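(* Let $m\ge 2$, $d\ge 3$ be integers and let $X=X_{m,d}=\nu_d(\mathbb{P}^m)\subset\mathbb{P}^N$, $N=\binom{m+d}{m}-1$, be the order $d$ Veronese variety. Set $\alpha:=\lfloor\binom{m+d-1}{m}/(m+1)\rfloor$. Let $t\ge 3$ be an integer such that $t\le\alpha-1$. There is a non-empty and irreducible codimension $1$ algebraic subset $\Gamma_1$ of $\sigma_t(X)$ with the following property: for every $P\in\Gamma_1$ there is a scheme $Z_P\subset X$ such that $P\in\langle Z_P\rangle$ and $Z_P$ has one connected component of degree $2$ and $t-2$ connected components of degree $1$ (and no others).
   Context: The base field is algebraically closed of characteristic zero. $\nu_d$ is the order $d$ Veronese embedding. $\sigma_t(X)$ is the Zariski closure of the union of the linear spans of $t$ points of $X$. $\langle Z\rangle$ denotes the linear span of a closed subscheme $Z\subset\mathbb{P}^N$ (the smallest linear subspace containing $Z$ as a subscheme). ''Algebraic subset'' here means a constructible subset, not necessarily closed. *)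

(* Defs.v *)
From HB Require Import structures.
From mathcomp Require Import all_boot all_order all_algebra.
From mathcomp Require Import boolp classical_sets topology.
From mathcomp Require Import mpoly.

Set Implicit Arguments.
Unset Strict Implicit.
Unset Printing Implicit Defensive.

Import GRing.Theory.
Local Open Scope classical_set_scope.
Local Open Scope ring_scope.

(* The closed points of P^n: the lines of k^(n+1). *)
Record proj (k : fieldType) (n : nat) :=
  Proj { pline :> {vspace 'rV[k]_n.+1} ; _ : \dim pline == 1%N }.

HB.instance Definition _ (k : fieldType) n := [isSub for @pline k n].
HB.instance Definition _ (k : fieldType) n := [Choice of proj k n by <:].

Lemma dim_vline_nz (k : fieldType) n (v : 'rV[k]_n.+1) :
  v != 0 -> \dim <[v]> == 1%N.
Proof. by rewrite dim_vline => ->. Qed.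

Definition pt (k : fieldType) n (v : 'rV[k]_n.+1) (v0 : v != 0) : proj k n :=
  Proj (dim_vline_nz v0).

Lemma pline_spanned (k : fieldType) n (p : proj k n) :
  vpick p != 0 /\ pline p = <[vpick p]>%VS.
Proof.
case: p => L /= /eqP dL.
have v0 : vpick L != 0 by rewrite vpick0 -dimv_eq0 dL.
split=> //; apply/esym/eqP; rewrite eqEdim dL dim_vline v0 andbT.
by rewrite -memvE memv_pick.
Qed.

Definition vanish (k : fieldType) n (f : {mpoly k[n.+1]}) (p : proj k n) :=
  forall v : 'rV[k]_n.+1, v \in pline p -> f.@[v 0] = 0.

Definition zeros (k : fieldType) n (S : set {mpoly k[n.+1]}) : set (proj k n) :=
  [set p | forall f, S f -> vanish f p].

Definition zclosed (k : fieldType) n (A : set (proj k n)) :=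
  exists2 S : set {mpoly k[n.+1]},
    forall f, S f -> exists e, f \is e.-homog & A = zeros S.

Lemma meval_scale (k : fieldType) n e (f : {mpoly k[n.+1]}) c
    (v : 'rV[k]_n.+1) :
  f \is e.-homog -> f.@[(c *: v) 0] = c ^+ e * f.@[v 0].
Proof.
move=> /dhomogP hf; rewrite !mevalE mulr_sumr big_seq [RHS]big_seq.
apply: eq_bigr => m /hf <-; rewrite mulrCA; congr (_ * _).
rewrite (eq_bigr (fun i => c ^+ m i * v 0 i ^+ m i)); last first.
  by move=> i _; rewrite !mxE exprMn.
by rewrite big_split /= -expr_sum mdegE.
Qed.

Lemma vanishE (k : fieldType) n e (f : {mpoly k[n.+1]}) (p : proj k n) :
  f \is e.-homog -> vanish f p <-> f.@[vpick p 0] = 0.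
Proof.
move=> hf; split; first by apply; rewrite memv_pick.
move=> f0 v; have [_ ->] := pline_spanned p => /vlineP[c ->].
by rewrite (meval_scale _ _ hf) f0 mulr0.
Qed.

Lemma zclosed_setT (k : fieldType) n : zclosed (~` [set: proj k n]).
Proof.
exists [set 1]; first by move=> f ->; exists 0%N; exact: dhomog1.
rewrite setCT; apply/seteqP; split=> // p /(_ 1 erefl).
move/(vanishE p (dhomog1 _ _)); rewrite meval1.
by move/eqP; rewrite oner_eq0.
Qed.

Lemma zclosed_setI (k : fieldType) n (A B : set (proj k n)) :
  zclosed (~` A) -> zclosed (~` B) -> zclosed (~` (A `&` B)).
Proof.
move=> [S hS SE] [T hT TE]; rewrite setCI SE TE.
exists [set fg | exists f g, [/\ S f, T g & fg = f * g]].
  move=> _ [f [g [/hS[a fa] /hT[b gb] ->]]].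
  by exists (a + b)%N; exact: dhomogM.
apply/seteqP; split=> [p [Sp|Tp] _ [f [g [Sf Tg ->]]] v vp|p].
- by rewrite mevalM (Sp f Sf v vp) mul0r.
- by rewrite mevalM (Tp g Tg v vp) mulr0.
move=> h; apply: contrapT => /not_orP[/existsNP[f /not_implyP[Sf nf]]].
move=> /existsNP[g /not_implyP[Tg ng]].
have [a fa] := hS f Sf; have [b gb] := hT g Tg.
have /(vanishE p (dhomogM fa gb)) : vanish (f * g) p by apply: h; exists f, g.
rewrite mevalM => /eqP; rewrite mulf_eq0 => /orP[]/eqP h0.
- by apply: nf; apply/(vanishE p fa).
- by apply: ng; apply/(vanishE p gb).
Qed.

Lemma zclosed_bigcup (k : fieldType) n (I : Type) (F : I -> set (proj k n)) :
  (forall i, zclosed (~` F i)) -> zclosed (~` (\bigcup_i F i)).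
Proof.
move=> /(_ _)/cid2 /= h.
exists (\bigcup_i s2val (h i)) => [f [i _]|].
  by case: (h i) => S /= hS _ /hS.
have hE i : ~` F i = zeros (s2val (h i)) by case: (h i).
rewrite setC_bigcup (eq_bigcapr (fun i _ => hE i)).
apply/seteqP; split=> [p Fp f [i _ Sf]|p Sp i _ f Sf]; first exact: (Fp i).
by apply: Sp; exists i.
Qed.

(* The Zariski topology. *)
HB.instance Definition _ (k : fieldType) n :=
  isOpenTopological.Build (proj k n) (op := [set A | zclosed (~` A)])
    (zclosed_setT k n) (@zclosed_setI k n) (@zclosed_bigcup k n).

Lemma closed_zclosed (k : fieldType) n (A : set (proj k n)) :
  closed A <-> zclosed A.
Proof. by rewrite -openC /open /= setCK. Qed.

Definition irreducible (T : topologicalType) (A : set T) :=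
  A !=set0 /\ forall F G : set T, closed F -> closed G ->
    A `<=` F `|` G -> A `<=` F \/ A `<=` G.

Definition constructible (T : topologicalType) (A : set T) :=
  exists r (U F : 'I_r -> set T),
    [/\ forall i, open (U i), forall i, closed (F i)
      & A = \bigcup_i (U i `&` F i)].

Definition irr_chain (T : topologicalType) (A Y : set T) (n : nat) :=
  exists C : nat -> set T,
    [/\ C 0%N = closure Y,
        forall i, (i <= n)%N -> [/\ closed (C i), irreducible (C i) & C i `<=` A]
      & forall i, (i < n)%N -> C i `<` C i.+1].

(* Codimension in a closed set A of an irreducible subset Y, which need not be
   closed and has by convention the codimension of its closure. *)
Definition codimension (T : topologicalType) (A Y : set T) (n : nat) :=
  irr_chain A Y n /\ forall r, irr_chain A Y r -> (r <= n)%N.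

Definition linear_space (k : fieldType) n (U : {vspace 'rV[k]_n.+1}) :
  set (proj k n) := [set p | (pline p <= U)%VS].

Definition secant_variety (k : fieldType) n (t : nat) (X : set (proj k n)) :
    set (proj k n) :=
  closure (\bigcup_(x in [set x : 'I_t -> proj k n | forall i, X (x i)])
             linear_space (\sum_(i < t) pline (x i))%VS).

Definition monomials (m d : nat) : seq 'X_{1..m.+1} :=
  [seq bmnm u | u <- enum [pred u : 'X_{1..m.+1 < d.+1} | mdeg u == d]].

Lemma mem_monomials m d u : (u \in monomials m d) = (mdeg u == d).
Proof.
apply/mapP/eqP => [[v]|ud]; first by rewrite mem_enum => /eqP ? ->.
have hu : (mdeg u < d.+1)%N by rewrite ud.
by exists (BMultinom hu) => //; rewrite mem_enum inE /= ud.
Qed.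

Lemma uniq_monomials m d : uniq (monomials m d).
Proof. by rewrite map_inj_uniq ?enum_uniq //; exact: val_inj. Qed.

Lemma size_monomials m d : size (monomials m d) = 'C(m + d, m).
Proof.
have -> : 'C(m + d, m) = 'C(d + m, d) by rewrite -bin_sub ?leq_addr // addKn addnC.
rewrite -(size_basis m d); apply/perm_size/uniq_perm.
- exact: uniq_monomials.
- exact: uniq_basis.
- by move=> u; rewrite mem_monomials basis_cover.
Qed.

Definition veronese_dim (m d : nat) : nat := 'C(m + d, m).-1.

Lemma veronese_dimS m d : (veronese_dim m d).+1 = 'C(m + d, m).
Proof. by rewrite prednK // bin_gt0 leq_addr. Qed.

Definition veronese_vec (k : fieldType) (m d : nat) (x : 'rV[k]_m.+1) :
    'rV[k]_(veronese_dim m d).+1 :=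
  \row_i ('X_[nth 0%MM (monomials m d) i]).@[x 0].

Lemma veronese_vec_neq0 (k : fieldType) m d (x : 'rV[k]_m.+1) :
  x != 0 -> veronese_vec d x != 0.
Proof.
move=> /rV0Pn[j xj]; pose u : 'X_{1..m.+1} := (U_(j) *+ d)%MM.
have hu : u \in monomials m d by rewrite mem_monomials mdegMn mdeg1 mul1n.
have hi : (index u (monomials m d) < (veronese_dim m d).+1)%N.
  by rewrite veronese_dimS -size_monomials index_mem.
apply/rV0Pn; exists (Ordinal hi).
rewrite mxE nth_index // -mpolyXn rmorphXn /= mevalXU expf_eq0.
by rewrite (negPf xj) andbF.
Qed.

Lemma veronese_vecZ (k : fieldType) m d c (x : 'rV[k]_m.+1) :
  veronese_vec d (c *: x) = c ^+ d *: veronese_vec d x.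
Proof.
apply/rowP => i; rewrite !mxE; apply: meval_scale.
rewrite dhomogX -mem_monomials mem_nth // size_monomials -veronese_dimS.
exact: ltn_ord.
Qed.

Definition veronese (k : fieldType) (m d : nat) (p : proj k m) :
    proj k (veronese_dim m d) :=
  pt (veronese_vec_neq0 d (pline_spanned p).1).

Lemma veronese_pt (k : fieldType) m d (x : 'rV[k]_m.+1) (x0 : x != 0) :
  veronese d (pt x0) = pt (veronese_vec_neq0 d x0).
Proof.
have [p0 _] := pline_spanned (pt x0).
have /vlineP[c E] : vpick (pt x0) \in <[x]>%VS := memv_pick _.
have c0 : c != 0 by apply: contraNneq p0; rewrite E => ->; rewrite scale0r.
apply/val_inj; apply/eqP; rewrite /= E veronese_vecZ.
rewrite eqEdim !dim_vline scaler_eq0 expf_eq0 (negPf c0) andbF /= leqnn andbT.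
by rewrite -memvE memvZ // memv_line.
Qed.

Definition veronese_variety (k : fieldType) (m d : nat) :
  set (proj k (veronese_dim m d)) := range (veronese d).
Arguments veronese_variety : clear implicits.

(* A closed subscheme of P^n is given by its saturated homogeneous ideal. *)
Record subscheme (k : fieldType) (n : nat) := Subscheme {
  ideal :> set {mpoly k[n.+1]} ;
  ideal0 : ideal 0 ;
  idealD : forall f g, ideal f -> ideal g -> ideal (f + g) ;
  idealM : forall f g, ideal g -> ideal (f * g) ;
  ideal_homog : forall f e, ideal f -> ideal (pihomog mdeg e f) ;
  ideal_sat : forall f,
    (forall i : 'I_n.+1, exists r, ideal ('X_i ^+ r * f)) -> ideal f }.

Definition supp (k : fieldType) n (Z : subscheme k n) : set (proj k n) :=
  zeros Z.

(* The scheme Z is contained in the closed set A with its reduced structure. *)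
Definition sub_closed (k : fieldType) n (Z : subscheme k n)
    (A : set (proj k n)) :=
  forall f : {mpoly k[n.+1]}, (forall p, A p -> vanish f p) -> ideal Z f.

Definition scheme_span (k : fieldType) n (Z : subscheme k n) : set (proj k n) :=
  \bigcap_(U in [set U : {vspace 'rV[k]_n.+1} | sub_closed Z (linear_space U)])
    linear_space U.

Lemma pihomogMl (k : fieldType) n c e (g f : {mpoly k[n]}) :
  g \is c.-homog -> pihomog mdeg (c + e) (g * f) = g * pihomog mdeg e f.
Proof.
move=> hg; have [K E] : exists K, f = \sum_(i < K) pihomog mdeg i f.
  by exists (mmeasure mdeg f); exact: pihomog_partitionE.
rewrite [in LHS]E [in RHS]E.
rewrite mulr_sumr !raddf_sum /= mulr_sumr; apply: eq_bigr => i _.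
have hi : pihomog mdeg i f \is i.-homog by exact: pihomogP.
case: (eqVneq (i : nat) e) => [<-|ne].
  by rewrite pihomog_id pihomog_dE //; exact: dhomogM.
rewrite (pihomog_ne0 ne hi) mulr0.
by apply: (@pihomog_ne0 _ _ _ (c + i)%N); [rewrite eqn_add2l|exact: dhomogM].
Qed.

Definition local_ideal (k : fieldType) n (Z : subscheme k n)
    (D : set (proj k n)) : set {mpoly k[n.+1]} :=
  [set f | forall p, D p -> exists c g,
     [/\ g \is c.-homog, ~ vanish g p & ideal Z (g * f)]].

Lemma nvanishM (k : fieldType) n c e (g h : {mpoly k[n.+1]}) p :
  g \is c.-homog -> h \is e.-homog -> ~ vanish g p -> ~ vanish h p ->
  ~ vanish (g * h) p.
Proof.
move=> hg hh ng nh /(vanishE p (dhomogM hg hh)); rewrite mevalM => /eqP.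
by rewrite mulf_eq0 => /orP[]/eqP h0; [apply: ng|apply: nh];
  [apply/(vanishE p hg)|apply/(vanishE p hh)].
Qed.

Section Restrict.
Context (k : fieldType) (n : nat) (Z : subscheme k n) (D : set (proj k n)).

Lemma local_ideal0 : local_ideal Z D 0.
Proof.
move=> p _; exists 0%N, 1; split; first exact: dhomog1.
  move/(vanishE p (dhomog1 _ _)); rewrite meval1.
  by move/eqP; rewrite oner_eq0.
by rewrite mulr0; exact: ideal0.
Qed.

Lemma local_idealD f g :
  local_ideal Z D f -> local_ideal Z D g -> local_ideal Z D (f + g).
Proof.
move=> hf hg p Dp; have [a [u [ua nu uf]]] := hf p Dp.
have [b [v [vb nv vg]]] := hg p Dp.
exists (a + b)%N, (u * v); split; [exact: dhomogM|exact: nvanishM ua vb nu nv|].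
rewrite mulrDr; apply: idealD; last by rewrite -mulrA; exact: idealM.
by rewrite mulrAC [_ * v]mulrC; exact: idealM.
Qed.

Lemma local_idealM f g : local_ideal Z D g -> local_ideal Z D (f * g).
Proof.
move=> hg p Dp; have [a [u [ua nu ug]]] := hg p Dp.
by exists a, u; split=> //; rewrite mulrCA; exact: idealM.
Qed.

Lemma local_ideal_homog f e :
  local_ideal Z D f -> local_ideal Z D (pihomog mdeg e f).
Proof.
move=> hf p Dp; have [a [u [ua nu uf]]] := hf p Dp.
exists a, u; split=> //; rewrite -(pihomogMl _ _ ua); exact: ideal_homog.
Qed.

Lemma local_ideal_sat f :
  (forall i : 'I_n.+1, exists r, local_ideal Z D ('X_i ^+ r * f)) ->
  local_ideal Z D f.
Proof.
move=> hf p Dp; have [/rV0Pn[i pi] _] := pline_spanned p.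
have [r /(_ p Dp)[a [u [ua nu uf]]]] := hf i.
have hX : ('X_i ^+ r : {mpoly k[n.+1]}) \is (1 * r)%N.-homog.
  by apply: dhomogMn; rewrite dhomogX; apply/eqP; exact: mdeg1.
exists (a + 1 * r)%N, (u * 'X_i ^+ r); split; first exact: dhomogM.
  apply: (nvanishM ua hX nu) => /(vanishE p hX).
  by rewrite rmorphXn /= mevalXU => /eqP; rewrite expf_eq0 (negPf pi) andbF.
by rewrite -mulrA.
Qed.

End Restrict.

(* For D open in the support of Z, the scheme structure of Z on D (more
   precisely its scheme-theoretic closure). *)
Definition restrict (k : fieldType) n (Z : subscheme k n) (D : set (proj k n)) :
    subscheme k n :=
  Subscheme (@local_ideal0 k n Z D) (@local_idealD k n Z D)
    (@local_idealM k n Z D) (@local_ideal_homog k n Z D)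
    (@local_ideal_sat k n Z D).

(* The degree e part of the homogeneous coordinate ring of Z has dimension r. *)
Definition hilbert_value (k : fieldType) n (Z : subscheme k n) (e r : nat) :=
  exists b : 'I_r -> {mpoly k[n.+1]},
    (forall i, b i \is e.-homog) /\
    forall f, f \is e.-homog ->
      exists! c : {ffun 'I_r -> k}, ideal Z (f - \sum_i c i *: b i).

(* The Hilbert polynomial of Z is the constant r; for r > 0, this says that Z
   is zero-dimensional of degree r. *)
Definition finite_of_degree (k : fieldType) n (Z : subscheme k n) (r : nat) :=
  exists e0, forall e, (e0 <= e)%N -> hilbert_value Z e r.

Definition components (k : fieldType) n (Z : subscheme k n) :
    set (set (proj k n)) :=
  [set connected_component (supp Z) p | p in supp Z].

Definition one_double_rest_simple (k : fieldType) n (Z : subscheme k n)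
    (s : nat) :=
  exists (D : set (proj k n)) (C : 'I_s -> set (proj k n)),
    [/\ injective C, components Z = D |` range C,
        finite_of_degree (restrict Z D) 2
      & forall i, finite_of_degree (restrict Z (C i)) 1].

Definition alpha (m d : nat) : nat := 'C(m + d - 1, m) %/ m.+1.

(* Main.v *)
Require Import Defs.
From HB Require Import structures.
From mathcomp Require Import all_boot all_order all_algebra.
From mathcomp Require Import boolp classical_sets topology.
From mathcomp Require Import mpoly.
From mathcomp Require Import closed_field.
From mathcomp Require Import zify ring lra.

Set Implicit Arguments.
Unset Strict Implicit.
Unset Printing Implicit Defensive.

Import Order.TTheory GRing.Theory Num.Theory.
Local Open Scope classical_set_scope.
Local Open Scope ring_scope.

(** The set [Gamma1] consists of the points [[y]] with
    [y = D + nu(v_3) + ... + nu(v_t)], where [nu] is the Veronese map on vectors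
    and [D] is the derivative of [nu] at a vector [v] in the direction [w]; the
    first coordinate of [v] is normalized to 1, and some minors are required not
    to vanish, so that [v] and [w] are independent and the points [[v]], [[v_i]]
    are distinct. Such a point lies in the span of the scheme that consists of
    the tangent vector at [nu(v)] and the points [nu(v_i)]
    ([jet_scheme_span], [jet_scheme_type], [veronese_jet_sub]). It lies in the
    secant variety because a tangent vector is a limit of secant vectors
    ([tangent_sum_secant]).

    [Gamma1] and a dense subset of the secant variety are images of principal
    open sets of affine spaces under polynomial maps; so they are irreducible
    ([irreducible_param_image]), and [Gamma1] is constructible by Chevalley's
    theorem, here a consequence of quantifier elimination
    ([constructible_param_image]). Dimensions are measured by algebraically
    independent functions on the affine cone ([cone_dim_ge]). Their number is at
    most the number of parameters, [t(m+1)] for the secant variety and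
    [t(m+1) - 1] for [Gamma1] ([param_cone_dim]), and it increases along chains
    of irreducible closed sets ([cone_dim_step]). So the codimension is 1 as soon
    as these bounds are attained ([power_sum_dim], [tangent_sum_dim]).

    That they are attained is shown by a monomial degeneration. Algebraic
    independence of polynomials follows from linear independence of the exponents
    of their leading terms with respect to a weight ([leads_independent]). The
    coordinates of [nu(v_1) + ... + nu(v_t)] are the sums over [i] of the
    monomials [v_i^u], so one needs disjoint groups of [m+1] linearly independent
    exponents [u] of degree [d], and for each group a linear form that is smaller
    there than the forms of the other groups. Dehomogenized, these groups are
    cells of lattice points of degree at most [d]. They are built by induction on
    the dimension: the points over a cell of dimension [m-1] form a stack of
    lines, which are traversed in zigzag and cut into runs of [m+1] points. Along
    a run the degree increases by at most one ([cell_deg_mono]), so the cells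
    inside the simplex of degree [d] cover all points of degree at most [d-1], and
    there are at least [C(m+d-1,m)/(m+1)] of them ([size_cells]): this is where
    [alpha] comes from. For [Gamma1], two neighbouring cells at a corner of the
    simplex contain the [2m+1] monomials that account for the tangent vector
    ([cell_point0], [cell_point_second]). *)

(** * Evaluation of polynomials *)

Lemma poly_cofinite_eq0 (k : closedFieldType) (p q : {poly k}) :
  q != 0 -> (forall s, q.[s] != 0 -> p.[s] = 0) -> p = 0.
Proof.
move=> q0 h; apply/eqP; apply: contraT => p0.
have /closed_nonrootP[s] : p * q != 0 by rewrite mulf_neq0.
by rewrite rootM negb_or !rootE => /andP[p1 /h p2]; rewrite p2 eqxx in p1.
Qed.

Lemma poly_punctured_eq0 (k : closedFieldType) (p : {poly k}) :
  (forall s, s != 0 -> p.[s] = 0) -> p = 0.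
Proof.
move=> h; apply: (@poly_cofinite_eq0 _ _ 'X); first by rewrite polyX_eq0.
by move=> s; rewrite hornerX; exact: h.
Qed.

Lemma horner_mmap (k : comNzRingType) n (h : 'I_n -> {poly k}) f s :
  (mmap polyC h f).[s] = f.@[fun i => (h i).[s]].
Proof.
rewrite mevalE /mmap horner_sum; apply: eq_bigr => m _.
rewrite hornerCM /mmap1 horner_prod; congr (_ * _).
by apply: eq_bigr => i _; rewrite horner_exp.
Qed.

Lemma muni_neq0 (k : fieldType) n (p : {mpoly k[n.+1]}) : p != 0 -> muni p != 0.
Proof.
move=> p0; apply/negP => /eqP mp0.
pose w (m : 'X_{1..n.+1}) : 'X_{1..n} :=
  [multinom m (widen_ord (leqnSn n) i) | i < n].
have E m : (muni p)`_(m ord_max)@_(w m) = p@_m.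
  rewrite muniE coef_sum raddf_sum /=.
  transitivity (\sum_(m' <- msupp p | m' == m) p@_m').
    rewrite [RHS]big_mkcond; apply: eq_bigr => m' _ /=.
    rewrite coefZ coefXn mulr_natr; case: (eqVneq m' m) => [->|ne].
      by rewrite eqxx mulr1n mcoeffZ mcoeffX eqxx mulr1.
    case: eqP => /= e; last by rewrite mulr0n mcoeff0.
    rewrite mulr1n mcoeffZ mcoeffX; case: eqP => [e'|_]; rewrite ?mulr0 //.
    case/eqP: ne; apply/mnmP => i; case: (unliftP ord_max i) => [j|] -> //.
    move/mnmP/(_ j): e'; rewrite !mnmE.
    by have -> : widen_ord (leqnSn n) j = lift ord_max j
      by apply/val_inj; rewrite /= /bump leqNgt ltn_ord.
  have [mp|/memN_msupp_eq0 p_m0] := boolP (m \in msupp p).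
    by rewrite -big_filter filter_pred1_uniq ?msupp_uniq // big_seq1.
  by rewrite big1 // => m' /eqP ->.
case/eqP: p0; apply/mpolyP => m.
by rewrite -E mp0 coef0 !mcoeff0.
Qed.

(** Induction on the number of variables: specialize all variables but one
    without killing the leading coefficient in the last one. *)
Lemma mpoly_nonroot (k : closedFieldType) n (p : {mpoly k[n]}) :
  p != 0 -> exists v : 'I_n -> k, p.@[v] != 0.
Proof.
elim: n p => [|n IH] p p0.
  exists (fun=> 0); move: p0; rewrite (nvar0_mpolyC p).
  by rewrite mevalC mpolyC_eq0.
have q0 := muni_neq0 p0; set q := muni p in q0.
have /IH[v' v'0] : lead_coef q != 0 by rewrite lead_coef_eq0.
have : map_poly (meval v') q != 0.
  apply: contraNneq v'0 => /(congr1 (fun r : {poly k} => r`_(size q).-1)).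
  by rewrite coef_map coef0 /= => ->.
case/closed_nonrootP => x; rewrite rootE => x0.
exists (fun i => if unlift ord_max i is Some j then v' j else x).
apply: contraNneq x0 => <-; apply/eqP.
rewrite /q muniE mevalE raddf_sum /= horner_sum; apply: eq_bigr => m _.
rewrite map_polyZ map_polyXn hornerZ hornerXn /= mevalZ mevalX -mulrA.
congr (_ * _).
rewrite big_ord_recr /= unlift_none; congr (_ * _); apply: eq_bigr => i _.
have -> : widen_ord (leqnSn n) i = lift ord_max i
  by apply/val_inj; rewrite /= /bump leqNgt ltn_ord.
rewrite liftK mnmE; congr (_ ^+ m _).
by apply/val_inj; rewrite /= /bump leqNgt ltn_ord.
Qed.

Lemma mpoly_ring_ind (R : comNzRingType) n (K : {mpoly R[n]} -> Prop) :
  (forall c, K c%:MP) -> (forall i, K 'X_i) ->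
  (forall p q, K p -> K q -> K (p + q)) ->
  (forall p q, K p -> K q -> K (p * q)) -> forall p, K p.
Proof.
move=> KC KX KD KM p; rewrite (mpolyE p).
elim/big_ind: _ => [|//|m _]; first exact: (KC 0).
rewrite -mul_mpolyC mpolyXE_id; apply: (KM _ _ (KC _)) _.
elim/big_ind: _ => [|//|i _]; first exact: (KC 1).
by elim: (m i) => [|e IH]; [exact: (KC 1)|rewrite exprS; exact: KM].
Qed.

Definition msubst (R : comNzRingType) r n (g : 'I_r -> {mpoly R[n]}) :
  {mpoly R[r]} -> {mpoly R[n]} := mmap (@mpolyC n R) g.

HB.instance Definition _ (R : comNzRingType) r n (g : 'I_r -> {mpoly R[n]}) :=
  GRing.RMorphism.copy (msubst g) (mmap (@mpolyC n R) g).

Lemma msubstE (R : comNzRingType) r n (g : 'I_r -> {mpoly R[n]}) P :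
  msubst g P = \sum_(m <- msupp P) P@_m *: \prod_i g i ^+ m i.
Proof. by apply: eq_bigr => m _; rewrite mul_mpolyC. Qed.

Lemma msubstX (R : comNzRingType) r n (g : 'I_r -> {mpoly R[n]}) i :
  msubst g 'X_i = g i.
Proof. by rewrite /msubst mmapX mmap1U. Qed.

Lemma msubstXm (R : comNzRingType) r n (g : 'I_r -> {mpoly R[n]}) m :
  msubst g 'X_[m] = \prod_i g i ^+ m i.
Proof. by rewrite /msubst mmapX. Qed.

Lemma msubstC (R : comNzRingType) r n (g : 'I_r -> {mpoly R[n]}) c :
  msubst g c%:MP = c%:MP.
Proof. by rewrite /msubst mmapC. Qed.

Lemma meval_msubst (R : comNzRingType) r n (g : 'I_r -> {mpoly R[n]}) P v :
  (msubst g P).@[v] = P.@[fun i => (g i).@[v]].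
Proof.
rewrite msubstE raddf_sum mevalE; apply: eq_bigr => m _ /=.
by rewrite mevalZ rmorph_prod; under eq_bigr do rewrite rmorphXn.
Qed.

Lemma msubst_comp (R : comNzRingType) q r n (g : 'I_r -> {mpoly R[n]})
    (h : 'I_q -> {mpoly R[r]}) P :
  msubst g (msubst h P) = msubst (fun i => msubst g (h i)) P.
Proof.
rewrite [msubst h P]msubstE [RHS]msubstE raddf_sum; apply: eq_bigr => m _ /=.
rewrite -!mul_mpolyC rmorphM /= msubstC rmorph_prod; congr (_ * _).
by apply: eq_bigr => i _; rewrite rmorphXn.
Qed.

(** The chain rule, along a polynomial curve: both sides are derivations that
    agree on the variables. *)
Lemma deriv_mmap (k : comNzRingType) n (h : 'I_n -> {poly k}) f :
  (mmap polyC h f)^`() = \sum_i mmap polyC h f^`M(i) * (h i)^`().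
Proof.
elim/mpoly_ring_ind: f => [c|i|f g Df Dg|f g Df Dg].
- by rewrite mmapC derivC big1 // => i _; rewrite mderivC raddf0 mul0r.
- rewrite mmapX mmap1U (bigD1 i) //= mderivX mnm1E eqxx scale1r.
  have -> : (U_(i) - U_(i) = 0)%MM by apply/mnmP => j; rewrite mnmBE subnn mnm0E.
  rewrite mmapX mmap11 mul1r big1 ?addr0 // => j ji.
  by rewrite mderivX mnm1E eq_sym (negPf ji) scale0r raddf0 mul0r.
- rewrite raddfD derivD Df Dg -big_split; apply: eq_bigr => i _.
  by rewrite mderivD raddfD mulrDl.
rewrite rmorphM /= derivM Df Dg mulr_suml mulr_sumr -big_split.
by apply: eq_bigr => i _; rewrite mderivM raddfD /= !rmorphM /=; ring.
Qed.

(** * Vanishing and closed sets *)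

Section Zariski.
Variables (k : closedFieldType) (n : nat).
Implicit Types (p : proj k n) (f g : {mpoly k[n.+1]}) (A C : set (proj k n)).

Definition restrict_line (x : 'rV[k]_n.+1) f : {poly k} :=
  mmap polyC (fun i => (x 0 i)%:P * 'X) f.

Lemma horner_restrict_line x f s : (restrict_line x f).[s] = f.@[(s *: x) 0].
Proof.
rewrite horner_mmap; apply: meval_eq => i.
by rewrite hornerM hornerC hornerX mxE mulrC.
Qed.

Lemma restrict_line_homog x e f : f \is e.-homog ->
  restrict_line x f = (f.@[x 0])%:P * 'X^e.
Proof.
move=> /dhomogP fe; rewrite /restrict_line /mmap mevalE raddf_sum mulr_suml /=.
rewrite big_seq [RHS]big_seq; apply: eq_bigr => m /fe /= <-.
rewrite polyCM -mulrA; congr (_ * _); rewrite /mmap1.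
rewrite (eq_bigr (fun i => (x 0 i)%:P ^+ m i * 'X ^+ m i)); last first.
  by move=> i _; rewrite -exprMn.
rewrite big_split /= rmorph_prod; congr (_ * _).
  by apply: eq_bigr => i _; rewrite rmorphXn.
by rewrite prodrXr mdegE.
Qed.

Lemma coef_restrict_line x f e : (restrict_line x f)`_e = (pihomog mdeg e f).@[x 0].
Proof.
rewrite {1}(@pihomog_partitionE _ _ mdeg _ f (leqnn _)) [restrict_line _ _]raddf_sum.
rewrite coef_sum /=.
under eq_bigr => i _ do
  rewrite -/(restrict_line x _) (restrict_line_homog _ (pihomogP mdeg i f)) coefCM coefXn.
set K := mmeasure _ _; case: (ltnP e K) => [eK|Ke].
  rewrite (bigD1 (Ordinal eK)) //= eqxx mulr1 big1 ?addr0 // => i ie.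
  by rewrite [e == i]eq_sym (_ : (_ == _) = false) ?mulr0 //; exact/negbTE.
rewrite big1 => [|i _]; last by rewrite gtn_eqF ?mulr0 // (leq_trans _ Ke).
rewrite pihomogE big_seq_cond big1 ?meval0 // => m /andP[/mmeasure_mnm_lt + /eqP].
by move=> /(_ mdeg); rewrite -/K /= => + E; rewrite E ltnNge Ke.
Qed.

Lemma vanish_line f p x : pline p = <[x]>%VS -> vanish f p <-> restrict_line x f = 0.
Proof.
move=> px; split=> [fp|f0 v]; last first.
  by rewrite px => /vlineP[s ->]; rewrite -horner_restrict_line f0 horner0.
apply: (@poly_cofinite_eq0 _ _ 1) => [|s _]; first exact: oner_neq0.
by rewrite horner_restrict_line; apply: fp; rewrite px memvZ ?memv_line.
Qed.

Lemma vanish_pihomogP f p : vanish f p <-> forall e, vanish (pihomog mdeg e f) p.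
Proof.
have [_ px] := pline_spanned p; rewrite (vanish_line _ px).
have E e : vanish (pihomog mdeg e f) p <-> (restrict_line (vpick p) f)`_e = 0.
  by rewrite coef_restrict_line (vanishE p (pihomogP _ _ _)).
split=> [f0 e|h]; first by apply/E; rewrite f0 coef0.
by apply/polyP => e; rewrite coef0; apply/E.
Qed.

Lemma vanish_mull f g p : vanish g p -> vanish (f * g) p.
Proof. by move=> gp v vp; rewrite mevalM gp ?mulr0. Qed.

Lemma vanishM f g p : vanish (f * g) p -> vanish f p \/ vanish g p.
Proof.
have [_ px] := pline_spanned p; rewrite !(vanish_line _ px).
rewrite [restrict_line _ _]rmorphM => /eqP; rewrite mulf_eq0.
by case/orP => /eqP; [left|right].
Qed.

(** The polynomial need not be homogeneous: as the field is infinite, vanishing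
    on a line through the origin amounts to the vanishing of all homogeneous
    components. *)
Lemma closed_vanish f : closed [set p | vanish f p].
Proof.
apply/closed_zclosed; exists [set g | exists e, g = pihomog mdeg e f].
  by move=> _ [e ->]; exists e; exact: pihomogP.
apply/seteqP; split=> p /=.
  by move=> /vanish_pihomogP h _ [e ->].
by move=> h; apply/vanish_pihomogP => e; apply: h; exists e.
Qed.

(** The ideal of the affine cone over [A], without restriction to forms, so that
    it is an ideal of the full polynomial ring. *)
Definition cone_ideal A f := forall p, A p -> vanish f p.

Lemma cone_ideal_closure A f : cone_ideal (closure A) f <-> cone_ideal A f.
Proof.
split=> fA p Ap; first by apply: fA; exact: subset_closure.
suff : closure A `<=` [set q | vanish f q] by exact.
rewrite (closure_id [set q | vanish f q]).1; first exact: closure_subset.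
exact: closed_vanish.
Qed.

Lemma closureP A p : closure A p <-> forall f, cone_ideal A f -> vanish f p.
Proof.
split=> [pA f /cone_ideal_closure|h]; first exact.
have /closed_zclosed[S hS E] := @closed_closure _ A.
rewrite E => f Sf; apply: h; apply/cone_ideal_closure => q.
by rewrite E => /(_ f Sf).
Qed.

Lemma eq_closure A B :
  (forall f, cone_ideal A f <-> cone_ideal B f) -> closure A = closure B.
Proof.
by move=> h; apply/seteqP; split=> p /closureP pA; apply/closureP => f /h; apply: pA.
Qed.

Lemma cone_ideal_prime C f g : irreducible C ->
  cone_ideal C (f * g) -> cone_ideal C f \/ cone_ideal C g.
Proof.
move=> [_ irr] fg.
have [p /fg|Cf|Cg] := irr _ _ (@closed_vanish f) (@closed_vanish g).
- exact: vanishM.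
- by left => p /Cf.
- by right => p /Cg.
Qed.

Lemma closed_separated C C' : closed C -> C `<` C' ->
  exists2 f, cone_ideal C f & ~ cone_ideal C' f.
Proof.
move=> Ccl [_ C'C]; apply: contrapT => /forall2NP h; apply: C'C => p C'p.
rewrite (closure_id C).1 //; apply/closureP => f fC.
by have [//|/contrapT] := h f; apply.
Qed.

Lemma irreducible_closure A : irreducible A -> irreducible (closure A).
Proof.
move=> [[p Ap] irr]; split=> [|F G Fc Gc AFG].
  by exists p; exact: subset_closure.
have [|AF|AG] := irr F G Fc Gc; first exact: subset_trans (@subset_closure _ A) AFG.
  by left; rewrite (closure_id F).1 //; exact: closure_subset.
by right; rewrite (closure_id G).1 //; exact: closure_subset.
Qed.

(** A parametrization reaches only the nonzero multiples of a vector; vanishing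
    extends to the origin along the line. *)
Lemma vanish_punctured f p x : pline p = <[x]>%VS ->
  (forall s, s != 0 -> f.@[(s *: x) 0] = 0) -> vanish f p.
Proof.
move=> px h; apply/(vanish_line _ px); apply: poly_punctured_eq0 => s s0.
by rewrite horner_restrict_line h.
Qed.

Lemma pt_of_line p x : pline p = <[x]>%VS -> x != 0.
Proof.
move=> px; apply: contra_eq_neq px => ->; case: p => L /= /eqP dL.
by apply: contra_eqN dL => /eqP ->; rewrite dim_vline eqxx.
Qed.

End Zariski.

(** * Algebraic independence *)

Lemma msubst_id (R : comNzRingType) n (P : {mpoly R[n]}) :
  msubst (fun i => 'X_i) P = P.
Proof.
rewrite [RHS]mpolyE msubstE; apply: eq_bigr => m _.
by rewrite -mpolyXE_id.
Qed.

(** Substitutions that agree modulo [z] on the variables agree modulo [z]; with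
    one of them the identity, this splits off the terms divisible by a variable. *)
Lemma msubst_congr (R : comNzRingType) r n (g h : 'I_r -> {mpoly R[n]}) z :
  (forall i, exists q, g i = h i + z * q) ->
  forall P, exists q, msubst g P = msubst h P + z * q.
Proof.
move=> gh; elim/mpoly_ring_ind => [c|i|P Q [p Ep] [q Eq]|P Q [p Ep] [q Eq]].
- by exists 0; rewrite !msubstC mulr0 addr0.
- by rewrite !msubstX; exact: gh.
- by exists (p + q); rewrite !raddfD /= Ep Eq; ring.
exists (msubst h P * q + p * msubst h Q + z * p * q).
by rewrite !rmorphM /= Ep Eq; ring.
Qed.

Definition deg_le (R : nzRingType) n (p : {mpoly R[n]}) e :=
  forall m, m \in msupp p -> (mdeg m <= e)%N.

Lemma deg_leM (R : comNzRingType) n (p q : {mpoly R[n]}) a b :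
  deg_le p a -> deg_le q b -> deg_le (p * q) (a + b).
Proof.
move=> pa qb m /msuppM_le /allpairsP[[m1 m2] /= [/pa h1 /qb h2 ->]].
by rewrite mdegD leq_add.
Qed.

Lemma deg_leX (R : comNzRingType) n (p : {mpoly R[n]}) a e :
  deg_le p a -> deg_le (p ^+ e) (e * a).
Proof.
move=> pa; elim: e => [|e IH]; last by rewrite exprS mulSn; exact: deg_leM.
by move=> m; rewrite expr0 -mpolyC1 msuppC oner_eq0 inE => /eqP ->; rewrite mdeg0.
Qed.

(** More polynomials than variables satisfy a relation: there are more
    monomials of bounded degree in the former than values to combine. *)
Lemma mpoly_dependent (k : fieldType) r n (y : 'I_r -> {mpoly k[n]}) :
  (n < r)%N -> exists2 P : {mpoly k[r]}, P != 0 & msubst y P = 0.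
Proof.
move=> nr; pose e := (\max_i msize (y i))%N.
have ye i : deg_le (y i) e.
  move=> m /msize_mdeg_lt /ltnW /leq_trans -> //.
  exact: (leq_bigmax (F := fun i => msize (y i))).
(* With exponents below [D], the products have exponents below [M], and [D] is
   chosen such that [M ^ n < D ^ n.+1 <= D ^ r]. *)
pose D := ((r * e).+1 ^ n).+1; pose M := (r * (D * e)).+1.
pose T := {ffun 'I_r -> 'I_D}; pose S := {ffun 'I_n -> 'I_M}.
have TS : (#|S| < #|T|)%N.
  rewrite !card_ffun !card_ord.
  apply: (@leq_trans (D ^ n.+1)); last exact: leq_pexp2l.
  apply: (@leq_ltn_trans (((r * e).+1 * D) ^ n)).
    case: (posnP n) => [->|n0]; first by rewrite !expn0.
    by rewrite leq_exp2r // /M mulSn [(D * e)%N]mulnC mulnA -add1n leq_add2r //.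
  by rewrite expnMn expnS ltn_pmul2r ?expn_gt0.
pose mon q B (a : {ffun 'I_q -> 'I_B}) : 'X_{1..q} := [multinom (a i : nat) | i < q].
pose A := \matrix_(i < #|T|, j < #|S|)
  (\prod_l y l ^+ (enum_val i : T) l)@_(mon n M (enum_val j)).
have /rowV0Pn[v /sub_kermxP vA v0] : kermx A != 0.
  rewrite kermx_eq0 /row_free; apply: contraL TS => /eqP <-.
  by rewrite -leqNgt rank_leq_col.
exists (\sum_i v 0 i *: 'X_[mon r D (enum_val i)]).
  case/rV0Pn: v0 => i vi; apply: contraNneq vi.
  move/(congr1 (mcoeff (mon r D (enum_val i)))).
  rewrite mcoeff0 raddf_sum (bigD1 i) //= mcoeffZ mcoeffX eqxx mulr1.
  rewrite big1 ?addr0 => [->//|j ji].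
  rewrite mcoeffZ mcoeffX; case: eqP => [E|]; last by rewrite mulr0.
  case/eqP: ji; apply/enum_val_inj/ffunP => l.
  by move/mnmP/(_ l): E; rewrite !mnmE => /val_inj.
have -> : msubst y (\sum_i v 0 i *: 'X_[mon r D (enum_val i)]) =
    \sum_i v 0 i *: \prod_l y l ^+ (enum_val i : T) l.
  rewrite raddf_sum; apply: eq_bigr => i _ /=.
  rewrite -mul_mpolyC rmorphM /= msubstC msubstXm mul_mpolyC; congr (_ *: _).
  by apply: eq_bigr => l _; rewrite mnmE.
apply/mpolyP => m; rewrite mcoeff0 raddf_sum /=.
have [mM|] := boolP [forall l, (m l < M)%N].
  have lt l : (m l < M)%N by exact: (forallP mM).
  pose b : S := [ffun l => Ordinal (lt l)].
  have -> : m = mon n M (enum_val (enum_rank b)).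
    by apply/mnmP => l; rewrite enum_rankK mnmE ffunE.
  move/rowP/(_ (enum_rank b)): vA; rewrite !mxE => vA; rewrite -[RHS]vA.
  by apply: eq_bigr => i _; rewrite mcoeffZ mxE.
rewrite negb_forall => /existsP[l]; rewrite -leqNgt => Ml.
rewrite big1 // => i _; rewrite mcoeffZ memN_msupp_eq0 ?mulr0 //.
apply/negP; set a : T := enum_val i.
have : deg_le (\prod_l y l ^+ a l) (\sum_(l < r) D * e).
  elim/big_rec2: _ => [|j q p _ pq].
    by move=> m'; rewrite -mpolyC1 msuppC oner_eq0 inE => /eqP ->; rewrite mdeg0.
  apply: deg_leM => // m' /(deg_leX (ye j)) /leq_trans -> //.
  by rewrite leq_mul2r orbC ltnW.
move=> + h => /(_ m h); rewrite sum_nat_const card_ord mdegE (bigD1 l) //=.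
by move: Ml; rewrite /M; lia.
Qed.

Section Dimension.
Variables (k : closedFieldType) (n : nat).
Implicit Types C : set (proj k n).

(** The dimension of the affine cone over [C], that is, the transcendence
    degree of its coordinate ring, is at least [r]. *)
Definition cone_dim_ge C r := exists y : 'I_r -> {mpoly k[n.+1]},
  forall P : {mpoly k[r]}, cone_ideal C (msubst y P) -> P = 0.

(** To [r] functions independent on [C] one adds a function that vanishes on
    [C] but not on the larger irreducible set: a relation between them can be
    divided by the last variable, as it would otherwise restrict to a relation
    on [C]. *)
Lemma cone_dim_step C C' r : irreducible C' -> closed C -> C `<` C' ->
  cone_dim_ge C r -> cone_dim_ge C' r.+1.
Proof.
move=> irr Ccl CC' [y yC]; have [f fC fC'] := closed_separated Ccl CC'.
pose y' i := if unlift ord_max i is Some j then y j else f.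
exists y' => P; move: {2}(msize P) (leqnn (msize P)) => N.
elim: N P => [|N IH] P PN hP.
  by apply/eqP; rewrite -msize_poly_eq0 -leqn0.
pose W (j : 'I_r) : {mpoly k[r.+1]} := 'X_(lift ord_max j).
pose Z i : {mpoly k[r]} := if unlift ord_max i is Some j then 'X_j else 0.
have [i|P1 EP] := @msubst_congr _ _ _ (fun i => 'X_i)
    (fun i => msubst W (Z i)) 'X_ord_max _ P.
  rewrite /Z; case: unliftP => [j ->|->]; first by exists 0; rewrite msubstX mulr0 addr0.
  by exists 1; rewrite raddf0 add0r mulr1.
rewrite -msubst_comp msubst_id in EP.
have Ey : msubst y' P = msubst y (msubst Z P) + f * msubst y' P1.
  rewrite {1}EP raddfD /= rmorphM /= msubstX {2}/y' unlift_none msubst_comp.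
  have -> // : (fun j => msubst y' (W j)) = y.
  by apply/funext => j; rewrite msubstX /y' liftK.
have Z0 : msubst Z P = 0.
  apply: yC => p Cp v vp; have := hP p (CC'.1 _ Cp) v vp.
  by rewrite Ey mevalD mevalM (fC p Cp v vp) mul0r addr0.
rewrite Z0 raddf0 add0r in EP; rewrite Z0 raddf0 add0r in Ey.
suff P10 : P1 = 0 by rewrite EP P10 mulr0.
have [//|P10] := eqVneq P1 0; apply: IH.
  have X0 : 'X_ord_max != 0 :> {mpoly k[r.+1]}.
    by rewrite -msize_poly_eq0 msizeX.
  by move: PN; rewrite EP msizeM // msizeX mdeg1 add2n.
by rewrite Ey in hP; case: (cone_ideal_prime irr hP).
Qed.

End Dimension.

(** * Parametrized cones *)

Lemma vlineZ (k : fieldType) (V : vectType k) c (v : V) :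
  c != 0 -> <[c *: v]>%VS = <[v]>%VS.
Proof.
move=> c0; apply/eqP; rewrite eqEdim !dim_vline scaler_eq0 (negPf c0) leqnn andbT.
by rewrite -memvE memvZ // memv_line.
Qed.

Section Parametrized.
Variables (k : closedFieldType) (n N : nat) (g : 'I_N.+1 -> {mpoly k[n]}).
Implicit Types (a : 'I_n -> k) (Q : {mpoly k[n]}) (f : {mpoly k[N.+1]}).

Definition param_vec a : 'rV[k]_N.+1 := \row_u (g u).@[a].

(** The points of projective space with affine representatives [param_vec a],
    for [a] in a principal open set of the affine space of parameters. *)
Definition param_image Q : set (proj k N) :=
  [set p | exists2 a, Q.@[a] != 0 & pline p = <[param_vec a]>%VS].

(** The cone property of the set of all [param_vec a], as opposed to the cone
    over it. *)
Definition cone_stable := forall a c, c != 0 ->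
  exists a', param_vec a' = c *: param_vec a.

Lemma meval_param f a : f.@[param_vec a 0] = (msubst g f).@[a].
Proof. by rewrite meval_msubst; apply: meval_eq => u; rewrite mxE. Qed.

Lemma param_image_point Q : (exists u, g u != 0) -> Q != 0 ->
  param_image Q !=set0.
Proof.
move=> [u gu0] Q0; have [a] := mpoly_nonroot (mulf_neq0 Q0 gu0).
rewrite mevalM mulf_eq0 negb_or => /andP[Qa ga].
have a0 : param_vec a != 0 by apply/rV0Pn; exists u; rewrite mxE.
by exists (pt a0); exists a.
Qed.

(** A function that vanishes at the points [param_vec a] with [Q.@[a] != 0] gives
    zero after multiplication by [Q] and by a nonzero coordinate [g u]; both are
    injective operations. *)
Lemma cone_ideal_param Q f : (exists u, g u != 0) -> Q != 0 ->
  cone_ideal (param_image Q) f -> msubst g f = 0.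
Proof.
move=> [u gu0] Q0 fI; apply/eqP; apply: contraT => f0.
have [a] := mpoly_nonroot (mulf_neq0 (mulf_neq0 Q0 gu0) f0).
rewrite !mevalM !mulf_eq0 !negb_or => /andP[/andP[Qa ga]].
have a0 : param_vec a != 0 by apply/rV0Pn; exists u; rewrite mxE.
rewrite -meval_param (fI (pt a0)) ?eqxx //; first by exists a.
exact: memv_line.
Qed.

Hypothesis stable : cone_stable.

Lemma param_cone_ideal Q f : msubst g f = 0 -> cone_ideal (param_image Q) f.
Proof.
move=> f0 p [a _ pa]; apply: (vanish_punctured pa) => s s0.
by have [a' <-] := stable a s0; rewrite meval_param f0 meval0.
Qed.

(** Substitution of [g] identifies the functions on the image with a subring of
    a polynomial ring, which is an integral domain. *)
Lemma irreducible_param_image Q : (exists u, g u != 0) -> Q != 0 ->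
  irreducible (param_image Q).
Proof.
move=> g0 Q0; split=> [|F G Fc Gc FG]; first exact: param_image_point.
have sub H : closed H -> (forall f, cone_ideal H f -> msubst g f = 0) ->
    param_image Q `<=` H.
  move=> Hc h p Ip; rewrite (closure_id H).1 //; apply/closureP => f /h f0.
  exact: (param_cone_ideal f0 Ip).
have [|/existsNP[f /not_implyP[fF /eqP f0]]] :=
  pselect (forall f, cone_ideal F f -> msubst g f = 0); first by left; exact: sub.
right; apply: sub => // f' fG.
have /(cone_ideal_param g0 Q0)/eqP : cone_ideal (param_image Q) (f * f').
  move=> p /FG[/fF h|/fG h]; last exact: vanish_mull.
  by rewrite mulrC; exact: vanish_mull.
by rewrite rmorphM mulf_eq0 (negPf f0) => /eqP.
Qed.

Lemma cone_dim_param Q r (y : 'I_r -> 'I_N.+1) : (exists u, g u != 0) -> Q != 0 ->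
  (forall P : {mpoly k[r]}, msubst (g \o y) P = 0 -> P = 0) ->
  cone_dim_ge (closure (param_image Q)) r.
Proof.
move=> g0 Q0 indep; exists (fun i => 'X_(y i)) => P.
move/cone_ideal_closure/(cone_ideal_param g0 Q0); rewrite msubst_comp => h.
apply: indep; rewrite -[RHS]h; congr msubst; apply/funext => i.
by rewrite msubstX.
Qed.

(** A relation between the substituted functions is a relation on the cone. *)
Lemma param_cone_dim C Q r : C `<=` closure (param_image Q) ->
  cone_dim_ge C r -> (r <= n)%N.
Proof.
move=> CI [y yC]; rewrite leqNgt; apply/negP => nr.
have [P P0 yP] := mpoly_dependent (fun i => msubst g (y i)) nr.
move/eqP: P0; apply; apply: yC => p /CI; move: p.
by apply/cone_ideal_closure/param_cone_ideal; rewrite msubst_comp.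
Qed.

End Parametrized.

(** * Constructible sets *)

Section Constructible.
Variable T : topologicalType.
Implicit Types A B : set T.

Lemma constructible_fin (I : finType) (U F : I -> set T) :
  (forall i, open (U i)) -> (forall i, closed (F i)) ->
  constructible (\bigcup_i (U i `&` F i)).
Proof.
move=> Uo Fc; exists #|I|, (U \o enum_val), (F \o enum_val).
split=> [i|i|]; [exact: Uo|exact: Fc|].
apply/seteqP; split=> x [i _ h]; last by exists (enum_val i).
by exists (enum_rank i) => //=; rewrite enum_rankK.
Qed.

Lemma constructibleU A B :
  constructible A -> constructible B -> constructible (A `|` B).
Proof.
move=> [r [U [F [Uo Fc ->]]]] [s [V [G [Vo Gc ->]]]].
pose cat (X : 'I_r -> set T) (Y : 'I_s -> set T) i :=
  match i with inl i => X i | inr j => Y j end.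
rewrite (_ : _ `|` _ = \bigcup_i (cat U V i `&` cat F G i)).
  by apply: constructible_fin => -[].
apply/seteqP; split=> x; first by case=> -[i _ h]; [exists (inl i)|exists (inr i)].
by case=> -[i|i] _ h; [left|right]; exists i.
Qed.

Lemma constructibleI A B :
  constructible A -> constructible B -> constructible (A `&` B).
Proof.
move=> [r [U [F [Uo Fc ->]]]] [s [V [G [Vo Gc ->]]]].
rewrite (_ : _ `&` _ =
    \bigcup_(i : 'I_r * 'I_s) ((U i.1 `&` V i.2) `&` (F i.1 `&` G i.2))).
  apply: constructible_fin => i; first exact: openI.
  exact: closedI.
  apply/seteqP; split=> x.
  by move=> [[i _ [Ui Fi]] [j _ [Vj Gj]]]; exists (i, j).
by move=> [[i j] _ [[Ui Vj] [Fi Gj]]]; split; [exists i|exists j].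
Qed.

Lemma closed_constructible A : closed A -> constructible A.
Proof.
move=> Ac; exists 1%N, (fun=> setT), (fun=> A); split=> // [i|]; first exact: openT.
by apply/seteqP; split=> x; [move=> h; exists ord0|case=> i _ []].
Qed.

Lemma open_constructible A : open A -> constructible A.
Proof.
move=> Ao; exists 1%N, (fun=> A), (fun=> setT); split=> //.
by apply/seteqP; split=> x; [move=> h; exists ord0|case=> i _ []].
Qed.

Lemma constructible_bigcup (I : finType) (A : I -> set T) :
  (forall i, constructible (A i)) -> constructible (\bigcup_i A i).
Proof.
move=> Ac; suff h (s : seq I) : constructible (\bigcup_(i in [set` s]) A i).
  suff -> : [set: I] = [set` enum I] by [].
  by apply/seteqP; split=> i //= _; rewrite mem_enum.
elim: s => [|i s IH].
  rewrite (_ : \bigcup_(_ in _) _ = set0); last by apply/seteqP; split=> x [].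
  exact/closed_constructible/closed0.
rewrite (_ : \bigcup_(_ in _) _ = A i `|` \bigcup_(j in [set` s]) A j).
  exact: constructibleU.
apply/seteqP; split=> x.
  by case=> j /=; rewrite inE => /orP[/eqP ->|js] h; [left|right; exists j].
case=> [h|[j /= js h]]; first by exists i; rewrite //= inE eqxx.
by exists j; rewrite //= inE js orbT.
Qed.

(** The sets that are constructible together with their complement form a
    Boolean algebra by construction. *)
Definition biconstructible A := constructible A /\ constructible (~` A).

Lemma biconstructibleC A : biconstructible A -> biconstructible (~` A).
Proof. by case=> a b; split; rewrite ?setCK. Qed.

Lemma biconstructibleU A B :
  biconstructible A -> biconstructible B -> biconstructible (A `|` B).
Proof.
case=> a a' [b b']; split; first exact: constructibleU.
by rewrite setCU; exact: constructibleI.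
Qed.

Lemma biconstructibleI A B :
  biconstructible A -> biconstructible B -> biconstructible (A `&` B).
Proof.
by move=> a b; rewrite -[A `&` B]setCK setCI; apply: biconstructibleC;
  apply: biconstructibleU; exact: biconstructibleC.
Qed.

Lemma closed_biconstructible A : closed A -> biconstructible A.
Proof.
by move=> Ac; split; [exact: closed_constructible|apply/open_constructible/closed_openC].
Qed.

End Constructible.

(** * Chevalley's theorem *)

Section TermOfMpoly.
Variables (k : fieldType) (n : nat) (V : 'I_n -> GRing.term k).

(** The term of the language of rings in which [V i] stands for the [i]-th
    variable of [f]. *)
Definition mpoly_term (f : {mpoly k[n]}) : GRing.term k :=
  foldr (fun m t => GRing.Add (GRing.Mul (GRing.Const f@_m)
    (foldr (fun i u => GRing.Mul (GRing.Exp (V i) (m i)) u) (GRing.NatConst k 1)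
       (enum 'I_n))) t) (GRing.NatConst k 0) (msupp f).

Lemma eval_mpoly_term e f :
  GRing.eval e (mpoly_term f) = f.@[fun i => GRing.eval e (V i)].
Proof.
rewrite mevalE /mpoly_term; elim: (msupp f) => [|m s IH]; rewrite ?big_nil //=.
rewrite big_cons IH; congr (_ * _ + _); rewrite -big_enum /=.
by elim: (enum _) => [|i s' IH']; rewrite ?big_nil //= big_cons IH'.
Qed.

Lemma rterm_mpoly_term f : (forall i, GRing.rterm (V i)) ->
  GRing.rterm (mpoly_term f).
Proof.
move=> rV; rewrite /mpoly_term; elim: (msupp f) => //= m s ->; rewrite andbT.
by elim: (enum _) => //= i s' ->; rewrite rV.
Qed.

End TermOfMpoly.

Section Chevalley.
Variables (k : closedFieldType) (N : nat).

Definition env_of (x : 'rV[k]_N.+1) : seq k := [seq x 0 j | j <- enum 'I_N.+1].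

Lemma nth_env_of x (j : 'I_N.+1) : (env_of x)`_j = x 0 j.
Proof. by rewrite (nth_map ord0) ?size_enum_ord // nth_ord_enum. Qed.

Lemma mpoly_of_rterm (t : GRing.term k) : GRing.rterm t ->
  exists h : {mpoly k[N.+1]}, forall x, GRing.eval (env_of x) t = h.@[x 0].
Proof.
elim: t => //=.
- move=> j _; case: (ltnP j N.+1) => [jN|Nj].
    by exists 'X_(Ordinal jN) => x; rewrite mevalXU -nth_env_of.
  by exists 0 => x; rewrite meval0 nth_default // size_map size_enum_ord.
- by move=> c _; exists c%:MP => x; rewrite mevalC.
- by move=> c _; exists (c%:R)%:MP => x; rewrite mevalC.
- move=> t1 IH1 t2 IH2 /andP[/IH1[h1 E1] /IH2[h2 E2]].
  by exists (h1 + h2) => x; rewrite mevalD E1 E2.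
- by move=> t IH /IH[h E]; exists (- h) => x; rewrite mevalN E.
- by move=> t IH c /IH[h E]; exists (h *+ c) => x; rewrite mevalMn E.
- move=> t1 IH1 t2 IH2 /andP[/IH1[h1 E1] /IH2[h2 E2]].
  by exists (h1 * h2) => x; rewrite mevalM E1 E2.
by move=> t IH c /IH[h E]; exists (h ^+ c) => x; rewrite rmorphXn /= E.
Qed.

(** On the chart where the [i]-th coordinate does not vanish, a polynomial
    equation between affine coordinates is the vanishing of a form. *)
Lemma homogenize (h : {mpoly k[N.+1]}) (i : 'I_N.+1) : exists e,
  exists2 H : {mpoly k[N.+1]}, H \is e.-homog & forall x : 'rV[k]_N.+1,
    x 0 i != 0 -> H.@[x 0] = x 0 i ^+ e * h.@[((x 0 i)^-1 *: x) 0].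
Proof.
pose e := msize h; exists e.
exists (\sum_(m <- msupp h) h@_m *: ('X_[m] * 'X_i ^+ (e - mdeg m))).
  rewrite big_seq; apply: rpred_sum => m mh; apply: dhomogZ.
  rewrite -[X in X.-homog](@subnKC (mdeg m)); last exact/ltnW/msize_mdeg_lt.
  apply: dhomogM; first by rewrite dhomogX.
  rewrite -[X in X.-homog]mul1n; apply: dhomogMn.
  by rewrite dhomogX; apply/eqP; exact: mdeg1.
move=> x x0; rewrite raddf_sum mevalE mulr_sumr /= big_seq [RHS]big_seq.
apply: eq_bigr => m mh; rewrite mevalZ mevalM rmorphXn /= mevalX mevalXU.
rewrite [RHS]mulrCA; congr (_ * _).
rewrite [in RHS](eq_bigr (fun j => (x 0 i)^-1 ^+ m j * x 0 j ^+ m j)); last first.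
  by move=> j _; rewrite mxE exprMn.
rewrite big_split /= prodrXr -mdegE mulrA mulrC; congr (_ * _).
rewrite exprVn -[in RHS](@subnK (mdeg m) e).
  by rewrite exprD mulfK // expf_neq0.
exact/ltnW/msize_mdeg_lt.
Qed.

Let chart (i : 'I_N.+1) : set (proj k N) :=
  [set p | (vpick p : 'rV[k]_N.+1) 0 i != 0].
Let coords (i : 'I_N.+1) (p : proj k N) : 'rV[k]_N.+1 :=
  ((vpick p : 'rV[k]_N.+1) 0 i)^-1 *: vpick p.

Let open_chart i : open (chart i).
Proof.
have -> : chart i = ~` [set p | vanish ('X_i) p].
  apply/seteqP; split=> p /=; have hX : ('X_i : {mpoly k[N.+1]}) \is 1.-homog.
  - by rewrite dhomogX; apply/eqP; exact: mdeg1.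
  - by rewrite /chart /= (vanishE p hX) mevalXU => /eqP.
  - by rewrite dhomogX; apply/eqP; exact: mdeg1.
  - by rewrite /chart /= (vanishE p hX) mevalXU => /eqP.
by rewrite openC; exact: closed_vanish.
Qed.

(** The validity of a formula depends on the chosen representative of the point;
    in a chart there is a canonical one. *)
Lemma qf_biconstructible i (phi : GRing.formula k) :
  GRing.qf_form phi -> GRing.rformula phi ->
  biconstructible (chart i `&`
    [set p | GRing.qf_eval (env_of (coords i p)) phi]).
Proof.
have Kc : biconstructible (chart i).
  by rewrite -[chart i]setCK; apply/biconstructibleC/closed_biconstructible;
    exact/open_closedC/open_chart.
have KC A : biconstructible (chart i `&` A) ->
    biconstructible (chart i `&` ~` A).
  move=> KA; have -> : chart i `&` ~` A = chart i `&` ~` (chart i `&` A).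
    apply/seteqP; split=> p [cp h]; split=> //; first by case.
    by move=> Ap; apply: h.
  by apply: biconstructibleI => //; exact: biconstructibleC.
elim: phi => //=.
- move=> [] _ _.
    by rewrite (_ : _ `&` _ = chart i) //; apply/seteqP; split=> p // -[].
  rewrite (_ : _ `&` _ = set0); last by apply/seteqP; split=> p //= -[].
  exact/closed_biconstructible/closed0.
- move=> t1 t2 _ /andP[/mpoly_of_rterm[h1 E1] /mpoly_of_rterm[h2 E2]].
  have [e [H He HE]] := homogenize (h1 - h2) i.
  rewrite (_ : _ `&` _ = chart i `&` [set p | vanish H p]).
    by apply: biconstructibleI => //; exact/closed_biconstructible/closed_vanish.
  apply/seteqP; split=> p /= [cp h]; split=> //.
    apply/(vanishE p He); rewrite HE // mevalB -E1 -E2 (eqP h) subrr mulr0 //.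
  move/(vanishE p He)/eqP: h; rewrite HE // mulf_eq0 expf_eq0 (negPf cp) andbF /=.
  by rewrite mevalB subr_eq0 E1 E2.
- move=> f1 IH1 f2 IH2 /andP[q1 q2] /andP[r1 r2].
  rewrite (_ : [set p | _] = [set p | GRing.qf_eval (env_of (coords i p)) f1] `&`
    [set p | GRing.qf_eval (env_of (coords i p)) f2]).
    by rewrite setIIr; apply: biconstructibleI; [exact: IH1|exact: IH2].
  by apply/seteqP; split=> p /= => [/andP|/andP].
- move=> f1 IH1 f2 IH2 /andP[q1 q2] /andP[r1 r2].
  rewrite (_ : [set p | _] = [set p | GRing.qf_eval (env_of (coords i p)) f1] `|`
    [set p | GRing.qf_eval (env_of (coords i p)) f2]).
    by rewrite setIUr; apply: biconstructibleU; [exact: IH1|exact: IH2].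
  by apply/seteqP; split=> p /= => [/orP|/orP].
- move=> f1 IH1 f2 IH2 /andP[q1 q2] /andP[r1 r2].
  rewrite (_ : [set p | _] = ~` [set p | GRing.qf_eval (env_of (coords i p)) f1]
    `|` [set p | GRing.qf_eval (env_of (coords i p)) f2]).
    by rewrite setIUr; apply: biconstructibleU; [exact/KC/IH1|exact: IH2].
  apply/seteqP; split=> p /=; rewrite implybE.
    by move=> /orP[/negP|]; [left|right].
  by move=> h; apply/orP; case: h => [/negP|]; [left|right].
move=> f IH qf rf; rewrite (_ : [set p | _] =
  ~` [set p | GRing.qf_eval (env_of (coords i p)) f]); first exact/KC/IH.
by apply/seteqP; split=> p /= /negP.
Qed.

(** The image is defined by an existential formula over the parameters [a] and
    the ratio [c] of [param_vec g a] to the given representative of the point.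
    In this formula the variables [0, ..., N] are the coordinates of the point,
    the next [n] are [a], and the last one is [c]. *)
Lemma constructible_param_image n (g : 'I_N.+1 -> {mpoly k[n]}) Q :
  constructible (param_image g Q).
Proof.
pose V (i : 'I_n) : GRing.term k := GRing.Var k (N.+1 + i).
pose c : GRing.term k := GRing.Var k (N.+1 + n).
pose body : GRing.formula k := GRing.And
  (GRing.Not (GRing.Equal (mpoly_term V Q) (GRing.NatConst k 0)))
  (GRing.And (GRing.Not (GRing.Equal c (GRing.NatConst k 0)))
     (foldr (fun u phi => GRing.And (GRing.Equal (mpoly_term V (g u))
          (GRing.Mul c (GRing.Var k (u : 'I_N.+1)))) phi)
       (@GRing.Bool k true) (enum 'I_N.+1))).
pose phi := foldr GRing.Exists body (iota N.+1 n.+1).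
have rV i : GRing.rterm (V i) by [].
have rphi : GRing.rformula phi.
  rewrite /phi; elim: (iota _ _) => //=; rewrite !rterm_mpoly_term //=.
  by elim: (enum _) => //= u s ->; rewrite rterm_mpoly_term.
pose psi := GRing.quantifier_elim (@ClosedFieldQE.ex_elim k) phi.
have /andP[qpsi rpsi] : GRing.qf_form psi && GRing.rformula psi.
  by apply: GRing.quantifier_elim_wf => //; exact: ClosedFieldQE.wf_ex_elim.
have psiP e : reflect (GRing.holds e phi) (GRing.qf_eval e psi).
  apply: GRing.quantifier_elim_rformP => //; first exact: ClosedFieldQE.wf_ex_elim.
  exact/ClosedFieldQE.holds_ex_elim/solve_monicpoly.
have bodyP e : GRing.holds e body <-> [/\ Q.@[fun i => e`_(N.+1 + i)] != 0,
    e`_(N.+1 + n) != 0 &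
    forall u, (g u).@[fun i => e`_(N.+1 + i)] = e`_(N.+1 + n) * e`_u].
  rewrite /body /= eval_mpoly_term /=.
  pose eqn u := (g u).@[fun i => e`_(N.+1 + i)] = e`_(N.+1 + n) * e`_u.
  set X := GRing.holds _ _; have XP : X <-> forall u, eqn u.
    rewrite /X; transitivity (forall u, u \in enum 'I_N.+1 -> eqn u).
      elim: (enum _) => [|u s IH] //=; rewrite eval_mpoly_term IH; split.
        by move=> [h1 h2] v; rewrite inE => /orP[/eqP ->|/h2].
      by move=> h; split=> [|v vs]; apply: h; rewrite inE ?eqxx ?vs ?orbT.
    by split=> h u; [apply: h; rewrite mem_enum|move=> _; exact: h].
  rewrite XP; split; last by case=> /eqP h1 /eqP h2 h3.
  by case=> /eqP h1 [/eqP h2 h3].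
have imP p i : chart i p ->
    param_image g Q p <-> GRing.qf_eval (env_of (coords i p)) psi.
  move=> pi; have [p0 pE] := pline_spanned p.
  set x := coords i p; have x0 : x != 0 by rewrite scaler_eq0 invr_eq0 negb_or pi.
  have px : pline p = <[x]>%VS by rewrite /x /coords vlineZ ?invr_eq0.
  apply: (iff_trans _ (rwP (psiP _))).
  apply: (iff_trans _ (GRing.foldExistsP _ _ _)).
  split=> [[a Qa pa]|[e' ee' /bodyP[h1 h2 h3]]].
    have : param_vec g a \in <[x]>%VS by rewrite -px pa memv_line.
    case/vlineP => s aE; have s0 : s != 0.
      by apply: contraNneq (pt_of_line pa) => s0; rewrite aE s0 scale0r.
    exists (env_of x ++ codom a ++ [:: s]).
      move=> j jP; have {jP} : j \notin iota N.+1 n.+1 := jP.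
      rewrite mem_iota negb_and -!ltnNge => jP.
      have se : size (env_of x) = N.+1 by rewrite size_map size_enum_ord.
      rewrite nth_cat se; case: ltnP => // Nj; rewrite nth_default ?se //.
      rewrite nth_default // size_cat size_codom card_ord /=.
      by move: jP Nj; lia.
    apply/bodyP; have E1 j : (env_of x ++ codom a ++ [:: s])`_(N.+1 + j) =
        (codom a ++ [:: s])`_j.
      by rewrite nth_cat size_map size_enum_ord ltnNge leq_addr /= addKn.
    have Ea : (fun i0 : 'I_n => (env_of x ++ codom a ++ [:: s])`_(N.+1 + i0)) =1 a.
      move=> j; rewrite E1 nth_cat size_codom card_ord ltn_ord.
      by rewrite (nth_map j) ?size_enum_ord // nth_ord_enum.
    rewrite (meval_eq _ Ea) E1 nth_cat size_codom card_ord ltnn subnn /=.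
    split=> // u; rewrite (meval_eq _ Ea) nth_cat size_map size_enum_ord ltn_ord.
    by rewrite nth_env_of; move/rowP/(_ u): aE; rewrite !mxE.
  exists (fun i => e'`_(N.+1 + i)) => //.
  have -> : param_vec g (fun i => e'`_(N.+1 + i)) = e'`_(N.+1 + n) *: x.
    apply/rowP => u; rewrite [LHS]mxE [RHS]mxE h3 -nth_env_of; congr (_ * _).
    have hu : (u : nat) \notin iota N.+1 n.+1 by rewrite mem_iota leqNgt ltn_ord.
    by rewrite (ee' u hu).
  by rewrite px [RHS]vlineZ.
rewrite (_ : param_image g Q = \bigcup_i (chart i `&`
    [set p | GRing.qf_eval (env_of (coords i p)) psi])).
  by apply: constructible_bigcup => i; case: (qf_biconstructible i qpsi rpsi).
apply/seteqP; split=> p.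
  move=> Ip; have [/rV0Pn[i pi] _] := pline_spanned p.
  by exists i => //; split; [exact: pi|apply/(imP p i)].
by case=> i _ [pi h]; apply/(imP p i).
Qed.

End Chevalley.

(** * Leading terms *)

Section Weight.
Variables (k : fieldType) (n : nat) (w : 'I_n -> rat).
Implicit Types (m e : 'X_{1..n}) (p q f g : {mpoly k[n]}).

Definition weight m : rat := \sum_i w i * (m i)%:R.

Lemma weightD m m' : weight (m + m') = weight m + weight m'.
Proof.
rewrite -big_split; apply: eq_bigr => i _ /=.
by rewrite mnmDE natrD mulrDr.
Qed.

Lemma weight0 : weight 0%MM = 0.
Proof. by rewrite /weight big1 // => i _; rewrite mnm0E mulr0. Qed.

Lemma weight1 i : weight U_(i)%MM = w i.
Proof.
rewrite /weight (bigD1 i) //= mnm1E eqxx mulr1 big1 ?addr0 // => j ji.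
by rewrite mnm1E eq_sym (negPf ji) mulr0.
Qed.

Lemma weightMn m j : weight (m *+ j) = weight m * j%:R.
Proof.
elim: j => [|j IH]; first by rewrite mulm0n weight0 mulr0.
by rewrite mulmS weightD IH mulrS mulrDr mulr1.
Qed.

Lemma weight_sum (I : Type) (r : seq I) (P : pred I) (F : I -> 'X_{1..n}) :
  weight (\sum_(i <- r | P i) F i)%MM = \sum_(i <- r | P i) weight (F i).
Proof. exact: (big_morph _ weightD weight0). Qed.

Definition heavier s p := forall m, m \in msupp p -> s < weight m.

Lemma heavierD s p q : heavier s p -> heavier s q -> heavier s (p + q).
Proof. by move=> hp hq m /msuppD_le; rewrite mem_cat => /orP[/hp|/hq]. Qed.

Lemma heavierM s s' p q : heavier s p -> heavier s' q -> heavier (s + s') (p * q).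
Proof.
move=> hp hq m /msuppM_le /allpairsP[[m1 m2] /= [/hp h1 /hq h2 ->]].
by rewrite weightD ltrD.
Qed.

Lemma heavierXm s c e p : heavier s p -> heavier (weight e + s) (c *: 'X_[e] * p).
Proof.
move=> hp m /msuppM_le /allpairsP[[m1 m2] /= [+ /hp h2 ->]].
by move=> /msuppZ_le; rewrite msuppX inE => /eqP ->; rewrite weightD ltrD2l.
Qed.

Lemma heavier_sum (I : Type) (r : seq I) (P : pred I) (F : I -> {mpoly k[n]}) s :
  (forall i, P i -> heavier s (F i)) -> heavier s (\sum_(i <- r | P i) F i).
Proof.
move=> h; elim/big_ind: _ => //; first by move=> m; rewrite msupp0.
by move=> p q; exact: heavierD.
Qed.

(** The lightest term of [f] is unique, with exponent [e]. *)
Definition leads f e := exists c, exists2 f' : {mpoly k[n]},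
  heavier (weight e) f' & c != 0 /\ f = c *: 'X_[e] + f'.

Lemma leads1 : leads 1 0%MM.
Proof.
exists 1, 0 => [m|]; first by rewrite msupp0.
by rewrite oner_neq0 mpolyX0 scale1r addr0.
Qed.

Lemma leadsM f g e e' : leads f e -> leads g e' -> leads (f * g) (e + e')%MM.
Proof.
move=> [c [f' hf [c0 ->]]] [c' [g' hg [c'0 ->]]].
exists (c * c'), (c *: 'X_[e] * g' + (c' *: 'X_[e'] * f' + f' * g')).
  rewrite weightD; apply: heavierD; first exact: heavierXm.
  by apply: heavierD; [rewrite addrC; exact: heavierXm|exact: heavierM].
split; first by rewrite mulf_neq0.
by rewrite mpolyXD -!mul_mpolyC mpolyCM; ring.
Qed.

Lemma leadsX f e j : leads f e -> leads (f ^+ j) (e *+ j)%MM.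
Proof.
move=> fe; elim: j => [|j IH]; first by rewrite expr0 mulm0n; exact: leads1.
by rewrite exprS mulmS; exact: leadsM.
Qed.

Lemma leads_prod r (g : 'I_r -> {mpoly k[n]}) (e : 'I_r -> 'X_{1..n}) :
  (forall i, leads (g i) (e i)) -> leads (\prod_i g i) (\sum_i e i)%MM.
Proof.
by move=> h; elim/big_rec2: _ => [|i m p _ pm]; [exact: leads1|exact: leadsM].
Qed.

(** Polynomials whose leading exponents are linearly independent are
    algebraically independent: distinct monomials in them have distinct leading
    terms, so the lightest of these cannot cancel. *)
Lemma leads_independent r (g : 'I_r -> {mpoly k[n]}) (e : 'I_r -> 'X_{1..n}) :
  (forall i, leads (g i) (e i)) ->
  injective (fun a : 'X_{1..r} => (\sum_i e i *+ a i)%MM) ->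
  forall P : {mpoly k[r]}, msubst g P = 0 -> P = 0.
Proof.
move=> ge inj P gP; apply/eqP; apply: contraT => P0.
pose E (a : 'X_{1..r}) := (\sum_i e i *+ a i)%MM.
have [a aP amin] : exists2 a, a \in msupp P &
    forall b, b \in msupp P -> weight (E a) <= weight (E b).
  move: P0; rewrite -msupp_eq0; elim: (msupp P) => [//|b s IH] _.
  have [->|/IH[c cs cmin]] := eqVneq s [::].
    by exists b; rewrite ?inE // => c; rewrite inE => /eqP ->.
  have [bc|cb] := leP (weight (E b)) (weight (E c)).
    exists b; rewrite ?inE ?eqxx // => x; rewrite inE => /orP[/eqP ->//|/cmin].
    exact: le_trans.
  exists c; rewrite ?inE ?cs ?orbT // => x; rewrite inE => /orP[/eqP ->|/cmin //].
  exact: ltW.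
have lg (b : 'X_{1..r}) : leads (\prod_i g i ^+ b i) (E b).
  by apply: leads_prod => i; exact: leadsX.
have := congr1 (mcoeff (E a)) gP; rewrite msubstE mcoeff0 raddf_sum /=.
rewrite (bigD1_seq a) ?msupp_uniq //= mcoeffZ.
rewrite [X in _ + X]big_seq_cond [X in _ + X]big1 ?addr0.
  have [c [f' hf [c0 ->]]] := lg a.
  rewrite mcoeffD mcoeffZ mcoeffX eqxx mulr1 (@memN_msupp_eq0 _ _ f') ?addr0.
    by move/eqP; rewrite mulf_eq0 (negPf c0) orbF mcoeff_eq0 aP.
  by apply/negP => /hf; rewrite ltxx.
move=> b /andP[bP ba]; rewrite mcoeffZ; have [c [f' hf [c0 ->]]] := lg b.
rewrite mcoeffD mcoeffZ mcoeffX (@memN_msupp_eq0 _ _ f') ?addr0.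
  case: eqP => [/inj ab|_]; first by rewrite ab eqxx in ba.
  by rewrite mulr0 mulr0.
by apply/negP => /hf; rewrite ltNge amin.
Qed.

End Weight.

(** * Cells of lattice points *)

Section Zigzag.
Local Open Scope nat_scope.

(** The position of the lattice point [u] in the zigzag order of its stack:
    the points over the [l] points of a cell in dimension [l - 1] are numbered
    layer by layer, and a cell in dimension [l] consists of [l + 1] consecutive
    ones. *)
Fixpoint zigzag (u : nat -> nat) l :=
  if l is l'.+1 then l * u l' + zigzag u l' %% l else 0.

Definition cell_index u l := zigzag u l %/ l.+1.

(** The inverse of the numbering: the point with cell indices [I 1, ..., I l]
    and with position [r] in its cell. *)
Fixpoint cell_point (I : nat -> nat) l r : nat -> nat :=
  if l is l'.+1 then
    let z := l.+1 * I l + r in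
    fun j => if j == l' then z %/ l else cell_point I l' (z %% l) j
  else fun=> 0.

Lemma cell_point_lt I l r j : j < l ->
  cell_point I l.+1 r j = cell_point I l ((l.+2 * I l.+1 + r) %% l.+1) j.
Proof. by move=> jl /=; rewrite ltn_eqF. Qed.

Lemma cell_point_top I l r :
  cell_point I l.+1 r l = (l.+2 * I l.+1 + r) %/ l.+1.
Proof. by rewrite /= eqxx. Qed.

Lemma zigzag_ext u v l : (forall j, j < l -> u j = v j) -> zigzag u l = zigzag v l.
Proof.
elim: l => //= l IH uv; rewrite uv // IH // => j jl; apply: uv.
exact: ltnW.
Qed.

Lemma zigzag_cell I l r : I 0 = 0 -> r <= l ->
  zigzag (cell_point I l r) l = l.+1 * I l + r.
Proof.
move=> I0; elim: l r => [|l IH] r rl; first by rewrite I0; move: rl; case: r.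
have zE : zigzag (cell_point I l.+1 r) l =
    l.+1 * I l + (l.+2 * I l.+1 + r) %% l.+1.
  rewrite -IH; last by rewrite -ltnS ltn_mod.
  by apply: zigzag_ext => j /cell_point_lt.
have -> u : zigzag u l.+1 = l.+1 * u l + zigzag u l %% l.+1 by [].
by rewrite zE cell_point_top [_ * I l]mulnC modnMDl modn_mod mulnC -divn_eq.
Qed.

(** The condition [I 0 = 0] reflects that dimension 0 has a single cell. *)
Lemma cell_index_point I l r j : I 0 = 0 -> r <= l -> j <= l ->
  cell_index (cell_point I l r) j = I j.
Proof.
move=> I0; elim: l r => [|l IH] r rl.
  by rewrite leqn0 => /eqP ->; rewrite I0.
rewrite leq_eqVlt => /orP[/eqP ->|jl].
  by rewrite /cell_index zigzag_cell // mulnC divnMDl // divn_small ?addn0.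
rewrite -(IH ((l.+2 * I l.+1 + r) %% l.+1)) // -1?ltnS ?ltn_mod //.
rewrite /cell_index; congr (_ %/ _); apply: zigzag_ext => i ij.
by apply: cell_point_lt; exact: leq_trans ij _.
Qed.

Lemma cell_pointE u l j : j < l ->
  cell_point (cell_index u) l (zigzag u l %% l.+1) j = u j.
Proof.
elim: l j => // l IH j; rewrite ltnS leq_eqVlt => /orP[/eqP ->|jl].
  rewrite cell_point_top /cell_index [_.+2 * _]mulnC -divn_eq.
  have -> : zigzag u l.+1 = l.+1 * u l + zigzag u l %% l.+1 by [].
  by rewrite mulnC divnMDl // divn_small ?addn0 // ltn_mod.
rewrite cell_point_lt // /cell_index [_.+2 * _]mulnC -divn_eq -[RHS]IH //.
congr (cell_point _ _ _ _).
have -> : zigzag u l.+1 = l.+1 * u l + zigzag u l %% l.+1 by [].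
by rewrite mulnC modnMDl modn_mod.
Qed.

(** ** Degrees of the points of a cell *)

Definition cell_deg I l r := \sum_(j < l) cell_point I l r j.

(** The degree as a function of the position in the stack. *)
Definition stack_deg I l z := z %/ l.+1 + cell_deg I l (z %% l.+1).

Lemma cell_degS I l r : cell_deg I l.+1 r = stack_deg I l (l.+2 * I l.+1 + r).
Proof.
rewrite /stack_deg /cell_deg big_ord_recr cell_point_top /= [LHS]addnC; congr (_ + _).
by apply: eq_bigr => j _; apply: cell_point_lt; exact: ltn_ord.
Qed.

Lemma stack_degD I l z : stack_deg I l (z + l.+1) = (stack_deg I l z).+1.
Proof. by rewrite /stack_deg modnDr divnDr ?dvdnn // divnn addn1. Qed.

(** The degree does not decrease along a cell, and increases by at most one:
    passing from a layer of a stack to the next adds one to all degrees. *)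
Lemma cell_deg_mono I l r s : r <= s <= l ->
  cell_deg I l r <= cell_deg I l s <= (cell_deg I l r).+1.
Proof.
elim: l r s => [|l IH] r s rsl; first by rewrite /cell_deg !big_ord0.
have step z : stack_deg I l z <= stack_deg I l z.+1.
  rewrite /stack_deg; have [zl|] := ltnP (z %% l.+1) l.
    rewrite -[z.+1]addn1 divnD // modnD // [1 %% _]modn_small ?[1 %/ _]divn_small //;
      try lia.
    have -> : (l.+1 <= z %% l.+1 + 1) = false by lia.
    rewrite addn0 addn0 mul0n subn0 leq_add2l.
    by have /andP[] := IH (z %% l.+1) (z %% l.+1 + 1) ltac:(lia).
  have := ltn_pmod z (ltn0Sn l) => h1 h2; have E : z %% l.+1 = l by lia.
  have Ez : z.+1 = (z %/ l.+1).+1 * l.+1 by have := divn_eq z l.+1; lia.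
  rewrite Ez mulnK // modnMl E addSn.
  by have /andP[_] := IH 0 l ltac:(lia); lia.
have mono z z' : z <= z' -> stack_deg I l z <= stack_deg I l z'.
  move=> /subnK <-; elim: (z' - z) => [|e IHe]; rewrite ?add0n //.
  by rewrite addSn (leq_trans IHe).
rewrite !cell_degS -stack_degD.
by apply/andP; split; apply: mono; lia.
Qed.

End Zigzag.

(** ** Affine independence *)

(** The first and the last point of a cell lie over the same point of the cell
    below, one layer apart; the others lie over distinct points. *)
Lemma cell_independent I l (h : 'I_l.+1 -> rat) : \sum_r h r = 0 ->
  (forall j, (j < l)%N -> \sum_r h r * (cell_point I l r j)%:R = 0) ->
  forall r, h r = 0.
Proof.
elim: l h => [|l IH] h h0 hj r.
  by rewrite (ord1 r); move: h0; rewrite big_ord_recl big_ord0 addr0.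
pose z (r : 'I_l.+2) := (l.+2 * I l.+1 + r)%N.
pose s (r : 'I_l.+2) : 'I_l.+1 := inord (z r %% l.+1).
have sE i : s i = (z i %% l.+1)%N :> nat by rewrite inordK // ltn_mod.
pose h' q := \sum_(i | s i == q) h i.
have push (F : nat -> rat) : \sum_q h' q * F q = \sum_i h i * F (z i %% l.+1)%N.
  rewrite [RHS](partition_big s predT) //=; apply: eq_bigr => q _.
  by rewrite mulr_suml; apply: eq_bigr => i /eqP <-; rewrite sE.
have h'0 : forall q, h' q = 0.
  apply: IH => [|j jl].
    have := push (fun=> 1); rewrite (eq_bigr h') => [->|q _]; last by rewrite mulr1.
    by rewrite -[RHS]h0; apply: eq_bigr => i _; rewrite mulr1.
  rewrite (push (fun q => (cell_point I l q j)%:R)) -[RHS](hj j); last exact: ltnW.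
  by apply: eq_bigr => i _; rewrite (cell_point_lt I i jl).
have s_inj (i j : 'I_l.+2) : s i = s j -> (i < j)%N -> i = ord0 /\ j = ord_max.
  move=> /(congr1 val); rewrite /= !sE => zE ij.
  have : (l.+1 %| z j - z i)%N by rewrite -eqn_mod_dvd ?zE //; rewrite /z; lia.
  rewrite /z subnDl => /dvdn_leq; rewrite subn_gt0 => /(_ ij) lij.
  by have := ltn_ord j; split; apply/val_inj => /=; lia.
have hmid (i : 'I_l.+2) : i != ord0 -> i != ord_max -> h i = 0.
  move=> i0 im; rewrite -[RHS](h'0 (s i)) /h' (bigD1 i) //= big1 ?addr0 // => j.
  move=> /andP[/eqP sji]; rewrite neq_ltn => /orP[ji|ij].
    by have [_ E] := s_inj _ _ sji ji; rewrite E eqxx in im.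
  by have [E _] := s_inj _ _ (esym sji) ij; rewrite E eqxx in i0.
have mid F : \sum_i h i * F i = h ord0 * F ord0 + h ord_max * F ord_max.
  rewrite (bigD1 ord0) // (bigD1 ord_max) //= big1 ?addr0 // => i /andP[? ?].
  by rewrite hmid ?mul0r.
have sum0 : h ord0 + h ord_max = 0.
  rewrite -[RHS]h0 -[h ord0]mulr1 -[h ord_max]mulr1 -(mid (fun=> 1)).
  by apply: eq_bigr => i _; rewrite mulr1.
have max0 : h ord_max = 0.
  have := hj l (leqnn _); rewrite (mid (fun i => (cell_point I l.+1 i l)%:R)).
  rewrite !cell_point_top /= addn0 divnDr // divnn /= natrD mulrDr mulr1 addrA -mulrDl.
  by rewrite sum0 mul0r add0r.
have [->|r0] := eqVneq r ord0; first by move: sum0; rewrite max0 addr0.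
by have [->|rm] := eqVneq r ord_max; last exact: hmid.
Qed.

(** ** Separating functionals *)

(** The affine functional that numbers the stack to which the cell [I]
    belongs. *)
Fixpoint stack_form (I u : nat -> nat) l : int :=
  if l is l'.+1 then l%:Z * (u l')%:Z + stack_form I u l' - l%:Z * (I l')%:Z else 0.

Lemma stack_formE I u l : (forall j, (j < l)%N -> I j = cell_index u j) ->
  stack_form I u l = (zigzag u l)%:Z.
Proof.
elim: l => //= l IH Iu; rewrite IH => [|j jl]; last by apply: Iu; exact: ltnW.
rewrite Iu // /cell_index {1}(divn_eq (zigzag u l) l.+1); lia.
Qed.

(** Supporting lines of a convex function, the [i]-th of which is the largest
    at the integers [z] with [z %/ l.+1 = i]. *)
Definition tangent_line (l : nat) (i : nat) (z : int) : int :=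
  2 * i%:Z * z - l.+1%:Z * i%:Z * (i%:Z + 1) + i%:Z.

Lemma tangent_line_lt l q i z : (q * l.+1 <= z < q.+1 * l.+1)%N -> i != q ->
  tangent_line l i z%:Z + 1 <= tangent_line l q z%:Z.
Proof.
move=> /andP[z1 z2] iq; rewrite /tangent_line.
have : (i < q)%N \/ (q < i)%N by lia.
case=> h; [have [e E] : exists e, q = (i + e.+1)%N by exists (q - i.+1)%N; lia|
  have [e E] : exists e, i = (q + e.+1)%N by exists (i - q.+1)%N; lia]; subst.
- have [f F] : exists f, z = ((i + e.+1) * l.+1 + f)%N.
    by exists (z - (i + e.+1) * l.+1)%N; lia.
  subst z; clear. nia.
- have [f F] : exists f, z = (q * l.+1 + f)%N by exists (z - q * l.+1)%N; lia.
  have fl : (f <= l)%N by lia.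
  subst z; clear -fl. nia.
Qed.

(** Below the first breakpoint the line with slope index 1, though not the
    largest, still dominates those of larger index. *)
Lemma tangent_line_lt1 l i z : (z <= l)%N -> (1 < i)%N ->
  tangent_line l i z%:Z + 1 <= tangent_line l 1 z%:Z.
Proof.
move=> zl i1; rewrite /tangent_line.
have [e E] : exists e, i = (2 + e)%N by exists (i - 2)%N; lia.
subst i; clear i1; nia.
Qed.

(** The forms that separate the stacks, scaled up by [K] from each dimension to
    the next, plus the form that separates the cells of a stack. *)
Fixpoint cell_form (K : int) I u l : int :=
  if l is l'.+1 then K * cell_form K I u l' + tangent_line l (I l) (stack_form I u l)
  else 0.

Lemma stack_form_eq A B u l : (forall j, (j < l)%N -> A j = B j) ->
  stack_form A u l = stack_form B u l.
Proof.
elim: l => //= l IH AB; rewrite IH ?AB // => j jl; apply: AB; exact: ltnW.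
Qed.

Lemma cell_form_eq K A B u l : (forall j, (j <= l)%N -> A j = B j) ->
  cell_form K A u l = cell_form K B u l.
Proof.
elim: l => // l IH AB; rewrite /cell_form -/cell_form IH => [|j jl].
  by rewrite (@stack_form_eq A B) => [|j jl]; rewrite ?AB //; exact: ltnW.
by apply: AB; exact: ltnW.
Qed.

(** With [K] large, the forms of two cells are compared at the first index
    where the cells differ. The last index is left to a hypothesis, so that the
    form of the second cell of a stack can be used at the points of the first. *)
Lemma cell_form_lt K A B u m : A 0%N = 0%N -> B 0%N = 0%N ->
  (forall l, (l <= m)%N -> let f I := `|tangent_line l (I l) (stack_form I u l)| in
     f A + f B < K) ->
  (forall l, (l < m)%N -> A l = cell_index u l) ->
  (exists2 l, (l <= m)%N & A l != B l) ->
  ((forall l, (l < m)%N -> A l = B l) ->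
    tangent_line m (B m) (zigzag u m)%:Z + 1 <= tangent_line m (A m) (zigzag u m)%:Z) ->
  cell_form K B u m + 1 <= cell_form K A u m.
Proof.
move=> A0 B0; elim: m => [|m IH] hK Au [l lm ABl] top.
  by move: lm ABl; rewrite leqn0 => /eqP ->; rewrite A0 B0.
have [AB|/existsNP[j /not_implyP[jm /eqP ABj]]] :=
  pselect (forall l, (l < m.+1)%N -> A l = B l).
  rewrite /cell_form -/cell_form (@cell_form_eq K B A) => [|j jm]; last by rewrite AB.
  rewrite (@stack_form_eq B A) => [|j jm]; last by rewrite AB.
  by rewrite stack_formE // -addrA lerD2l; exact: top.
have : cell_form K B u m + 1 <= cell_form K A u m.
  apply: IH => [l' /leqW /hK //|l' /ltnW /Au //||AB].
    by exists j.
  have zE : (zigzag u m = cell_index u m * m.+1 + zigzag u m %% m.+1)%N.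
    exact: divn_eq.
  rewrite -Au // in zE; have := ltn_pmod (zigzag u m) (ltn0Sn m) => zlt.
  apply: tangent_line_lt; first by lia.
  apply: contra_neq ABj => ABm; move: jm.
    by rewrite ltnS leq_eqVlt => /orP[/eqP ->//|/AB].
have := hK m.+1 (leqnn _); rewrite /cell_form -/cell_form /=.
set fA := tangent_line _ (A _) _; set fB := tangent_line _ (B _) _.
move: (cell_form K A u m) (cell_form K B u m) => a b h1 h2.
have h3 : K * (b + 1) <= K * a by apply: ler_wpM2l => //; lia.
by lia.
Qed.

(** ** From lattice points to monomials *)

(** In dimension [m]: the functional depends on the first [m] coordinates. *)
Definition affine m (F : (nat -> nat) -> int) := exists (a : 'I_m -> rat) b,
  forall u, (F u)%:~R = \sum_j a j * (u j)%:R + b.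

Lemma affine_const m c : affine m (fun=> c).
Proof. by exists (fun=> 0), c%:~R => u; rewrite big1 ?add0r // => j _; rewrite mul0r. Qed.

Lemma affine_coord m l : (l < m)%N -> affine m (fun u => (u l)%:Z).
Proof.
move=> lm; exists (fun j => ((j : nat) == l)%:R), 0 => u.
rewrite (bigD1 (Ordinal lm)) //= eqxx mul1r big1 ?addr0 // => j.
by rewrite -val_eqE => /negPf /= ->; rewrite mul0r.
Qed.

Lemma affine_comb m x F G : affine m F -> affine m G ->
  affine m (fun u => x * F u + G u).
Proof.
move=> [a [b aF]] [a' [b' aG]].
exists (fun j => x%:~R * a j + a' j), (x%:~R * b + b') => u.
rewrite intrD intrM aF aG mulrDr mulr_sumr addrACA -big_split; congr (_ + _).
by apply: eq_bigr => j _; rewrite mulrDl mulrA.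
Qed.

Lemma affine_stack_form m I l : (l <= m)%N -> affine m (fun u => stack_form I u l).
Proof.
elim: l => [_|l IH lm]; first exact: affine_const.
have aux : affine m (fun u => l.+1%:Z * (u l)%:Z +
    (1 * stack_form I u l + - (l.+1%:Z * (I l)%:Z))).
  apply: affine_comb; first exact: affine_coord.
  by apply: affine_comb; [exact/IH/ltnW|exact: affine_const].
by have [a [b h]] := aux; exists a, b => u; rewrite -h /= mul1r addrA.
Qed.

Lemma affine_cell_form m K I l : (l <= m)%N -> affine m (fun u => cell_form K I u l).
Proof.
elim: l => [_|l IH lm]; first exact: affine_const.
have aux : affine m (fun u => K * cell_form K I u l + ((2 * (I l.+1)%:Z) *
    stack_form I u l.+1 +
    ((I l.+1)%:Z - l.+2%:Z * (I l.+1)%:Z * ((I l.+1)%:Z + 1)))).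
  apply: affine_comb; first exact/IH/ltnW.
  by apply: affine_comb; [exact: affine_stack_form|exact: affine_const].
have [a [b h]] := aux; exists a, b => u; rewrite -h; congr (_ %:~R).
by rewrite /cell_form -/cell_form /tangent_line; ring.
Qed.

Section Monomials.
Variables (m d : nat).

(** Monomials of degree [d] in [m + 1] variables stand for the lattice points of
    degree at most [d] in dimension [m], the exponent of [x_0] being the
    defect. *)
Definition affine_part (u : 'X_{1..m.+1}) (j : nat) : nat := u (inord j.+1).

Definition cell_mon I r : 'X_{1..m.+1} :=
  [multinom if i == ord0 then (d - cell_deg I m r)%N
            else cell_point I m r i.-1 | i < m.+1].

Lemma affine_part_cell I r j : (j < m)%N ->
  affine_part (cell_mon I r) j = cell_point I m r j.
Proof.
by move=> jm; rewrite /affine_part mnmE -val_eqE /= inordK.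
Qed.

Lemma cell_mon_lift I r (j : 'I_m) : cell_mon I r (lift ord0 j) = cell_point I m r j.
Proof. by rewrite mnmE -val_eqE. Qed.

Lemma mdeg_affine (u : 'X_{1..m.+1}) :
  mdeg u = (u ord0 + \sum_(j < m) affine_part u j)%N.
Proof.
rewrite mdegE big_ord_recl; congr (_ + _)%N; apply: eq_bigr => j _.
by rewrite /affine_part; congr (u _); apply/val_inj; rewrite /= inordK // ltnS.
Qed.

Lemma mdeg_cell_mon I r : (cell_deg I m r <= d)%N -> mdeg (cell_mon I r) = d.
Proof.
move=> h; rewrite mdeg_affine mnmE eqxx.
rewrite (eq_bigr (fun j : 'I_m => cell_point I m r j)); last first.
  by move=> j _; rewrite affine_part_cell.
by rewrite subnK.
Qed.

Lemma cell_mon_independent I (h : 'I_m.+1 -> rat) : (0 < d)%N ->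
  (forall r, (r <= m)%N -> (cell_deg I m r <= d)%N) ->
  (forall j, \sum_r h r * (cell_mon I r j)%:R = 0) -> forall r, h r = 0.
Proof.
move=> d0 hd h0; apply: (@cell_independent I) => [|j jm].
  have : \sum_j \sum_r h r * (cell_mon I r j)%:R = 0 by rewrite big1.
  rewrite exchange_big (eq_bigr (fun r => h r * d%:R)) => [|r _] /=.
    rewrite -mulr_suml => /eqP; rewrite mulf_eq0 pnatr_eq0 -[d == _]negbK -lt0n d0.
    by rewrite orbF => /eqP.
  by rewrite -mulr_sumr -natr_sum -mdegE mdeg_cell_mon // hd // -ltnS.
rewrite -[RHS](h0 (lift ord0 (Ordinal jm))).
by apply: eq_bigr => r _; rewrite cell_mon_lift.
Qed.

(** The constant term of an affine functional is distributed over the exponents,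
    whose sum is [d]. *)
Lemma affine_weight F : (0 < d)%N -> affine m F -> exists w : 'I_m.+1 -> rat,
  forall I r, (cell_deg I m r <= d)%N ->
  weight w (cell_mon I r) = (F (cell_point I m r))%:~R.
Proof.
move=> d0 [a [b aF]].
exists (fun i => (if unlift ord0 i is Some j then a j else 0) + b / d%:R) => I r hr.
rewrite /weight; under eq_bigr do rewrite mulrDl.
rewrite big_split /= -mulr_sumr -natr_sum -mdegE mdeg_cell_mon //.
rewrite divfK ?pnatr_eq0 -?lt0n // aF; congr (_ + _).
rewrite big_ord_recl unlift_none mul0r add0r; apply: eq_bigr => j _.
by rewrite liftK cell_mon_lift.
Qed.

End Monomials.

(** ** Cells near the origin *)

(** The origin and the unit vectors, which stand for the coordinates
    [x_0^(d-1) x_r] of the tangent vector. *)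
Lemma cell_point0 l r j : (r <= l)%N ->
  cell_point (fun=> 0%N) l r j = ((j.+1 == r) && (r <= l))%N.
Proof.
elim: l r j => [|l IH] r j; first by rewrite leqn0 => /eqP ->.
move=> rl /=; rewrite muln0 add0n; case: (ltnP r l.+1) => [rl1|lr].
  rewrite divn_small // modn_small // IH // rl; case: eqP => [->|_].
    by apply/esym/eqP; rewrite eqb0 andbT; lia.
  by rewrite -ltnS rl1.
have -> : r = l.+1 by lia.
by rewrite divnn modnn IH // eqSS leqnn andbT; case: eqP.
Qed.

Definition second_cell (m : nat) : nat -> nat := fun j => (j == m) : nat.

(** The second cell of the first stack is, but for its last point, the set of
    the sums of the last unit vector and a unit vector. *)
Lemma cell_point_second l r j : (r <= l)%N ->
  cell_point (second_cell l.+1) l.+1 r j = ((j == l) + (j == r))%N.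
Proof.
have low i s : (s <= l)%N ->
    cell_point (second_cell l.+1) l s i = cell_point (fun=> 0%N) l s i.
  have gen n : (n <= l)%N -> forall s i,
      cell_point (second_cell l.+1) n s i = cell_point (fun=> 0%N) n s i.
    elim: n => // n IHn nl s' i' /=.
    have -> : second_cell l.+1 n.+1 = 0%N by rewrite /second_cell ltn_eqF.
    by rewrite IHn // ltnW.
  by move=> _; exact: gen.
have top1 : second_cell l.+1 l.+1 = 1%N by rewrite /second_cell eqxx.
move=> rl; rewrite /= top1 muln1.
have -> : (l.+2 + r = l.+1 + r.+1)%N by lia.
rewrite divnDl ?dvdnn // divnn modnDl /=; case: (ltnP r.+1 l.+1) => [r1|lr].
  rewrite divn_small // modn_small // low // cell_point0 // eqSS.
  case: eqP => [->|_]; first by case: eqP => [|_]; lia.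
  by case: eqP => _; lia.
have -> : r = l by lia.
rewrite divnn modnn low // cell_point0 //.
by case: eqP => // _; rewrite addn0.
Qed.

(** ** Counting cells *)

Lemma mnm_eq_lift m (u v : 'X_{1..m.+1}) : mdeg u = mdeg v ->
  (forall j : 'I_m, u (lift ord0 j) = v (lift ord0 j)) -> u = v.
Proof.
rewrite !mdegE !big_ord_recl => E uv.
rewrite (eq_bigr (fun j => v (lift ord0 j))) // in E.
apply/mnmP => i; case: (unliftP ord0 i) => [j ->|->]; first exact: uv.
exact: (addIn E).
Qed.

Lemma cell_point_ext I J l r : (forall j, (j <= l)%N -> I j = J j) ->
  cell_point I l r =1 cell_point J l r.
Proof.
elim: l r => //= l IH r IJ j; rewrite IJ //; case: eqP => // _.
by apply: IH => i il; apply: IJ; exact: ltnW.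
Qed.

Section Counting.
Variables (m d : nat).

Definition cell_code I : seq nat := [seq I l | l <- iota 1 m].
Definition cell_of (s : seq nat) l := nth 0%N (0%N :: s) l.

Lemma cell_codeK I l : I 0%N = 0%N -> (l <= m)%N -> cell_of (cell_code I) l = I l.
Proof.
move=> I0; case: l => [|l] lm; first by rewrite I0.
by rewrite /cell_of /= (nth_map 0%N) ?size_iota // nth_iota.
Qed.

(** As monomials of degree [d] stand for points of degree at most [d], the cells
    that contain such a point. *)
Definition cells : seq (seq nat) :=
  undup [seq cell_code (cell_index (affine_part u)) | u <- monomials m d].

Lemma mem_cells I r : I 0%N = 0%N -> (r <= m)%N -> (cell_deg I m r <= d)%N ->
  cell_code I \in cells.
Proof.
move=> I0 rm rd; rewrite mem_undup; apply/mapP; exists (cell_mon m d I r).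
  by rewrite mem_monomials mdeg_cell_mon.
apply/eq_in_map => l; rewrite mem_iota => /andP[_ lm].
rewrite -(@cell_index_point I m r l) // /cell_index; congr (_ %/ _)%N.
by apply: zigzag_ext => j jl; rewrite affine_part_cell //; lia.
Qed.

(** Such a cell may stick out of the simplex by one degree only. *)
Lemma cells_deg s r : s \in cells -> (r <= m)%N ->
  (cell_deg (cell_of s) m r <= d.+1)%N.
Proof.
rewrite mem_undup => /mapP[u]; rewrite mem_monomials => /eqP ud -> rm.
set I := cell_of _; pose r0 := (zigzag (affine_part u) m %% m.+1)%N.
have r0m : (r0 <= m)%N by rewrite -ltnS ltn_mod.
have : (cell_deg I m r0 <= d)%N.
  rewrite -ud mdeg_affine /cell_deg.
  rewrite (eq_bigr (fun j : 'I_m => affine_part u j)) ?leq_addl // => j _.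
  rewrite -(cell_pointE (affine_part u) (ltn_ord j)).
  apply: cell_point_ext => l lm.
  by rewrite /I cell_codeK.
have /andP[h1 _] := @cell_deg_mono I m 0 r0 r0m.
by have /andP[_ h2] := @cell_deg_mono I m 0 r rm; lia.
Qed.

Lemma size_cells : ('C(m + d, m) <= size cells * m.+1)%N.
Proof.
pose rem (u : 'X_{1..m.+1}) := (zigzag (affine_part u) m %% m.+1)%N.
pose F u := (cell_code (cell_index (affine_part u)), rem u).
have -> : (size cells * m.+1 = size (allpairs pair cells (iota 0 m.+1)))%N.
  by rewrite size_allpairs size_iota.
rewrite -size_monomials -(size_map F); apply: uniq_leq_size.
  rewrite map_inj_in_uniq ?uniq_monomials // => u v.
  rewrite !mem_monomials => /eqP ud /eqP vd [Eu Er].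
  apply: mnm_eq_lift => [|j]; first by rewrite ud vd.
  have E (w : 'X_{1..m.+1}) : w (lift ord0 j) = affine_part w j :> nat.
    by rewrite /affine_part; congr (w _); apply/val_inj; rewrite /= inordK // ltnS.
  rewrite !E -(cell_pointE (affine_part u) (ltn_ord j)).
  rewrite -(cell_pointE (affine_part v) (ltn_ord j)) -/(rem u) -/(rem v) Er.
  by apply: cell_point_ext => l lm; rewrite -(cell_codeK _ lm) // Eu cell_codeK.
move=> _ /mapP[u um ->]; apply: allpairs_f.
  rewrite mem_undup; apply/mapP; exists u => //.
by rewrite mem_iota add0n ltn_mod.
Qed.

End Counting.

(** The combinatorial input: [t] cells of monomials of degree [d], each of them
    a basis, separated by linear weights; the first two are those of the
    monomials [x_0^(d-1) x_r] and [x_0^(d-2) x_m x_(r+1)], and the weight of the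
    second cell also separates the first one from all others. *)
Lemma separated_cells m d t : (2 <= m)%N -> (3 <= d)%N -> (2 <= t <= alpha m d)%N ->
  exists (U : 'I_t -> 'I_m.+1 -> 'X_{1..m.+1}) (w : 'I_t -> 'I_m.+1 -> rat),
  [/\ forall i r, mdeg (U i r) = d,
      forall i (h : 'I_m.+1 -> rat),
        (forall j, \sum_r h r * (U i r j)%:R = 0) -> forall r, h r = 0,
      forall i i' r, i != i' -> weight (w i) (U i r) + 1 <= weight (w i') (U i r),
      forall (i : 'I_t) (r : 'I_m.+1),
        (i = 0%N :> nat -> U i r = (U_(ord0) *+ d.-1 + U_(r))%MM) /\
        (i = 1%N :> nat -> (r < m)%N ->
         U i r = (U_(ord0) *+ (d - 2) + U_(ord_max) + U_(inord r.+1))%MM)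
    & forall (i0 i1 i : 'I_t) (r : 'I_m.+1),
        i0 = 0%N :> nat -> i1 = 1%N :> nat -> (1 < i)%N ->
        weight (w i1) (U i0 r) + 1 <= weight (w i) (U i0 r)].
Proof.
move=> m2 d3 /andP[t2 ta]; pose s0 := cell_code m (fun=> 0%N).
pose s1 := cell_code m (second_cell m); set cs := cells m d.-1.
have mE : m = m.-1.+1 by lia.
have s0c : s0 \in cs.
  apply: (@mem_cells _ _ _ 0) => //; rewrite /cell_deg big1 // => j _.
  by rewrite cell_point0.
have s1c : s1 \in cs.
  apply: (@mem_cells _ _ _ 0); rewrite // /second_cell; first by rewrite ltn_eqF //; lia.
  rewrite /cell_deg; have E (j : 'I_m) : cell_point (second_cell m) m 0 j =
      ((j == m.-1 :> nat) + (j == 0 :> nat))%N.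
    by rewrite {1 2}mE cell_point_second.
  rewrite (eq_bigr _ (fun j _ => E j)) big_split /=.
  have pred_sum a : (\sum_(j < m) (j == a :> nat) <= 1)%N.
    have [am|ma] := ltnP a m.
      rewrite (bigD1 (Ordinal am)) //= eqxx big1 // => j.
      by rewrite -val_eqE => /negPf /= ->.
    by rewrite big1 // => j _; rewrite ltn_eqF // (leq_trans (ltn_ord j)).
  by apply: leq_trans (leq_add (pred_sum m.-1) (pred_sum 0%N)) _; lia.
have s01 : s0 != s1.
  apply/eqP => E; have : cell_of s0 m = cell_of s1 m by rewrite E.
  by rewrite !cell_codeK // /second_cell ?eqxx // ltn_eqF //; lia.
pose L := s0 :: s1 :: [seq s <- cs | s \notin [:: s0; s1]].
have uL : uniq L.
  rewrite /= inE negb_or s01 !mem_filter !inE !eqxx orbT /= filter_uniq //.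
  exact: undup_uniq.
have Lc s : (s \in L) = (s \in cs).
  rewrite !inE mem_filter !inE negb_or.
  have [->|_] := eqVneq s s0; first by rewrite s0c.
  by have [->|_] := eqVneq s s1; first by rewrite s1c.
have tL : (t <= size L)%N.
  have : (size cs <= size L)%N.
    by apply: uniq_leq_size (undup_uniq _) _ => s; rewrite Lc.
  apply: leq_trans; move: ta; rewrite /alpha.
  have := size_cells m d.-1; rewrite -/cs (_ : m + d.-1 = m + d - 1)%N; last by lia.
  move=> hs ht; rewrite -(leq_pmul2r (ltn0Sn m)); apply: leq_trans hs.
  by apply: leq_trans (leq_trunc_div _ m.+1); rewrite leq_mul2r ht orbT.
pose sq (i : 'I_t) := nth [::] L i; pose I i := cell_of (sq i).
have sqL i : sq i \in cs by rewrite -Lc mem_nth // (leq_trans _ tL).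
have sq_inj i i' : i != i' -> sq i != sq i'.
  by apply: contraNneq => /eqP; rewrite nth_uniq ?(leq_trans _ tL).
have I0 i : I i 0%N = 0%N by [].
have szs i : size (sq i) = m.
  by move: (sqL i); rewrite mem_undup => /mapP[u _ ->]; rewrite size_map size_iota.
have I_inj i i' : i != i' -> exists2 l, (l <= m)%N & I i l != I i' l.
  move=> /sq_inj ne; apply: contrapT => h; case/eqP: ne.
  apply: (@eq_from_nth _ 0%N); rewrite ?szs // => l lm; apply/eqP.
  by apply: contraT => hl; case: h; exists l.+1.
have Id i r : (r <= m)%N -> (cell_deg (I i) m r <= d)%N.
  by move=> rm; have := cells_deg (sqL i) rm; rewrite prednK //; lia.
have d0 : (0 < d)%N by lia.
have IE0 (i : 'I_t) : i = 0%N :> nat -> forall l, (l <= m)%N -> I i l = 0%N.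
  by move=> i0 l lm; rewrite /I /sq i0 /= cell_codeK.
have IE1 (i : 'I_t) : i = 1%N :> nat -> forall l, (l <= m)%N -> I i l = second_cell m l.
  move=> i1 l lm; rewrite /I /sq i1 /= cell_codeK // /second_cell.
  by rewrite ltn_eqF //; lia.
pose f i i' (r l : 'I_m.+1) : int :=
  `|tangent_line l (I i l) (stack_form (I i) (cell_point (I i') m r) l)|.
pose B := \sum_i \sum_i' \sum_r \sum_l f i i' r l.
have fB i i' r l : f i i' r l <= B.
  rewrite /B (bigD1 i) //= (bigD1 i') //= (bigD1 r) //= (bigD1 l) //= -!addrA.
  by rewrite lerDl !addr_ge0 // !sumr_ge0 // => *; rewrite ?sumr_ge0 // => *;
    rewrite ?sumr_ge0 // => *; rewrite ?sumr_ge0 // => *; exact: normr_ge0.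
(* Twice the bound, as two lines are compared at a time. *)
pose K : int := 2 * B + 1.
have hK i i' i'' (r : 'I_m.+1) l : (l <= m)%N ->
    `|tangent_line l (I i l) (stack_form (I i) (cell_point (I i'') m r) l)| +
    `|tangent_line l (I i' l) (stack_form (I i') (cell_point (I i'') m r) l)| < K.
  move=> lm; have := fB i i'' r (inord l); have := fB i' i'' r (inord l).
  by rewrite /f inordK // /K; lia.
have aW i : affine m (fun u => (-1) * cell_form K (I i) u m + 0).
  by apply: affine_comb; [exact: affine_cell_form|exact: affine_const].
have /choice[w wE] : forall i, exists w : 'I_m.+1 -> rat, forall i' r, (r <= m)%N ->
    weight w (cell_mon m d (I i') r) =
    - (cell_form K (I i) (cell_point (I i') m r) m)%:~R.
  move=> i; have [w hw] := affine_weight d0 (aW i).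
  by exists w => i' r rm; rewrite hw ?Id // mulN1r addr0 rmorphN.
have rm (r : 'I_m.+1) : (r <= m)%N by rewrite -ltnS.
have cmp i i' i'' (r : 'I_m.+1) :
    cell_form K (I i') (cell_point (I i'') m r) m + 1 <=
      cell_form K (I i) (cell_point (I i'') m r) m ->
    weight (w i) (cell_mon m d (I i'') r) + 1 <= weight (w i') (cell_mon m d (I i'') r).
  by move=> h; rewrite !wE // -(ler_int rat) in h *; rewrite intrD in h; lra.
exists (fun i r => cell_mon m d (I i) r), w; split.
- by move=> i r; rewrite mdeg_cell_mon // Id.
- by move=> i h; apply: cell_mon_independent => // r; exact: Id.
- move=> i i' r ii'; apply: cmp; apply: cell_form_lt => //.
  + by move=> l lm; exact: hK.
  + by move=> l lm; rewrite cell_index_point // ltnW.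
  + exact: I_inj.
  move=> agree; rewrite zigzag_cell //; apply: tangent_line_lt.
    by have := rm r; lia.
  have [l lm hl] := I_inj _ _ ii'; move: lm; rewrite leq_eqVlt => /orP[/eqP <-|/agree E].
    by rewrite eq_sym.
  by rewrite E eqxx in hl.
- move=> i r; split=> [i0|i1 rltm]; apply: mnm_eq_lift => [|j].
  + by rewrite mdeg_cell_mon ?Id // mdegD mdegMn !mdeg1; lia.
  + rewrite cell_mon_lift (cell_point_ext _ (IE0 i i0)) cell_point0 // rm andbT.
    by rewrite mnmDE mulmnE !mnm1E -!val_eqE /= mul0n add0n eq_sym.
  + by rewrite mdeg_cell_mon ?Id // !mdegD mdegMn !mdeg1; lia.
  rewrite cell_mon_lift (cell_point_ext _ (IE1 i i1)) {1 2}mE.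
  rewrite cell_point_second; last by lia.
  rewrite !mnmDE mulmnE !mnm1E -!val_eqE /= inordK // mul0n add0n.
  by have := ltn_ord j; rewrite /bump /=; lia.
move=> i0 i1 i r E0 E1 i2; apply: cmp.
have ne01 : i0 != i by rewrite -val_eqE /= E0; lia.
have ne1 : i1 != i by rewrite -val_eqE /= E1; lia.
have second0 l : (l < m)%N -> second_cell m l = 0%N.
  by move=> lm; rewrite /second_cell ltn_eqF.
apply: cell_form_lt => //.
- by move=> l lm; exact: hK.
- by move=> l lm; rewrite (IE1 i1 E1 _ (ltnW lm)) second0 // cell_index_point ?(ltnW lm) //
    (IE0 i0 E0 _ (ltnW lm)).
- exact: I_inj.
move=> agree; rewrite zigzag_cell // (IE0 i0 E0 m) // muln0 add0n (IE1 i1 E1) //.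
rewrite /second_cell eqxx.
apply: tangent_line_lt1; first exact: rm.
have Im0 : I i m != 0%N.
  have [l lm hl] := I_inj _ _ ne01; move: lm; rewrite leq_eqVlt => /orP[/eqP El|lm].
    by move: hl; rewrite El (IE0 i0 E0 m) // eq_sym.
  move: hl; rewrite -agree // (IE0 i0 E0 _ (ltnW lm)) (IE1 i1 E1 _ (ltnW lm)).
  by rewrite second0.
have Im1 : I i m != 1%N.
  have [l lm hl] := I_inj _ _ ne1; move: lm; rewrite leq_eqVlt => /orP[/eqP El|/agree E].
    by move: hl; rewrite El IE1 // /second_cell eqxx eq_sym.
  by rewrite E eqxx in hl.
by move: Im0 Im1; case: (I i m) => [|[]].
Qed.

(** * Sums of powers *)

Section Coordinates.
Variables (k : closedFieldType) (m t : nat) (A : {set 'I_t * 'I_m.+1}).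

(** The coordinates of [t] vectors: those with index in [A] are variables, the
    others are equal to 1. The former are numbered, to be the variables of a
    polynomial ring. *)
Let S := {x | x \in A}.
Let n := #|{: S}|.

Definition var i j : option 'I_n := omap enum_rank (insub (i, j) : option S).
Definition coord i j : {mpoly k[n]} := if var i j is Some q then 'X_q else 1.
Definition pair_of (q : 'I_n) : 'I_t * 'I_m.+1 := val (enum_val q).

Lemma var_pair q : var (pair_of q).1 (pair_of q).2 = Some q.
Proof. by rewrite /var -surjective_pairing /pair_of valK /= enum_valK. Qed.

Lemma varP i j q : var i j = Some q -> pair_of q = (i, j).
Proof.
rewrite /var; case: insubP => //= s _ sE [<-].
by rewrite /pair_of enum_rankK.
Qed.

Lemma var_in i j : (i, j) \in A -> exists q, var i j = Some q.
Proof. by move=> h; rewrite /var insubT; exists (enum_rank (Sub (i, j) h : S)). Qed.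

Lemma var_notin i j : (i, j) \notin A -> var i j = None.
Proof. by move=> h; rewrite /var insubN. Qed.

Lemma card_coordinates : n = #|A|.
Proof. exact: card_sig. Qed.

(** The exponent of the monomial [v_i^u] in the coordinates of the vectors. *)
Definition exponent i (u : 'X_{1..m.+1}) : 'X_{1..n} :=
  (\sum_j if var i j is Some q then U_(q) *+ u j else 0)%MM.

Lemma mmap1_coord i u : mmap1 (coord i) u = 'X_[exponent i u].
Proof.
rewrite /mmap1 /exponent -mprodXE; apply: eq_bigr => j _; rewrite /coord.
by case: (var i j) => [q|]; rewrite ?mpolyXn // expr1n mpolyX0.
Qed.

Lemma exponentE i u q :
  exponent i u q = if (pair_of q).1 == i then u (pair_of q).2 else 0%N.
Proof.
rewrite /exponent mnm_sumE; case: eqP => [<-|ne].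
  rewrite (bigD1 (pair_of q).2) //= var_pair mulmnE mnm1E eqxx mul1n.
  rewrite big1 ?addn0 // => j jq; case E : (var _ j) => [q'|]; last by rewrite mnm0E.
  rewrite mulmnE mnm1E; case: eqP => [qq'|_]; last by rewrite mul0n.
  by move: (varP E) jq; rewrite qq' => ->; rewrite eqxx.
rewrite big1 // => j _; case E : (var i j) => [q'|]; last by rewrite mnm0E.
rewrite mulmnE mnm1E; case: eqP => [qq'|_]; last by rewrite mul0n.
by case: ne; rewrite -qq' (varP E).
Qed.

Lemma weight_exponent (W : 'I_t -> 'I_m.+1 -> rat) i u :
  (forall j, (i, j) \notin A -> W i j = 0) ->
  weight (fun q => W (pair_of q).1 (pair_of q).2) (exponent i u) = weight (W i) u.
Proof.
move=> W0; rewrite weight_sum; apply: eq_bigr => j _.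
case E : (var i j) => [q|]; first by rewrite weightMn weight1 (varP E).
rewrite weight0 W0 ?mul0r //; apply/negP => /var_in[q]; by rewrite E.
Qed.

Definition vec (a : 'I_n -> k) i : 'rV[k]_m.+1 := \row_j (coord i j).@[a].

Lemma vecE a i j q : var i j = Some q -> vec a i 0 j = a q.
Proof. by move=> E; rewrite mxE /coord E mevalXU. Qed.

Lemma vec_notin a i j : (i, j) \notin A -> vec a i 0 j = 1.
Proof. by move=> h; rewrite mxE /coord var_notin // meval1. Qed.

Lemma vec_surj (x : 'I_t -> 'rV[k]_m.+1) :
  (forall i j, (i, j) \notin A -> x i 0 j = 1) -> exists a, vec a = x.
Proof.
move=> x1; exists (fun q => x (pair_of q).1 0 (pair_of q).2); apply/funext => i.
apply/rowP => j; have [/var_in[q E]|h] := boolP ((i, j) \in A).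
  by rewrite (vecE _ E) (varP E).
by rewrite vec_notin // x1.
Qed.

End Coordinates.

Lemma closed_root_exists (k : closedFieldType) d (c : k) : (0 < d)%N ->
  exists s, s ^+ d = c.
Proof.
move=> d0; have := @closed_rootP k ('X^d - c%:P).
rewrite size_XnsubC // eqSS -lt0n d0 => /elimT/(_ isT)[s].
by rewrite rootE !hornerE => /eqP/subr0_eq; exists s.
Qed.

Section VeroneseMaps.
Variables (k : closedFieldType) (m d : nat).
Let N := veronese_dim m d.
Implicit Types (x y : 'rV[k]_m.+1) (u : 'I_N.+1).

Definition mon u : 'X_{1..m.+1} := nth 0%MM (monomials m d) u.

Lemma mon_surj v : mdeg v = d -> exists u, mon u = v.
Proof.
move=> vd; have vm : v \in monomials m d by rewrite mem_monomials vd.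
have h : (index v (monomials m d) < N.+1)%N.
  by rewrite veronese_dimS -size_monomials index_mem.
by exists (Ordinal h); rewrite /mon nth_index.
Qed.

Lemma veronese_vecE x u : veronese_vec d x 0 u = ('X_[mon u]).@[x 0].
Proof. by rewrite mxE. Qed.

(** The differential of the Veronese map at [x], in the direction [y]. *)
Definition veronese_diff x y : 'rV[k]_N.+1 :=
  \row_u \sum_j ('X_[mon u])^`M(j).@[x 0] * y 0 j.

Lemma veronese_diffZ c x y : veronese_diff x (c *: y) = c *: veronese_diff x y.
Proof.
apply/rowP => u; rewrite !mxE mulr_sumr; apply: eq_bigr => j _.
by rewrite mxE mulrCA.
Qed.

End VeroneseMaps.

Section SumsOfPowers.
Variables (k : closedFieldType) (m d t : nat) (A : {set 'I_t * 'I_m.+1}).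
Variable (i0 i1 : 'I_t).
Let N := veronese_dim m d.
Let n := #|{: {x | x \in A}}|.
Let coord := @coord k m t A.
Let vec := @vec k m t A.

(** These vectors make up the affine cone over the union of the spans of [t]
    points: the coefficients of a linear combination have [d]-th roots. *)
Definition power_sum (u : 'I_N.+1) : {mpoly k[n]} :=
  \sum_i msubst (coord i) 'X_[mon u].

(** The same with the tangent vector at [v_i0] in the direction [v_i1] in place of
    two of the summands. *)
Definition tangent_sum (u : 'I_N.+1) : {mpoly k[n]} :=
  \sum_j msubst (coord i0) ('X_[mon u])^`M(j) * coord i1 j +
  \sum_(i | (i != i0) && (i != i1)) msubst (coord i) 'X_[mon u].

Lemma power_sum_vec a : param_vec power_sum a = \sum_i veronese_vec d (vec a i).
Proof.
apply/rowP => u; rewrite mxE summxE raddf_sum; apply: eq_bigr => i _.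
by rewrite veronese_vecE /= meval_msubst; apply: meval_eq => j; rewrite mxE.
Qed.

Lemma tangent_sum_vec a : param_vec tangent_sum a =
  veronese_diff d (vec a i0) (vec a i1) +
  \sum_(i | (i != i0) && (i != i1)) veronese_vec d (vec a i).
Proof.
apply/rowP => u; rewrite !mxE summxE mevalD !raddf_sum; congr (_ + _).
  apply: eq_bigr => j _ /=; rewrite mevalM meval_msubst mxE; congr (_ * _).
  by apply: meval_eq => j'; rewrite mxE.
apply: eq_bigr => i _ /=; rewrite veronese_vecE meval_msubst.
by apply: meval_eq => j; rewrite mxE.
Qed.

Hypothesis d0 : (0 < d)%N.

Lemma power_sum_stable : (forall i j, (i, j) \in A) -> cone_stable power_sum.
Proof.
move=> AT a c _; have [s sd] := closed_root_exists c d0.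
have [i j|a' va'] := @vec_surj k m t A (fun i => s *: vec a i).
  by rewrite AT.
exists a'; rewrite !power_sum_vec /vec va' scaler_sumr; apply: eq_bigr => i _.
by rewrite veronese_vecZ sd.
Qed.

(** The scalar is put on the direction of the tangent vector, as the first vector
    is normalized. *)
Lemma tangent_sum_stable : i0 != i1 -> (forall i j, i != i0 -> (i, j) \in A) ->
  cone_stable tangent_sum.
Proof.
move=> i01 AT a c _; have [s sd] := closed_root_exists c d0.
have [i j|a' va'] := @vec_surj k m t A
    (fun i => if i == i0 then vec a i else if i == i1 then c *: vec a i
              else s *: vec a i).
  by case: (eqVneq i i0) => [->|/AT -> //] /(vec_notin a).
exists a'; rewrite !tangent_sum_vec /vec va' eqxx (eq_sym i1) (negPf i01) eqxx.
rewrite veronese_diffZ scalerDr scaler_sumr; congr (_ + _).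
by apply: eq_bigr => i /andP[/negPf -> /negPf ->]; rewrite veronese_vecZ sd.
Qed.

End SumsOfPowers.

(** ** Independence of the coordinates *)

Lemma leads_neq0 (k : fieldType) n (w : 'I_n -> rat) (f : {mpoly k[n]}) e :
  leads w f e -> f != 0.
Proof.
move=> [c [f' hf [c0 ->]]]; apply: contraNneq c0 => /(congr1 (mcoeff e)).
rewrite mcoeffD mcoeffZ mcoeffX eqxx mulr1 mcoeff0 => <-.
by rewrite (@memN_msupp_eq0 _ _ f') ?addr0 //; apply/negP => /hf; rewrite ltxx.
Qed.

Lemma heavierX (k : fieldType) n (w : 'I_n -> rat) s c e :
  s < weight w e -> heavier w s (c *: 'X_[e] : {mpoly k[n]}).
Proof. by move=> h m /msuppZ_le; rewrite msuppX inE => /eqP ->. Qed.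

Section PairIndexed.
Variables (m t : nat) (B : {set 'I_t * 'I_m.+1}).

(** Back from the numbering of [B] to pairs. *)
Lemma sum_pairs (R : nmodType) (F : 'I_#|{: {x | x \in B}}| -> R) :
  \sum_i \sum_r (if var B i r is Some s then F s else 0) = \sum_s F s.
Proof.
rewrite pair_big [RHS](partition_big (@pair_of m t B) predT) //=.
apply: eq_bigr => -[i r] _ /=; case E : (var B i r) => [s|].
  rewrite (bigD1 s) ?(varP E) //= big1 ?addr0 // => s' /andP[/eqP h ns].
  case/eqP: ns; move: E.
  by rewrite -[i]/(i, r).1 -{2}[r]/(i, r).2 -h var_pair => -[].
rewrite big1 // => s /eqP h.
by move: E; rewrite -[i]/(i, r).1 -{2}[r]/(i, r).2 -h var_pair.
Qed.

(** Vectors of natural numbers that are linearly independent over the rationals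
    have distinct combinations with natural coefficients. *)
Lemma pair_exponents_inj n (E : 'I_t -> 'I_m.+1 -> 'X_{1..n}) :
  (forall al : 'I_t -> 'I_m.+1 -> rat,
    (forall i r, (i, r) \notin B -> al i r = 0) ->
    (forall q, \sum_i \sum_r al i r * (E i r q)%:R = 0) -> forall i r, al i r = 0) ->
  injective (fun a : 'X_{1..#|{: {x | x \in B}}|} =>
    (\sum_s E (pair_of s).1 (pair_of s).2 *+ a s)%MM).
Proof.
move=> h a b ab; pose F s : rat := (a s)%:R - (b s)%:R.
pose al i r := if var B i r is Some s then F s else 0.
have al0 : forall i r, al i r = 0.
  apply: h => [i r /var_notin E0|q]; first by rewrite /al E0.
  transitivity (\sum_s F s * (E (pair_of s).1 (pair_of s).2 q)%:R).
    rewrite -sum_pairs; apply: eq_bigr => i _; apply: eq_bigr => r _; rewrite /al.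
    by case V : (var B i r) => [s|]; rewrite ?mul0r // (varP V).
  under eq_bigr do rewrite /F mulrBl.
  rewrite sumrB; apply/eqP; rewrite subr_eq0; apply/eqP.
  move/(congr1 (fun e : 'X_{1..n} => (e q)%:R : rat)): ab; rewrite !mnm_sumE !natr_sum.
  move=> ab; rewrite (eq_bigr _ (fun s _ => mulrC _ _)).
  rewrite [RHS](eq_bigr _ (fun s _ => mulrC _ _)).
  under eq_bigr do rewrite -natrM -mulmnE.
  by under [RHS]eq_bigr do rewrite -natrM -mulmnE.
apply/mnmP => s; have := al0 (pair_of s).1 (pair_of s).2.
by rewrite /al var_pair => /eqP; rewrite subr_eq0 eqr_nat => /eqP.
Qed.

End PairIndexed.

Lemma msubst_coordX (k : closedFieldType) m t A i u :
  msubst (@coord k m t A i) 'X_[u] = 'X_[exponent A i u].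
Proof. by rewrite msubstXm -mmap1_coord. Qed.

Section Independence.
Variables (k : closedFieldType) (k_char0 : [pchar k] =i pred0) (m d t : nat).
Let N := veronese_dim m d.
Variables (U : 'I_t -> 'I_m.+1 -> 'X_{1..m.+1}) (w : 'I_t -> 'I_m.+1 -> rat).
Hypothesis U_deg : forall i r, mdeg (U i r) = d.
Hypothesis U_basis : forall i (h : 'I_m.+1 -> rat),
  (forall j, \sum_r h r * (U i r j)%:R = 0) -> forall r, h r = 0.
Hypothesis U_min : forall i i' r, i != i' ->
  weight (w i) (U i r) + 1 <= weight (w i') (U i r).

Let column i r : {u : 'I_N.+1 | mon u = U i r} := cid (mon_surj (U_deg i r)).

(** The coordinates of the vector with index [P] see only the exponents of the
    cell [P], a basis. *)
Lemma coord_independent (A : {set 'I_t * 'I_m.+1}) (P : 'I_t)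
    (al : 'I_t -> 'I_m.+1 -> rat)
    (E : 'I_t -> 'I_m.+1 -> 'X_{1.. #|{: {x | x \in A}}|}) :
  (forall j, (P, j) \in A) ->
  (forall i r j q, var A P j = Some q -> E i r q = if i == P then U P r j else 0%N) ->
  (forall q, \sum_i \sum_r al i r * (E i r q)%:R = 0) -> forall r, al P r = 0.
Proof.
move=> PA EP h; apply: U_basis => j; have [q V] := var_in (PA j).
rewrite -[RHS](h q) [RHS](bigD1 P) //= [X in _ + X]big1 ?addr0; last first.
  by move=> i /negPf iP; rewrite big1 // => r _; rewrite (EP _ _ _ _ V) iP mulr0.
by apply: eq_bigr => r _; rewrite (EP _ _ _ _ V) eqxx.
Qed.

(** The coordinate of index [U i r] has the leading term [v_i^(U i r)]. *)
Lemma power_sum_dim Q (i : 'I_t) : Q != 0 ->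
  cone_dim_ge
    (closure (param_image (@power_sum k m d t [set: 'I_t * 'I_m.+1]%SET) Q))
    (t * m.+1).
Proof.
move=> Q0; pose B : {set 'I_t * 'I_m.+1} := [set: 'I_t * 'I_m.+1]%SET.
have cB : (t * m.+1)%N = #|{: {x | x \in B}}|.
  by rewrite card_coordinates cardsT card_prod !card_ord.
pose om (q : 'I_#|{: {x | x \in B}}|) := w (pair_of q).1 (pair_of q).2.
have ld i' r : leads om (power_sum k B (sval (column i' r))) (exponent B i' (U i' r)).
  case: column => u /= uE.
  exists 1, (\sum_(i'' | i'' != i') 1 *: 'X_[exponent B i'' (U i' r)]).
    apply: heavier_sum => i'' ne; apply: heavierX.
    rewrite !weight_exponent; try by move=> j; rewrite inE.
    by apply: lt_le_trans (U_min r _); rewrite ?ltrDl // eq_sym.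
  rewrite oner_neq0; split=> //; rewrite /power_sum (bigD1 i') //= msubst_coordX uE.
  rewrite scale1r; congr (_ + _).
  by apply: eq_bigr => i'' _; rewrite msubst_coordX scale1r.
rewrite cB; apply: (cone_dim_param (y := fun s : 'I_#|{: {x | x \in B}}| =>
    sval (column (pair_of s).1 (pair_of s).2))) => //.
  by exists (sval (column i ord0)); exact: leads_neq0 (ld i ord0).
apply: leads_independent => [s|]; first exact: ld.
apply: (@pair_exponents_inj m t B _ (fun i r => exponent B i (U i r))) => al _ h P.
apply: coord_independent h; first by move=> j; rewrite inE.
move=> i' r j q V; rewrite exponentE (varP V) /= eq_sym.
by case: eqP => // ->.
Qed.

Variables (i0 i1 : 'I_t).
Hypotheses (i0E : i0 = 0%N :> nat) (i1E : i1 = 1%N :> nat).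
Hypotheses (m2 : (2 <= m)%N) (d3 : (3 <= d)%N).
Hypothesis U0 : forall r : 'I_m.+1, U i0 r = (U_(ord0) *+ d.-1 + U_(r))%MM.
Hypothesis U1 : forall r : 'I_m.+1, (r < m)%N ->
  U i1 r = (U_(ord0) *+ (d - 2) + U_(ord_max) + U_(inord r.+1))%MM.
Hypothesis U_min0 : forall (i : 'I_t) (r : 'I_m.+1), (1 < i)%N ->
  weight (w i1) (U i0 r) + 1 <= weight (w i) (U i0 r).

Let A : {set 'I_t * 'I_m.+1} := [set~ (i0, ord0)]%SET.
Let B : {set 'I_t * 'I_m.+1} := [set~ (i1, ord_max)]%SET.

(** The weights of the cells are shifted by that of the cell [i1] and scaled up,
    so that the vector [v_i0] gets weight 0 and the weights of the direction
    [v_i1] are small compared to the differences between distinct cells; they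
    only select a summand of the coordinates of the tangent vector. *)
Let delta (j : 'I_m.+1) : rat :=
  if j == ord_max then 0 else if j == ord0 then 2 else 1.
Let W (i : 'I_t) (j : 'I_m.+1) : rat :=
  if i == i0 then 0 else if i == i1 then delta j else 3 * (w i j - w i1 j).
Let om (q : 'I_#|{: {x | x \in A}}|) := W (pair_of q).1 (pair_of q).2.

Let i01 : i0 != i1. Proof. by rewrite -val_eqE /= i0E i1E. Qed.

Let W_A i j : (i, j) \notin A -> W i j = 0.
Proof. by rewrite !inE negbK => /eqP[-> _]; rewrite /W eqxx. Qed.

Let weight0 u : weight om (exponent A i0 u) = 0.
Proof.
rewrite weight_exponent; last by move=> j; exact: W_A.
by rewrite /weight big1 // => j _; rewrite /W eqxx mul0r.
Qed.

Let weight1 j : weight om (exponent A i1 U_(j)) = delta j.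
Proof.
rewrite weight_exponent; last by move=> j'; exact: W_A.
by rewrite weight1 /W eq_sym (negPf i01) eqxx.
Qed.

Let weight2 i u : i != i0 -> i != i1 ->
  weight om (exponent A i u) = 3 * (weight (w i) u - weight (w i1) u).
Proof.
move=> /negPf n0 /negPf n1; rewrite weight_exponent; last by move=> j; exact: W_A.
rewrite /weight -sumrB mulr_sumr; apply: eq_bigr => j _.
by rewrite /W n0 n1 -mulrBl mulrA.
Qed.

Let delta_ge0 j : 0 <= delta j. Proof. by rewrite /delta; do 2?case: ifP. Qed.
Let delta_le2 j : delta j <= 2. Proof. by rewrite /delta; do 2?case: ifP. Qed.

Lemma tangent_sumE (u : 'I_N.+1) : tangent_sum k A i0 i1 u =
  \sum_j (mon u j)%:R *: 'X_[exponent A i0 (mon u - U_(j)) + exponent A i1 U_(j)] +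
  \sum_(i | (i != i0) && (i != i1)) 1 *: 'X_[exponent A i (mon u)] :> {mpoly k[_]}.
Proof.
rewrite /tangent_sum; congr (_ + _); last first.
  by apply: eq_bigr => i _; rewrite msubst_coordX scale1r.
apply: eq_bigr => j _.
rewrite mderivX -mul_mpolyC rmorphM /= msubstC msubst_coordX mpolyXD mul_mpolyC.
by rewrite -scalerAl -(@mmap1_coord k m t A i1) mmap1U.
Qed.

Let large i : i != i0 -> i != i1 -> (1 < i)%N.
Proof. by rewrite -!val_eqE /= i0E i1E; lia. Qed.

Lemma tangent_sum_leads01 (u : 'I_N.+1) j : mon u j != 0%N ->
  (forall j', j' != j -> mon u j' != 0%N -> delta j < delta j') ->
  (forall i : 'I_t, (1 < i)%N -> weight (w i1) (mon u) + 1 <= weight (w i) (mon u)) ->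
  leads om (tangent_sum k A i0 i1 u)
    (exponent A i0 (mon u - U_(j)) + exponent A i1 U_(j))%MM.
Proof.
move=> uj hj hi; rewrite tangent_sumE (bigD1 j) //= -addrA.
exists (mon u j)%:R; eexists; last first.
  by split; last reflexivity; have /pcharf0P -> := k_char0.
rewrite weightD weight0 weight1 add0r; apply: heavierD; apply: heavier_sum.
  move=> j' jj'; have [->|uj'] := eqVneq (mon u j') 0%N.
    by move=> e; rewrite scale0r msupp0.
  by apply: heavierX; rewrite weightD weight0 weight1 add0r hj.
move=> i /andP[n0 n1]; apply: heavierX; rewrite weight2 //.
by have := hi i (large n0 n1); have := delta_le2 j; lra.
Qed.

Lemma tangent_sum_leads2 (u : 'I_N.+1) i : i != i0 -> i != i1 ->
  (forall i', i' != i -> weight (w i) (mon u) + 1 <= weight (w i') (mon u)) ->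
  leads om (tangent_sum k A i0 i1 u) (exponent A i (mon u)).
Proof.
move=> n0 n1 hi; rewrite tangent_sumE (bigD1 i) ?n0 //= addrCA.
exists 1; eexists; last by split; last reflexivity; rewrite oner_neq0.
have h1 : i1 != i by rewrite eq_sym.
have := hi _ h1 => hi1; rewrite weight2 //; apply: heavierD; apply: heavier_sum.
  move=> j _; apply: heavierX; rewrite weightD weight0 weight1.
  by have := delta_ge0 j; lra.
move=> i' /andP[/andP[n0' n1'] ne]; apply: heavierX; rewrite weight2 //.
by have := hi i' ne; lra.
Qed.

(** The leading exponents. In the two cells of the tangent vector they are, with
    [v_i0] normalized, those of [v_i1_r] and of [v_i0_(r+1) * v_i1_m]. *)
Let E i r : 'X_{1.. #|{: {x | x \in A}}|} :=
  if i == i0 then (exponent A i0 (U i0 r - U_(r)) + exponent A i1 U_(r))%MM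
  else if i == i1 then
    (exponent A i0 (U i1 r - U_(ord_max)) + exponent A i1 U_(ord_max))%MM
  else exponent A i (U i r).

Let ord0max : ord0 != ord_max :> 'I_m.+1.
Proof. by rewrite -val_eqE /=; lia. Qed.

Let B_lt r : (i1, r) \in B -> (r < m)%N.
Proof.
rewrite !inE xpair_eqE eqxx /= => h.
by have := ltn_ord r; rewrite -val_eqE /= in h; lia.
Qed.

Lemma tangent_sum_leads i r : (i, r) \in B ->
  leads om (tangent_sum k A i0 i1 (sval (column i r))) (E i r).
Proof.
case: column => u /= uE; rewrite /E.
case: (eqVneq i i0) => [Ei|n0]; last case: (eqVneq i i1) => [Ei|n1] irB.
- move=> _; rewrite Ei in uE; rewrite -uE; apply: tangent_sum_leads01.
  + by rewrite uE U0 mnmDE mnm1E eqxx addn1.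
  + move=> j' jr; rewrite uE U0 mnmDE mulmnE !mnm1E [r == _]eq_sym (negPf jr) addn0.
    case: (eqVneq ord0 j') => [j0 _|_]; last by rewrite mul0n.
    have r0 : r != ord0 by rewrite eq_sym j0.
    by rewrite -j0 /delta (negPf ord0max) eqxx (negPf r0); case: ifP.
  + by move=> i'; rewrite uE; exact: U_min0.
- rewrite Ei in irB uE; have rm := B_lt irB; rewrite -uE.
  apply: tangent_sum_leads01.
  + by rewrite uE U1 // !mnmDE !mnm1E eqxx; lia.
  + by move=> j' /negPf jm _; rewrite /delta eqxx jm; case: ifP.
  + by move=> i' i'1; rewrite uE; apply: U_min; rewrite -val_eqE /= i1E; lia.
rewrite -uE; apply: tangent_sum_leads2 => // i' ii'; rewrite uE; apply: U_min.
by rewrite eq_sym.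
Qed.

(** The variables of [v_i0] determine the coefficients of the cell [i1]; then
    those of [v_i1] determine the coefficients of the cell [i0]. *)
Lemma tangent_exponents_independent (al : 'I_t -> 'I_m.+1 -> rat) :
  (forall i r, (i, r) \notin B -> al i r = 0) ->
  (forall q, \sum_i \sum_r al i r * (E i r q)%:R = 0) -> forall i r, al i r = 0.
Proof.
move=> alB h.
have al2 i : i != i0 -> i != i1 -> forall r, al i r = 0.
  move=> n0 n1; apply: coord_independent h; last first.
    move=> i' r j q V; rewrite /E; case: (eqVneq i' i0) => [->|n0'].
      by rewrite mnmDE !exponentE (varP V) /= [i0 == i]eq_sym (negPf n0) (negPf n1).
    case: (eqVneq i' i1) => [->|n1'].
      by rewrite mnmDE !exponentE (varP V) /= [i1 == i]eq_sym (negPf n0) (negPf n1).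
    by rewrite exponentE (varP V) /= eq_sym; case: eqP => // ->.
  by move=> j; rewrite !inE xpair_eqE (negPf n0).
have sum2 q : \sum_r al i0 r * (E i0 r q)%:R + \sum_r al i1 r * (E i1 r q)%:R = 0.
  rewrite -[RHS](h q) [RHS](bigD1 i0) //= [in RHS](bigD1 i1) /=; last by rewrite eq_sym.
  rewrite [X in _ = _ + (_ + X)]big1 ?addr0 // => i /andP[n0 n1].
  by rewrite big1 // => r _; rewrite al2 // mul0r.
have al1 r : al i1 r = 0.
  have [/B_lt rm|/alB //] := boolP ((i1, r) \in B).
  have jA : (i0, inord r.+1) \in A by rewrite !inE xpair_eqE eqxx -val_eqE /= inordK.
  have [q V] := var_in jA; rewrite -[RHS](sum2 q).
  rewrite [X in _ = X + _]big1 ?add0r; last first.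
    move=> r' _; rewrite /E eqxx mnmDE !exponentE (varP V) /= eqxx (negPf i01) addn0.
    rewrite U0 mnmBE mnmDE addnK mulmnE mnm1E -val_eqE /= inordK // mul0n mulr0 //.
  have n10 : (i1 == i0) = false by rewrite eq_sym (negPf i01).
  have E1 (r' : 'I_m.+1) : (r' < m)%N -> E i1 r' q = (r' == r).
    move=> r'm; rewrite /E n10 eqxx mnmDE !exponentE (varP V) /= eqxx (negPf i01) addn0.
    rewrite U1 // mnmBE !mnmDE mulmnE !mnm1E -!val_eqE /= !inordK // mul0n add0n.
    by rewrite addKn eqSS.
  rewrite (bigD1 r) //= E1 // eqxx mulr1 big1 ?addr0 // => r' r'r.
  have [/B_lt r'm|/alB ->] := boolP ((i1, r') \in B); last by rewrite mul0r.
  by rewrite E1 // (negPf r'r) mulr0.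
have al0 r : al i0 r = 0.
  have jA : (i1, r) \in A by rewrite !inE xpair_eqE eq_sym (negPf i01).
  have [q V] := var_in jA; rewrite -[RHS](sum2 q).
  rewrite [X in _ = _ + X]big1 ?addr0 => [|r' _]; last by rewrite al1 mul0r.
  have E0 r' : E i0 r' q = (r' == r).
    rewrite /E eqxx mnmDE !exponentE (varP V) /= eqxx eq_sym (negPf i01) add0n.
    by rewrite mnm1E.
  rewrite (bigD1 r) //= E0 eqxx mulr1 big1 ?addr0 // => r' r'r.
  by rewrite E0 (negPf r'r) mulr0.
move=> i r; have [->|n0] := eqVneq i i0; first exact: al0.
by have [->|n1] := eqVneq i i1; [exact: al1|exact: al2].
Qed.

(** All pairs of a cell and a position contribute a function, except the last
    position in the cell [i1]. *)
Lemma tangent_sum_dim Q : Q != 0 ->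
  cone_dim_ge (closure (param_image (@tangent_sum k m d t A i0 i1) Q)) (t * m.+1 - 1).
Proof.
move=> Q0.
have cB : (t * m.+1 - 1)%N = #|{: {x | x \in B}}|.
  by rewrite card_coordinates cardsC1 card_prod !card_ord subn1.
have ld (s : 'I_#|{: {x | x \in B}}|) :
    leads om (tangent_sum k A i0 i1 (sval (column (pair_of s).1 (pair_of s).2)))
      (E (pair_of s).1 (pair_of s).2).
  by apply: tangent_sum_leads; rewrite -surjective_pairing; exact: valP.
rewrite cB; apply: (cone_dim_param (y := fun s : 'I_#|{: {x | x \in B}}| =>
    sval (column (pair_of s).1 (pair_of s).2))) => //.
  exists (sval (column i0 ord0)); apply: (@leads_neq0 _ _ om _ (E i0 ord0)).
  by apply: tangent_sum_leads; rewrite !inE xpair_eqE (negPf i01).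
apply: leads_independent ld _; apply: pair_exponents_inj.
exact: tangent_exponents_independent.
Qed.

End Independence.

(** * Secant varieties and tangent vectors *)

Section VeroneseCurve.
Variables (k : closedFieldType) (m d : nat) (x y : 'rV[k]_m.+1).
Let N := veronese_dim m d.

Definition veronese_curve (u : 'I_N.+1) : {poly k} :=
  mmap polyC (fun j => (x 0 j)%:P + (y 0 j)%:P * 'X) 'X_[mon u].

Lemma horner_veronese_curve u s :
  (veronese_curve u).[s] = veronese_vec d (x + s *: y) 0 u.
Proof.
rewrite horner_mmap veronese_vecE; apply: meval_eq => j.
by rewrite !hornerE !mxE mulrC.
Qed.

Lemma deriv_veronese_curve u :
  (veronese_curve u)^`().[0] = veronese_diff d x y 0 u.
Proof.
rewrite deriv_mmap horner_sum mxE; apply: eq_bigr => j _.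
rewrite hornerM horner_mmap !derivE !hornerE /= ?mulr0 ?addr0.
rewrite mulr1 (@meval_eq _ _ _ (x 0)) // => j'.
by rewrite !hornerE ?mulr0 ?addr0.
Qed.

(** The tangent vector is a limit of combinations of two points of the cone. *)
Lemma veronese_secant_quotient : exists h : 'I_N.+1 -> {poly k},
  (forall u, (h u).[0] = veronese_diff d x y 0 u) /\
  forall u s, s != 0 ->
    (h u).[s] = s^-1 * (veronese_vec d (x + s *: y) 0 u - veronese_vec d x 0 u).
Proof.
have ex u : exists q, veronese_curve u - (veronese_curve u).[0]%:P = q * 'X.
  have /factor_theorem[q E] : root (veronese_curve u - (veronese_curve u).[0]%:P) 0.
    by rewrite rootE !hornerE subrr.
  by exists q; rewrite E subr0.
have /choice[h hE] := ex; exists h; split=> u => [|s s0].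
  rewrite -deriv_veronese_curve; have := congr1 (fun p : {poly k} => p^`().[0]) (hE u).
  by rewrite derivB derivC subr0 derivM derivX !hornerE ?mulr0 ?add0r ?mulr1 => ->.
have := congr1 (fun p : {poly k} => p.[s]) (hE u); rewrite !hornerE.
rewrite !horner_veronese_curve scale0r addr0 => ->.
by rewrite mulrCA mulVf ?mulr1.
Qed.

End VeroneseCurve.

Section Secant.
Variables (k : closedFieldType) (m d t : nat).
Hypothesis d0 : (0 < d)%N.
Let N := veronese_dim m d.
Let full : {set 'I_t * 'I_m.+1} := [set: 'I_t * 'I_m.+1]%SET.

Lemma full_in i j : (i, j) \in full. Proof. by rewrite inE. Qed.

Lemma mem_veronese_line (x : 'rV[k]_m.+1) : x != 0 ->
  exists2 p, veronese_variety k m d p & pline p = <[veronese_vec d x]>%VS.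
Proof.
move=> x0; exists (veronese d (pt x0)); first by exists (pt x0).
by rewrite veronese_pt.
Qed.

(** A zero vector among the [t] vectors is replaced by an arbitrary point. *)
Lemma secant_points : \bigcup_(x in [set x : 'I_t -> proj k N |
      forall i, veronese_variety k m d (x i)])
    linear_space (\sum_(i < t) pline (x i))%VS =
  param_image (@power_sum k m d t full) 1.
Proof.
apply/seteqP; split=> p.
  move=> [x xX px]; have [_ pE] := pline_spanned p.
  have /memv_sumP[y yx yE] : vpick p \in (\sum_(i < t) pline (x i))%VS.
    by apply: (subvP px); exact: memv_pick.
  have /choice[z zE] : forall i, exists z, y i = veronese_vec d z.
    move=> i; have [q _ qE] := xX i; have := yx i isT; rewrite -qE /=.
    case/vlineP => c ->; have [s sd] := closed_root_exists c d0.
    by exists (s *: vpick q); rewrite veronese_vecZ sd.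
  have [i j|a az] := @vec_surj k m t full z; first by rewrite full_in.
  exists a; first by rewrite meval1 oner_neq0.
  rewrite pE power_sum_vec az yE; congr (<[_]>%VS).
  by apply: eq_bigr => i _; rewrite zE.
move=> [a _ pE]; pose e : 'rV[k]_m.+1 := delta_mx 0 0.
have e0 : e != 0 by apply/rV0Pn; exists 0; rewrite mxE !eqxx oner_neq0.
have /choice[x xE] : forall i, exists q, veronese_variety k m d q /\
    veronese_vec d (vec a i) \in pline q.
  move=> i; have [v0|v0] := eqVneq (vec a i) 0.
    have [q qX _] := mem_veronese_line e0; exists q; split=> //.
    by rewrite v0 -(scale0r e) veronese_vecZ expr0n eqn0Ngt d0 scale0r mem0v.
  by have [q qX qE] := mem_veronese_line v0; exists q; rewrite qE memv_line.
exists x => [i|]; first by case: (xE i).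
rewrite /linear_space /= pE -memvE power_sum_vec; apply: memv_sumr => i _.
by case: (xE i).
Qed.

Lemma secant_varietyE :
  secant_variety t (veronese_variety k m d) =
  closure (param_image (@power_sum k m d t full) 1).
Proof. by rewrite /secant_variety secant_points. Qed.

Variables (A : {set 'I_t * 'I_m.+1}) (i0 i1 : 'I_t).
Hypothesis i01 : i0 != i1.
Hypothesis power_sum_neq0 : exists u, @power_sum k m d t full u != 0.

(** Tangent vectors lie in the secant variety because they are limits of secant
    vectors. *)
Lemma tangent_sum_secant Q : cone_stable (@tangent_sum k m d t A i0 i1) ->
  param_image (@tangent_sum k m d t A i0 i1) Q `<=`
  secant_variety t (veronese_variety k m d).
Proof.
move=> stable; rewrite secant_varietyE => p [a Qa pE]; apply/closureP => f fI.
apply: (vanish_punctured pE) => c c0; have [{pE Qa c0}a' <-] := stable a c c0.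
rewrite tangent_sum_vec; set x := vec a' i0; set y := vec a' i1.
set z := \sum_(i | _) _; have [h [h0 hs]] := veronese_secant_quotient d x y.
pose F := mmap polyC (fun u => h u + (z 0 u)%:P) f.
suff F0 : F = 0.
  have := congr1 (fun q : {poly k} => q.[0]) F0; rewrite horner0 horner_mmap => <-.
  by apply: meval_eq => u; rewrite !hornerE h0 mxE.
apply: poly_punctured_eq0 => s s0; rewrite horner_mmap.
have [r rd] := closed_root_exists s^-1 d0.
have [r' r'd] := closed_root_exists (- s^-1) d0.
have [i j|b bE] := @vec_surj k m t full (fun i => if i == i0 then r *: (x + s *: y)
    else if i == i1 then r' *: x else vec a' i); first by rewrite full_in.
have bS : param_vec (@power_sum k m d t full) b = \row_u ((h u).[s] + z 0 u).
  rewrite power_sum_vec bE (bigD1 i0) //= (bigD1 i1) /= 1?eq_sym //.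
  rewrite eqxx (eq_sym i1) (negPf i01) eqxx !veronese_vecZ rd r'd.
  rewrite [X in _ + (_ + X)](_ : _ = z).
    apply/rowP => u; rewrite [RHS]mxE hs // mulrBr.
    rewrite addrA; rewrite [LHS]mxE [X in X + _ = _]mxE [X in X + _ + _ = _]mxE.
    by rewrite [X in _ + X + _ = _]mxE mulNr.
  by apply: eq_bigr => i /andP[/negPf -> /negPf ->].
transitivity (f.@[param_vec (@power_sum k m d t full) b 0]).
  by apply: meval_eq => u; rewrite bS !hornerE mxE.
by rewrite meval_param (cone_ideal_param power_sum_neq0 (oner_neq0 _) fI) meval0.
Qed.

End Secant.

(** * Schemes with one double point *)

(** Stated with a minor, whose entries are the coefficients of separating linear
    forms. *)
Definition independent_pair (k : fieldType) N (x y : 'rV[k]_N) :=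
  exists u v, x 0 u * y 0 v - x 0 v * y 0 u != 0.

Lemma independent_pair_sym (k : fieldType) N (x y : 'rV[k]_N) :
  independent_pair x y -> independent_pair y x.
Proof. by move=> [u [v h]]; exists v, u; rewrite [X in X - _]mulrC [X in _ - X]mulrC. Qed.

Lemma independent_pair_neq0 (k : fieldType) N (x y : 'rV[k]_N) :
  independent_pair x y -> x != 0.
Proof.
by move=> [u [v]]; apply: contraNneq => ->; rewrite !mxE !mul0r subrr.
Qed.

Lemma independent_linesP (k : closedFieldType) N (p q : proj k N) x y :
  pline p = <[x]>%VS -> pline q = <[y]>%VS -> p <> q <-> independent_pair x y.
Proof.
move=> px qy; have x0 := pt_of_line px; split=> [pq|[u [v h]] pq]; last first.
  have /vlineP[c E] : y \in <[x]>%VS by rewrite -px pq qy memv_line.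
  by case/eqP: h; rewrite E !mxE; ring.
apply: contrapT => h; apply: pq; apply/val_inj; rewrite /= px qy.
case/rV0Pn: (x0) => u xu; have E : y = (y 0 u / x 0 u) *: x.
  apply/rowP => v; rewrite mxE; apply: (mulfI xu).
  rewrite mulrA [x 0 u * (_ / _)]mulrC divfK //; apply/eqP; rewrite -subr_eq0.
  by apply: contraT => h'; case: h; exists u, v; rewrite [X in _ - X]mulrC.
have y0 := pt_of_line qy; rewrite E vlineZ //.
by apply: contraNneq y0 => c0; rewrite E c0 scale0r.
Qed.

Section LinearForms.
Variables (k : closedFieldType) (N : nat).
Implicit Types (x y : 'rV[k]_N.+1).

Definition form2 u v (a b : k) : {mpoly k[N.+1]} := a *: 'X_u - b *: 'X_v.

Lemma meval_form2 u v a b x : (form2 u v a b).@[x 0] = a * x 0 u - b * x 0 v.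
Proof. by rewrite /form2 mevalB !mevalZ !mevalXU. Qed.

Lemma homog_form2 u v a b : form2 u v a b \is 1.-homog.
Proof. by apply: rpredB; apply: dhomogZ; rewrite dhomogX; apply/eqP; exact: mdeg1. Qed.

Lemma separating_form x y : independent_pair x y ->
  exists l : {mpoly k[N.+1]}, [/\ l \is 1.-homog, l.@[x 0] != 0 & l.@[y 0] = 0].
Proof.
move=> [u [v h]]; exists (form2 u v (y 0 v) (y 0 u)); split.
- exact: homog_form2.
- by rewrite meval_form2 [y 0 v * _]mulrC [y 0 u * x _ _]mulrC.
by rewrite meval_form2; ring.
Qed.

Lemma separating_product (I : finType) (P : pred I) x (z : I -> 'rV[k]_N.+1) :
  (forall i, P i -> independent_pair x (z i)) ->
  exists e (g : {mpoly k[N.+1]}), [/\ g \is e.-homog, g.@[x 0] != 0 &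
    forall i, P i -> g.@[z i 0] = 0].
Proof.
move=> xz.
have /choice[l lP] : forall i, exists l : {mpoly k[N.+1]},
    P i -> [/\ l \is 1.-homog, l.@[x 0] != 0 & l.@[z i 0] = 0].
  move=> i; have [/xz/separating_form[l h]|] := boolP (P i); first by exists l.
  by exists 0.
exists (\sum_(i | P i) 1)%N, (\prod_(i | P i) l i); split.
- elim/big_rec2: _ => [|i e g /lP[h _ _] gh]; first exact: dhomog1.
  exact: dhomogM.
- rewrite rmorph_prod /=; apply/prodf_neq0 => i /lP[] //.
by move=> i Pi; rewrite (bigD1 i) //= mevalM; have [_ _ ->] := lP i Pi; rewrite mul0r.
Qed.

End LinearForms.

Lemma pihomogMl_lt (k : fieldType) n c e (g f : {mpoly k[n]}) :
  g \is c.-homog -> (e < c)%N -> pihomog mdeg e (g * f) = 0.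
Proof.
move=> hg ec; rewrite {1}(@pihomog_partitionE _ _ mdeg _ f (leqnn _)).
rewrite mulr_sumr raddf_sum big1 //= => i _.
have hi : pihomog mdeg i f \is i.-homog by exact: pihomogP.
by apply: (@pihomog_ne0 _ _ _ (c + i)%N); [lia|exact: dhomogM].
Qed.

Section DoublePoint.
Variables (k : closedFieldType) (N s : nat).
Variables (x x' : 'rV[k]_N.+1) (z : 'I_s -> 'rV[k]_N.+1).
Implicit Types (f g h : {mpoly k[N.+1]}) (p : proj k N).

Definition dir_deriv f := \sum_u (f^`M(u)).@[x 0] * x' 0 u.

Lemma dir_derivD f g : dir_deriv (f + g) = dir_deriv f + dir_deriv g.
Proof.
rewrite /dir_deriv -big_split; apply: eq_bigr => u _ /=.
by rewrite mderivD mevalD mulrDl.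
Qed.

Lemma dir_derivZ c f : dir_deriv (c *: f) = c * dir_deriv f.
Proof.
rewrite /dir_deriv mulr_sumr; apply: eq_bigr => u _.
by rewrite mderivZ mevalZ mulrA.
Qed.

Lemma dir_derivM f g :
  dir_deriv (f * g) = dir_deriv f * g.@[x 0] + f.@[x 0] * dir_deriv g.
Proof.
rewrite /dir_deriv mulr_suml mulr_sumr -big_split; apply: eq_bigr => u _ /=.
by rewrite mderivM mevalD !mevalM; ring.
Qed.

Lemma dir_derivX u : dir_deriv 'X_u = x' 0 u.
Proof.
rewrite /dir_deriv (bigD1 u) //= mderivX mnm1E eqxx scale1r.
have -> : (U_(u) - U_(u) = 0)%MM by apply/mnmP => j; rewrite mnmBE subnn mnm0E.
rewrite mpolyX0 meval1 mul1r big1 ?addr0 // => v vu.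
by rewrite mderivX mnm1E eq_sym (negPf vu) scale0r meval0 mul0r.
Qed.

Lemma dir_derivC c : dir_deriv c%:MP = 0.
Proof. by rewrite /dir_deriv big1 // => u _; rewrite mderivC meval0 mul0r. Qed.

Lemma dir_deriv_form2 u v a b : dir_deriv (form2 u v a b) = a * x' 0 u - b * x' 0 v.
Proof. by rewrite /form2 -scaleNr dir_derivD !dir_derivZ !dir_derivX mulNr. Qed.

Lemma dir_deriv_exp f e : dir_deriv f = 0 -> dir_deriv (f ^+ e) = 0.
Proof.
move=> f'0; elim: e => [|e IH]; first by rewrite expr0 -mpolyC1 dir_derivC.
by rewrite exprS dir_derivM f'0 IH mul0r mulr0 addr0.
Qed.

(** The equations of a scheme of degree 2 at [x], the tangent vector in the
    direction [x'], and of simple points [z i]. *)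
Definition jet_zero f :=
  [/\ f.@[x 0] = 0, dir_deriv f = 0 & forall i, f.@[z i 0] = 0].

Lemma jet_zero0 : jet_zero 0.
Proof. by split=> [||i]; rewrite ?meval0 // -mpolyC0 dir_derivC. Qed.

Lemma jet_zeroD f g : jet_zero f -> jet_zero g -> jet_zero (f + g).
Proof.
move=> [f1 f2 f3] [g1 g2 g3]; split=> [||i].
- by rewrite mevalD f1 g1 addr0.
- by rewrite dir_derivD f2 g2 addr0.
- by rewrite mevalD f3 g3 addr0.
Qed.

Lemma jet_zeroM f g : jet_zero g -> jet_zero (f * g).
Proof.
move=> [g1 g2 g3]; split=> [||i].
- by rewrite mevalM g1 mulr0.
- by rewrite dir_derivM g1 g2 !mulr0 addr0.
- by rewrite mevalM g3 mulr0.
Qed.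

(** The homogeneous ideal of the scheme is defined through homogeneous
    components, the conditions being independent of the scaling of the vectors
    for forms only. *)
Definition jet_ideal : set {mpoly k[N.+1]} :=
  [set f | forall e, jet_zero (pihomog mdeg e f)].

Lemma jet_ideal_homogE e f : f \is e.-homog -> jet_ideal f <-> jet_zero f.
Proof.
move=> hf; split=> [/(_ e)|h e']; first by rewrite pihomog_dE.
have [<-|ne] := eqVneq e e'; first by rewrite pihomog_dE.
by rewrite (pihomog_ne0 ne hf); exact: jet_zero0.
Qed.

Lemma jet_ideal0 : jet_ideal 0.
Proof. by move=> e; rewrite raddf0; exact: jet_zero0. Qed.

Lemma jet_idealD f g : jet_ideal f -> jet_ideal g -> jet_ideal (f + g).
Proof. by move=> hf hg e; rewrite pihomogD; apply: jet_zeroD; [exact: hf|exact: hg]. Qed.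

Lemma jet_idealM f g : jet_ideal g -> jet_ideal (f * g).
Proof.
move=> hg e; rewrite (@pihomog_partitionE _ _ mdeg _ f (leqnn _)) mulr_suml raddf_sum.
elim/big_ind: _ => [||i _ /=]; [exact: jet_zero0|exact: jet_zeroD|].
have hi : pihomog mdeg i f \is i.-homog by exact: pihomogP.
have [ie|ei] := leqP i e; last by rewrite (pihomogMl_lt _ hi ei); exact: jet_zero0.
by rewrite -(subnKC ie) (pihomogMl _ _ hi); exact: jet_zeroM.
Qed.

Lemma jet_ideal_homog f e : jet_ideal f -> jet_ideal (pihomog mdeg e f).
Proof.
by move=> hf; apply/(jet_ideal_homogE (pihomogP _ _ _)); exact: hf.
Qed.

Hypothesis xx' : independent_pair x x'.
Hypothesis xz : forall i, independent_pair x (z i).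
Hypothesis zz : forall i j, i != j -> independent_pair (z i) (z j).

Lemma z_neq0 i : z i != 0.
Proof. exact/independent_pair_neq0/independent_pair_sym/xz. Qed.

Lemma x_neq0 : x != 0.
Proof. exact: independent_pair_neq0 xx'. Qed.

(** Some variable does not vanish at a given point, so powers of it can be
    cancelled in the conditions at that point. *)
Lemma jet_ideal_sat f : (forall u : 'I_N.+1, exists r, jet_ideal ('X_u ^+ r * f)) ->
  jet_ideal f.
Proof.
move=> hf e.
have key u : exists r, jet_zero ('X_u ^+ r * pihomog mdeg e f).
  have [r hr] := hf u; exists r; rewrite -(@pihomogMl _ _ (1 * r)); first exact: hr.
  by apply: dhomogMn; rewrite dhomogX; apply/eqP; exact: mdeg1.
have cancel (y : 'rV[k]_N.+1) : y != 0 ->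
    (forall g, jet_zero g -> g.@[y 0] = 0) -> (pihomog mdeg e f).@[y 0] = 0.
  case/rV0Pn => u yu hy; have [r /hy] := key u; rewrite mevalM rmorphXn /= mevalXU.
  by move/eqP; rewrite mulf_eq0 expf_eq0 (negPf yu) andbF /= => /eqP.
have fx : (pihomog mdeg e f).@[x 0] = 0 by apply: cancel x_neq0 _ => g [].
split=> // [|i]; last by apply: cancel (z_neq0 i) _ => g [].
have /rV0Pn[u xu] := x_neq0; have [r [_ + _]] := key u.
rewrite dir_derivM fx mulr0 add0r rmorphXn /= mevalXU.
by move/eqP; rewrite mulf_eq0 expf_eq0 (negPf xu) andbF /= => /eqP.
Qed.

Definition jet_scheme : subscheme k N :=
  Subscheme jet_ideal0 jet_idealD jet_idealM jet_ideal_homog jet_ideal_sat.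

(** ** Its span *)

(** A coordinate of the projection onto a complement of [U]. *)
Lemma functional_outside (U : {vspace 'rV[k]_N.+1}) y : y \notin U ->
  exists l : {mpoly k[N.+1]}, [/\ l \is 1.-homog, l.@[y 0] != 0,
    (forall v : 'rV[k]_N.+1, v \in U -> l.@[v 0] = 0) & dir_deriv l = l.@[x' 0]].
Proof.
move=> yU; pose phi (v : 'rV[k]_N.+1) : 'rV[k]_N.+1 := v - projv U v.
have /rV0Pn[u yu] : phi y != 0.
  by apply: contraNneq yU => /subr0_eq ->; exact: memv_proj.
pose a v := phi (delta_mx 0 v) 0 u; pose l : {mpoly k[N.+1]} := \sum_v a v *: 'X_v.
have lE (v : 'rV[k]_N.+1) : l.@[v 0] = phi v 0 u.
  have -> : phi v = \sum_w v 0 w *: phi (delta_mx 0 w).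
    rewrite {1}(row_sum_delta v) /phi linear_sum -sumrB; apply: eq_bigr => w _.
    by rewrite linearZ /= -scalerBr.
  rewrite /l raddf_sum /= summxE; apply: eq_bigr => w _.
  by rewrite mevalZ mevalXU mxE mulrC.
exists l; split.
- by apply: rpred_sum => v _; apply: dhomogZ; rewrite dhomogX; apply/eqP; exact: mdeg1.
- by rewrite lE.
- by move=> v vU; rewrite lE /phi projv_id // subrr mxE.
rewrite /l raddf_sum /=; have -> : dir_deriv (\sum_v a v *: 'X_v) =
    \sum_v dir_deriv (a v *: 'X_v).
  apply: (big_morph _ dir_derivD); by rewrite -mpolyC0 dir_derivC.
by apply: eq_bigr => v _; rewrite dir_derivZ dir_derivX mevalZ mevalXU.
Qed.

(** The linear forms in the ideal of the scheme vanish at [x'] because they equal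
    their directional derivative. *)
Lemma jet_scheme_span p y : pline p = <[y]>%VS ->
  (forall U : {vspace 'rV[k]_N.+1}, x' \in U -> (forall i, z i \in U) -> y \in U) ->
  scheme_span jet_scheme p.
Proof.
move=> py hy U /= ZU; rewrite /linear_space /= py -memvE.
have van l : l \is 1.-homog -> 
      (forall v : 'rV[k]_N.+1, v \in U -> l.@[v 0] = 0) -> jet_zero l.
  move=> hl lU; apply/(jet_ideal_homogE hl); apply: ZU => q qU v vq.
  by apply: lU; exact: (subvP qU).
apply: hy => [|i]; apply: contraT => /functional_outside[l [hl ly lU lx']].
  by have [_ l' _] := van l hl lU; rewrite -lx' l' eqxx in ly.
by have [_ _ lz] := van l hl lU; rewrite lz eqxx in ly.
Qed.

(** ** Its support and its components *)

Lemma vanish_homog_line e f p y : f \is e.-homog -> pline p = <[y]>%VS ->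
  vanish f p <-> f.@[y 0] = 0.
Proof.
move=> hf py; split=> [h|fy v]; first by apply: h; rewrite py memv_line.
by rewrite py => /vlineP[c ->]; rewrite (meval_scale _ _ hf) fy mulr0.
Qed.

Definition base_pt : proj k N := pt x_neq0.
Definition simple_pt i : proj k N := pt (z_neq0 i).

(** A point outside is cut out by a product of linear forms; the one through [x]
    is squared to satisfy the condition on the derivative. *)
Lemma jet_scheme_supp : supp jet_scheme = [set base_pt] `|` range simple_pt.
Proof.
apply/seteqP; split=> p.
  move=> hp; apply: contrapT => /not_orP[pb ps].
  have [_ pE] := pline_spanned p; set y := vpick p in pE.
  have yx : independent_pair y x.
    by apply/(independent_linesP pE (erefl (pline base_pt))).
  have yz i : true -> independent_pair y (z i).
    move=> _; apply/(independent_linesP pE (erefl (pline (simple_pt i)))) => E.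
    by apply: ps; exists i.
  have [l [hl ly lx]] := separating_form yx.
  have [e [g [hg gy gz]]] := separating_product yz.
  have hlg : l * l * g \is (1 + 1 + e)%N.-homog by do 2?apply: dhomogM.
  have : jet_ideal (l * l * g).
    apply/(jet_ideal_homogE hlg); split=> [||i].
    - by rewrite !mevalM lx !mul0r.
    - by rewrite !dir_derivM !mevalM lx !(mul0r, mulr0, addr0).
    - by rewrite mevalM gz ?mulr0.
  move/hp/(vanish_homog_line hlg pE)/eqP; rewrite !mevalM !mulf_eq0.
  by rewrite (negPf ly) (negPf gy).
have van (y : 'rV[k]_N.+1) (y0 : y != 0) : (forall g, jet_zero g -> g.@[y 0] = 0) ->
    supp jet_scheme (pt y0).
  move=> hy f hf; apply/vanish_pihomogP => e.
  apply/(vanish_homog_line (pihomogP mdeg e f) (erefl (pline (pt y0)))).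
  by apply: hy; exact: hf.
case=> [->|[i _ <-]]; first by apply: van => g [].
by apply: van => g [].
Qed.

Lemma proj_closed1 p : closed [set p].
Proof.
suff -> : [set p] = closure [set p] by exact: closed_closure.
apply/seteqP; split=> [|q]; first exact: subset_closure.
move=> /closureP h; apply: contrapT => /nesym pq.
have [[_ pE] [_ qE]] := (pline_spanned p, pline_spanned q).
have /independent_pair_sym := (independent_linesP pE qE).1 pq.
case/separating_form=> l [hl lq lp].
have : vanish l q by apply: h => _ ->; apply/(vanish_homog_line hl pE).
by move/(vanish_homog_line hl qE)/eqP; rewrite (negPf lq).
Qed.

(** Points are closed, so finite sets are discrete. *)
Lemma finite_component (I : finType) (P : I -> proj k N) i :
  connected_component (range P) (P i) = [set P i].
Proof.
apply/seteqP; split=> q; last first.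
  by move=> ->; apply: connected_component_refl; exists i.
case=> C [Ci CP Cc] Cq; apply: contrapT => qi.
pose O := \bigcup_(j in [set j | P j <> P i]) [set P j].
have Ocl : closed O.
  pose others (r : seq I) := [set j | (j \in r) /\ P j <> P i].
  suff h (r : seq I) : closed (\bigcup_(j in others r) [set P j]).
    rewrite (_ : O = \bigcup_(j in others (enum I)) [set P j]) //.
    apply/seteqP; split=> y [j /= hj ->]; exists j => //=; last by case: hj.
    by split; rewrite ?mem_enum.
  elim: r => [|j r IH].
    rewrite (_ : \bigcup_(_ in _) _ = set0); first exact: closed0.
    by apply/seteqP; split=> y // [j [] /=].
  have [jE|jN] := pselect (P j = P i).
    rewrite (_ : \bigcup_(_ in _) _ = \bigcup_(j in others r) [set P j]) //.
    apply/seteqP; split=> y [l [lr lN] ->]; exists l => //; split=> //; last first.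
      by rewrite inE lr orbT.
    by move: lr; rewrite inE => /orP[/eqP El|//]; case: lN; rewrite El.
  rewrite (_ : \bigcup_(_ in _) _ = [set P j] `|`
    \bigcup_(j in others r) [set P j]).
    by apply: closedU => //; exact: proj_closed1.
  apply/seteqP; split=> y.
    case=> l [lr lN] ->; move: lr; rewrite inE => /orP[/eqP ->|lr]; first by left.
    by right; exists l.
  case=> [->|[l [lr lN] ->]]; first by exists j => //; split=> //; rewrite inE eqxx.
  by exists l => //; split=> //; rewrite inE lr orbT.
have E : C `&` [set P i] = C.
  apply: Cc.
  - by exists (P i).
  - exists (~` O); first exact: closed_openC.
    apply/seteqP; split=> y [Cy yi]; split=> //.
      by move=> [j jN yj]; apply: jN; rewrite -yj.
    apply: contrapT => ny; apply: yi; have [j _ jy] := CP _ Cy.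
    by exists j => //= jE; apply: ny; rewrite -jy.
  - by exists [set P i] => //; exact: proj_closed1.
by apply: qi; rewrite -E in Cq; case: Cq.
Qed.

Lemma jet_scheme_components :
  components jet_scheme = [set base_pt] |` range (fun i => [set simple_pt i]).
Proof.
pose P (i : option 'I_s) := if i is Some i then simple_pt i else base_pt.
have sE : supp jet_scheme = range P.
  rewrite jet_scheme_supp; apply/seteqP; split=> p.
    by case=> [->|[i _ <-]]; [exists None|exists (Some i)].
  by case=> -[i|] _ <-; [right; exists i|left].
rewrite /components sE; apply/seteqP; split=> C.
  case=> _ [i _ <-] <-; rewrite finite_component; case: i => [i|]; last by left.
  by right; exists i.
case=> [->|[i _ <-]].
  by exists base_pt; [exists None|exact: (finite_component P None)].
by exists (simple_pt i); [exists (Some i)|exact: (finite_component P (Some i))].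
Qed.

(** ** Degrees of its components *)

(** Near [x] the conditions at the other points are removed by multiplication with
    a form that vanishes there. *)
Lemma restrict_base f e : f \is e.-homog ->
  ideal (restrict jet_scheme [set base_pt]) f <-> f.@[x 0] = 0 /\ dir_deriv f = 0.
Proof.
move=> hf; split=> [/(_ base_pt erefl)[c [g [hg ng]]]|[f0 f'0] _ ->].
  have gx : g.@[x 0] != 0.
    by apply/eqP => g0; apply: ng; apply/(vanish_homog_line hg (erefl (pline base_pt))).
  move/(jet_ideal_homogE (dhomogM hg hf)) => [+ + _].
  rewrite mevalM dir_derivM => /eqP; rewrite mulf_eq0 (negPf gx) /= => /eqP fx.
  by rewrite fx mulr0 add0r => /eqP; rewrite mulf_eq0 (negPf gx) /= => /eqP.
have [c [g [hg gx gz]]] := separating_product (P := predT) (fun i _ => xz i).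
exists c, g; split=> //.
  by move/(vanish_homog_line hg (erefl (pline base_pt)))/eqP; rewrite (negPf gx).
apply/(jet_ideal_homogE (dhomogM hg hf)); split=> [||i].
- by rewrite mevalM f0 mulr0.
- by rewrite dir_derivM f0 f'0 !mulr0 addr0.
- by rewrite mevalM gz // mul0r.
Qed.

(** Here the form that removes the other conditions vanishes doubly at [x]. *)
Lemma restrict_simple i f e : f \is e.-homog ->
  ideal (restrict jet_scheme [set simple_pt i]) f <-> f.@[z i 0] = 0.
Proof.
move=> hf; split=> [/(_ (simple_pt i) erefl)[c [g [hg ng]]]|f0 _ ->].
  have gx : g.@[z i 0] != 0.
    apply/eqP => g0; apply: ng.
    by apply/(vanish_homog_line hg (erefl (pline (simple_pt i)))).
  move/(jet_ideal_homogE (dhomogM hg hf)) => [_ _ /(_ i)].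
  by rewrite mevalM => /eqP; rewrite mulf_eq0 (negPf gx) /= => /eqP.
have [l [hl lz lx]] := separating_form (independent_pair_sym (xz i)).
have zP j : j != i -> independent_pair (z i) (z j) by rewrite eq_sym => /zz.
have [c [g [hg gi gz]]] := separating_product zP.
have hlg : l * l * g \is (1 + 1 + c)%N.-homog by do 2?apply: dhomogM.
exists (1 + 1 + c)%N, (l * l * g); split=> //.
  move/(vanish_homog_line hlg (erefl (pline (simple_pt i))))/eqP.
  rewrite !mevalM !mulf_eq0.
  by rewrite (negPf lz) (negPf gi).
apply/(jet_ideal_homogE (dhomogM hlg hf)); split=> [||j].
- by rewrite !mevalM lx !mul0r.
- by rewrite !dir_derivM !mevalM lx !(mul0r, mulr0, addr0).
have [->|ji] := eqVneq j i; first by rewrite mevalM f0 mulr0.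
by rewrite !mevalM gz // mulr0 mul0r.
Qed.

(** The value and the derivative are coordinates on the forms of degree [e]
    modulo the ideal, with dual basis [l ^ e] and [l ^ (e - 1) * l'] for the
    linear forms [l], [l'] dual to [x], [x']. *)
Lemma restrict_base_degree :
  finite_of_degree (restrict jet_scheme [set base_pt]) 2.
Proof.
exists 1%N => e e1; have [u [v D0]] := xx'; set D := x 0 u * x' 0 v - _ in D0.
pose l := form2 u v (x' 0 v / D) (x' 0 u / D).
pose l' := form2 v u (x 0 u / D) (x 0 v / D).
have lx : l.@[x 0] = 1 by rewrite meval_form2 /D; field; exact: D0.
have l'x : l'.@[x 0] = 0 by rewrite meval_form2 /D; field; exact: D0.
have dl : dir_deriv l = 0 by rewrite dir_deriv_form2 /D; field; exact: D0.
have dl' : dir_deriv l' = 1 by rewrite dir_deriv_form2 /D; field; exact: D0.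
pose b (i : 'I_2) := if i == 0 then l ^+ e else l ^+ e.-1 * l'.
have hb i : b i \is e.-homog.
  have hX j : l ^+ j \is j.-homog.
    by rewrite -[X in X.-homog]mul1n; apply: dhomogMn; exact: homog_form2.
  rewrite /b; case: ifP => _ //; have eE : (e.-1 + 1 = e)%N by rewrite addn1 prednK.
  by rewrite -[X in X.-homog]eE; apply: dhomogM => //; exact: homog_form2.
exists b; split=> // f hf.
have hc (c : {ffun 'I_2 -> k}) : f - \sum_i c i *: b i \is e.-homog.
  by apply: rpredB => //; apply: rpred_sum => i _; exact: dhomogZ.
have ev (c : {ffun 'I_2 -> k}) : (f - \sum_i c i *: b i).@[x 0] = f.@[x 0] - c 0.
  rewrite big_ord_recl big_ord1 mevalB mevalD !mevalZ /b /= mevalM l'x mulr0.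
  by rewrite rmorphXn /= lx expr1n mulr1 mulr0 addr0.
have dv (c : {ffun 'I_2 -> k}) :
    dir_deriv (f - \sum_i c i *: b i) = dir_deriv f - c 1.
  rewrite -scaleN1r dir_derivD dir_derivZ big_ord_recl big_ord1 dir_derivD !dir_derivZ.
  rewrite /b /= dir_derivM !dir_deriv_exp // rmorphXn /= lx expr1n dl'.
  rewrite mulr0 mul0r !add0r mul1r mulr1 mulN1r; congr (_ - c _); exact/val_inj.
exists [ffun i => if i == 0 then f.@[x 0] else dir_deriv f]; split.
  apply/(restrict_base (hc _)); rewrite ev dv !ffunE /=.
  by rewrite !subrr.
move=> c /(restrict_base (hc _)); rewrite ev dv => -[/subr0_eq c0 /subr0_eq c1].
apply/ffunP => i; rewrite ffunE; case: eqP => [->//|i0]; rewrite c1; congr (c _).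
by apply/val_inj; case: i i0 => -[|[|]] //= ? h; case: h; exact/val_inj.
Qed.

Lemma restrict_simple_degree i :
  finite_of_degree (restrict jet_scheme [set simple_pt i]) 1.
Proof.
exists 0%N => e _; have /rV0Pn[u zu] := z_neq0 i.
pose l : {mpoly k[N.+1]} := form2 u u (z i 0 u)^-1 0.
have lz : l.@[z i 0] = 1 by rewrite meval_form2 mul0r subr0 mulVf.
have hX : l ^+ e \is e.-homog.
  by rewrite -[X in X.-homog]mul1n; apply: dhomogMn; exact: homog_form2.
exists (fun=> l ^+ e); split=> // f hf.
have hc (c : {ffun 'I_1 -> k}) : f - \sum_i c i *: l ^+ e \is e.-homog.
  by apply: rpredB => //; apply: rpred_sum => j _; exact: dhomogZ.
have ev (c : {ffun 'I_1 -> k}) :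
    (f - \sum_i c i *: l ^+ e).@[z i 0] = f.@[z i 0] - c 0.
  by rewrite mevalB big_ord1 mevalZ rmorphXn /= lz expr1n mulr1.
exists [ffun=> f.@[z i 0]]; split.
  by apply/(restrict_simple i (hc _)); rewrite ev ffunE subrr.
move=> c /(restrict_simple i (hc _)); rewrite ev => /subr0_eq E.
by apply/ffunP => j; rewrite ffunE E (ord1 j).
Qed.

Lemma jet_scheme_type : one_double_rest_simple jet_scheme s.
Proof.
exists [set base_pt], (fun i => [set simple_pt i]); split.
- move=> i j /seteqP[/(_ _ erefl) /= E _]; apply/eqP; apply: contraT => ij.
  have := (independent_linesP (erefl (pline (simple_pt i)))
    (erefl (pline (simple_pt j)))).2 (zz ij).
  by rewrite E.
- exact: jet_scheme_components.
- exact: restrict_base_degree.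
exact: restrict_simple_degree.
Qed.

End DoublePoint.

(** * Schemes on the Veronese variety *)

(** A function that vanishes on the Veronese variety vanishes along the curve
    [nu(v + s w)], hence so does its derivative. *)
Lemma veronese_jet_sub (k : closedFieldType) m d s (v w : 'rV[k]_m.+1)
    (y : 'I_s -> 'rV[k]_m.+1) f : v != 0 -> (forall i, y i != 0) ->
  (forall p, veronese_variety k m d p -> vanish f p) ->
  jet_ideal (veronese_vec d v) (veronese_diff d v w) (fun i => veronese_vec d (y i)) f.
Proof.
move=> v0 y0 fX e; set g := pihomog mdeg e f.
have gX x : x != 0 -> g.@[veronese_vec d x 0] = 0.
  move=> x0; have [p pX pE] := mem_veronese_line d x0.
  have /vanish_pihomogP/(_ e) : vanish f p by exact: fX.
  by move/(vanish_homog_line (pihomogP mdeg e f) pE).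
split=> [||i]; [exact: gX| |exact: gX].
pose G := mmap polyC (fun u => veronese_curve v w u) g.
have G0 : G = 0.
  have /rV0Pn[j vj] := v0; pose q : {poly k} := (v 0 j)%:P + (w 0 j)%:P * 'X.
  apply: (@poly_cofinite_eq0 _ _ q).
    apply: contraNneq vj => /(congr1 (fun p : {poly k} => p.[0])).
    by rewrite /q !hornerE ?mulr0 ?addr0 => ->.
  move=> s0 qs; rewrite horner_mmap -[RHS](gX (v + s0 *: w)).
    by apply: meval_eq => u; rewrite horner_veronese_curve.
  by apply: contraNneq qs => E; move/rowP/(_ j): E; rewrite !mxE !hornerE mulrC => ->.
have := congr1 (fun p : {poly k} => p^`().[0]) G0; rewrite deriv0 horner0 => <-.
rewrite /G deriv_mmap horner_sum; apply: eq_bigr => u _.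
rewrite hornerM horner_mmap deriv_veronese_curve; congr (_ * _).
by apply: meval_eq => u'; rewrite horner_veronese_curve scale0r addr0.
Qed.

(** * Distinct base points *)

Section Generic.
Variables (k : closedFieldType) (k_char0 : [pchar k] =i pred0) (m d t : nat).
Hypotheses (m0 : (0 < m)%N) (d0 : (0 < d)%N).
Variables (i0 i1 : 'I_t).
Hypotheses (i0E : i0 = 0%N :> nat) (i1E : i1 = 1%N :> nat).
Let N := veronese_dim m d.
Let A : {set 'I_t * 'I_m.+1} := [set~ (i0, ord0)]%SET.
Let e1 : 'I_m.+1 := inord 1.

Let degA : mdeg (U_(ord0 : 'I_m.+1) *+ d)%MM = d.
Proof. by rewrite mdegMn mdeg1 mul1n. Qed.
Let degB : mdeg (U_(ord0 : 'I_m.+1) *+ d.-1 + U_(e1))%MM = d.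
Proof. by rewrite mdegD mdegMn !mdeg1 mul1n addn1 prednK. Qed.

Let cA : 'I_N.+1 := sval (cid (mon_surj degA)).
Let cB : 'I_N.+1 := sval (cid (mon_surj degB)).

Let cAE : mon cA = (U_(ord0) *+ d)%MM. Proof. by rewrite /cA; case: cid. Qed.
Let cBE : mon cB = (U_(ord0) *+ d.-1 + U_(e1))%MM.
Proof. by rewrite /cB; case: cid. Qed.

Let power i (c : 'I_N.+1) := msubst (coord k A i) 'X_[mon c].
Let tangent (c : 'I_N.+1) :=
  \sum_j msubst (coord k A i0) ('X_[mon c])^`M(j) * coord k A i1 j.
Let others : pred ('I_t * 'I_t) :=
  fun p => [&& p.1 != i1, p.2 != i1 & (p.1 < p.2)%N].

(** The minors in the coordinates of [x_0^d] and [x_0^(d-1) x_1] alone: these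
    suffice generically to tell apart the points and the tangent direction. *)
Definition generic_minors : {mpoly k[#|{: {x | x \in A}}|]} :=
  (\prod_(p | others p)
     (power p.1 cA * power p.2 cB - power p.1 cB * power p.2 cA)) *
  (power i0 cA * tangent cB - power i0 cB * tangent cA).

Let powerE a i c : (power i c).@[a] = veronese_vec d (vec a i) 0 c.
Proof.
rewrite veronese_vecE meval_msubst; apply: meval_eq => j.
by rewrite mxE.
Qed.

Let tangentE a c : (tangent c).@[a] = veronese_diff d (vec a i0) (vec a i1) 0 c.
Proof.
rewrite mxE raddf_sum; apply: eq_bigr => j _ /=.
rewrite mevalM meval_msubst mxE; congr (_ * _).
by apply: meval_eq => j'; rewrite mxE.
Qed.

Let power_minorE a i j : (power i cA * power j cB - power i cB * power j cA).@[a] =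
  veronese_vec d (vec a i) 0 cA * veronese_vec d (vec a j) 0 cB -
  veronese_vec d (vec a i) 0 cB * veronese_vec d (vec a j) 0 cA.
Proof.
rewrite mevalB; congr (_ - _); rewrite [LHS]mevalM; congr (_ * _); exact: powerE.
Qed.

Let tangent_minorE a : (power i0 cA * tangent cB - power i0 cB * tangent cA).@[a] =
  veronese_vec d (vec a i0) 0 cA * veronese_diff d (vec a i0) (vec a i1) 0 cB -
  veronese_vec d (vec a i0) 0 cB * veronese_diff d (vec a i0) (vec a i1) 0 cA.
Proof.
rewrite mevalB; congr (_ - _); rewrite [LHS]mevalM; congr (_ * _);
  by [exact: powerE|exact: tangentE].
Qed.

Lemma generic_minorsP a : generic_minors.@[a] != 0 ->
  independent_pair (veronese_vec d (vec a i0)) (veronese_diff d (vec a i0) (vec a i1)) /\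
  forall i j, i != i1 -> j != i1 -> i != j ->
    independent_pair (veronese_vec d (vec a i)) (veronese_vec d (vec a j)).
Proof.
rewrite mevalM rmorph_prod mulf_eq0 negb_or => /andP[/prodf_neq0 hp].
rewrite tangent_minorE => ht; split; first by exists cA, cB.
have lt i j : i != i1 -> j != i1 -> (i < j)%N ->
    independent_pair (veronese_vec d (vec a i)) (veronese_vec d (vec a j)).
  move=> ni nj ij; have /hp : others (i, j) by rewrite /others /= ni nj ij.
  by rewrite /= power_minorE => h; exists cA, cB.
move=> i j ni nj; rewrite neq_ltn => /orP[ij|ji]; first exact: lt.
exact/independent_pair_sym/lt.
Qed.

(** The test vectors are [(1, i, 0, ..., 0)], with tangent direction
    [(0, 1, 0, ..., 0)] at the first one. *)
Lemma generic_minors_neq0 : generic_minors != 0.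
Proof.
pose x (i : 'I_t) : 'rV[k]_m.+1 :=
  if i == i1 then delta_mx 0 e1 else delta_mx 0 ord0 + (i : nat)%:R *: delta_mx 0 e1.
have e10 : (e1 == ord0) = false by rewrite -val_eqE /= inordK.
have i01 : (i0 == i1) = false by rewrite -val_eqE /= i0E i1E.
have x0 i : i != i1 -> x i 0 ord0 = 1.
  by move=> /negPf ni; rewrite /x ni !mxE !eqxx eq_sym e10 mulr0 addr0.
have x1 i : i != i1 -> x i 0 e1 = (i : nat)%:R.
  by move=> /negPf ni; rewrite /x ni !mxE !eqxx e10 mulr1 add0r.
have [i j|a aE] := @vec_surj k m t A x.
  by rewrite !inE negbK => /eqP[-> ->]; rewrite x0 // i01.
suff : generic_minors.@[a] != 0 by apply: contraNneq => ->; rewrite meval0.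
have vA i : i != i1 -> veronese_vec d (vec a i) 0 cA = 1.
  move=> ni; rewrite veronese_vecE cAE -mpolyXn rmorphXn /= mevalXU aE x0 //.
  exact: expr1n.
have vB i : i != i1 -> veronese_vec d (vec a i) 0 cB = (i : nat)%:R.
  move=> ni; rewrite veronese_vecE cBE mpolyXD -mpolyXn mevalM rmorphXn /= !mevalXU.
  by rewrite aE x0 // x1 // expr1n mul1r.
have diffE (c : 'I_N.+1) : veronese_diff d (vec a i0) (vec a i1) 0 c =
    dir_deriv (vec a i0) (vec a i1) 'X_[mon c] by rewrite mxE.
have tX0 : dir_deriv (vec a i0) (vec a i1) 'X_ord0 = 0.
  by rewrite dir_derivX aE /x eqxx mxE eqxx eq_sym e10.
have tA : veronese_diff d (vec a i0) (vec a i1) 0 cA = 0.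
  by rewrite diffE cAE -mpolyXn dir_deriv_exp.
have tB : veronese_diff d (vec a i0) (vec a i1) 0 cB = 1.
  rewrite diffE cBE mpolyXD -mpolyXn dir_derivM dir_deriv_exp // mul0r add0r.
  rewrite rmorphXn /= mevalXU dir_derivX aE x0 ?i01 // expr1n mul1r /x eqxx.
  by rewrite mxE !eqxx.
rewrite mevalM mulf_neq0 //; last first.
  rewrite tangent_minorE tA tB mulr0 subr0 vA ?i01 //.
  by rewrite mulr1 oner_neq0.
rewrite rmorph_prod; apply/prodf_neq0 => -[i j] /and3P[/= ni nj ij].
rewrite power_minorE !vA // !vB // mul1r mulr1 -natrB; last exact: ltnW.
by rewrite ((pcharf0P k).1 k_char0) -lt0n subn_gt0.
Qed.

End Generic.

(** * The divisor of the secant variety *)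

Lemma cone_dim_nonempty (k : closedFieldType) n (C : set (proj k n)) r :
  cone_dim_ge C r -> C !=set0.
Proof.
move=> [y yC]; apply: contrapT => /set0P/negP/negPn/eqP C0.
have /eqP : (1 : {mpoly k[r]}) = 0 by apply: yC => p; rewrite C0.
by rewrite oner_eq0.
Qed.

Lemma param_dim_neq0 (k : closedFieldType) n N (g : 'I_N.+1 -> {mpoly k[n]}) Q r :
  cone_dim_ge (closure (param_image g Q)) r -> exists u, g u != 0.
Proof.
move=> /cone_dim_nonempty[p pc]; apply: contrapT => h.
have g0 u : g u = 0 by apply/eqP; apply: contraT => gu; case: h; exists u.
have : vanish 1 p.
  apply: (closureP _ _).1 pc _ _ => q [a _ /pt_of_line/rV0Pn[u]].
  by rewrite mxE g0 meval0 eqxx.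
by move/(_ _ (memv_pick _)); rewrite meval1 => /eqP; rewrite oner_eq0.
Qed.

(** Each step of a chain adds one independent function. *)
Lemma irr_chain_dim (k : closedFieldType) n (A Y : set (proj k n)) e r :
  irr_chain A Y r -> cone_dim_ge (closure Y) e ->
  exists2 C : set (proj k n), C `<=` A & cone_dim_ge C (e + r).
Proof.
move=> [C [C0 CA CS]] Ye; exists (C r); first by case: (CA r (leqnn _)).
suff h i : (i <= r)%N -> cone_dim_ge (C i) (e + i) by exact: h.
elim: i => [_|i IH ir]; first by rewrite C0 addn0.
rewrite addnS; have [_ irr _] := CA _ ir; have [cl _ _] := CA i (ltnW ir).
exact: cone_dim_step irr cl (CS i ir) (IH (ltnW ir)).
Qed.

Theorem proposition1 (k : closedFieldType) (k_char0 : [pchar k] =i pred0)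
    (m d t : nat) (m_ge2 : (2 <= m)%N) (d_ge3 : (3 <= d)%N) (t_ge3 : (3 <= t)%N)
    (t_le : (t <= alpha m d - 1)%N) :
  exists Gamma1 : set (proj k (veronese_dim m d)),
    [/\ Gamma1 !=set0,
        irreducible Gamma1,
        constructible Gamma1,
        Gamma1 `<=` secant_variety t (veronese_variety k m d)
          /\ codimension (secant_variety t (veronese_variety k m d)) Gamma1 1
      & forall P, Gamma1 P ->
          exists Z : subscheme k (veronese_dim m d),
            [/\ sub_closed Z (veronese_variety k m d),
                scheme_span Z P
              & one_double_rest_simple Z (t - 2)]].
Proof.
have t1 : (1 < t)%N by exact: leq_trans t_ge3.
have m0 : (0 < m)%N by exact: leq_trans m_ge2.
have d0 : (0 < d)%N by exact: leq_trans d_ge3.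
pose i0 : 'I_t := Ordinal (ltnW t1); pose i1 : 'I_t := Ordinal t1.
have i01 : i0 != i1 by [].
have tm0 : (0 < t * m.+1)%N by rewrite muln_gt0 (ltnW t1).
have [|U [w [Udeg Ubasis Umin Uspec Umin0]]] := @separated_cells m d t m_ge2 d_ge3.
  by rewrite t1 /=; lia.
pose A : {set 'I_t * 'I_m.+1} := [set~ (i0, ord0)]%SET.
pose full : {set 'I_t * 'I_m.+1} := [set: 'I_t * 'I_m.+1]%SET.
pose phi := @power_sum k m d t full; pose psi := @tangent_sum k m d t A i0 i1.
pose Q : {mpoly k[#|{: {x | x \in A}}|]} := generic_minors k m d0 i0 i1.
have Q0 : Q != 0 by exact: generic_minors_neq0.
have one0 n : (1 : {mpoly k[n]}) != 0 := oner_neq0 _.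
have phi_stable : cone_stable phi by apply: power_sum_stable => // i j; rewrite inE.
have psi_stable : cone_stable psi.
  apply: tangent_sum_stable => // i j ni.
  by rewrite !inE xpair_eqE (negPf ni).
have phi_dim : cone_dim_ge (closure (param_image phi 1)) (t * m.+1).
  exact: (power_sum_dim Udeg Ubasis Umin i0 (one0 _)).
have psi_dim : cone_dim_ge (closure (param_image psi Q)) (t * m.+1 - 1).
  apply: (tangent_sum_dim k_char0 Udeg Ubasis Umin (i0 := i0) (i1 := i1)) => //.
  - by move=> r; apply: (Uspec i0 r).1.
  - by move=> r; apply: (Uspec i1 r).2.
  by move=> i r i2; apply: Umin0.
have phi0 := param_dim_neq0 phi_dim; have psi0 := param_dim_neq0 psi_dim.
have sE : secant_variety t (veronese_variety k m d) = closure (param_image phi 1).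
  exact: secant_varietyE.
have sub : param_image psi Q `<=` secant_variety t (veronese_variety k m d).
  exact: tangent_sum_secant.
have cphi : #|{: {x | x \in full}}| = (t * m.+1)%N.
  by rewrite card_coordinates cardsT card_prod !card_ord.
have cpsi : #|{: {x | x \in A}}| = (t * m.+1 - 1)%N.
  by rewrite card_coordinates cardsC1 card_prod !card_ord subn1.
exists (param_image psi Q); split.
- exact: param_image_point.
- exact: irreducible_param_image.
- exact: constructible_param_image.
- split=> //; rewrite sE in sub *; split; last first.
    move=> r /irr_chain_dim/(_ psi_dim)[C Cs Cdim].
    have := param_cone_dim phi_stable Cs Cdim; rewrite cphi.
    by lia.
  (* The chain consisting of the closure of the set and the secant variety. *)
  exists (fun i => if i == 0%N then closure (param_image psi Q)
                   else closure (param_image phi 1)); split=> //.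
    have cl : closure (param_image psi Q) `<=` closure (param_image phi 1).
      rewrite [X in _ `<=` X](closure_id _).1; last exact: closed_closure.
      exact: closure_subset.
    move=> [|i] _ /=; (split; [exact: closed_closure|apply: irreducible_closure|]) => //.
      exact: irreducible_param_image.
    exact: irreducible_param_image.
  move=> [|i] //= _; split.
    rewrite [X in _ `<=` X](closure_id _).1; last exact: closed_closure.
    exact: closure_subset.
  move=> /(param_cone_dim psi_stable)/(_ phi_dim); rewrite cpsi.
  by lia.
move=> P [a /generic_minorsP[xx' xz] PE].
have s_lt (i : 'I_(t - 2)) : (i.+2 < t)%N by have := ltn_ord i; lia.
pose s i : 'I_t := Ordinal (s_lt i).
pose x := veronese_vec d (vec a i0); pose x' := veronese_diff d (vec a i0) (vec a i1).
pose z i := veronese_vec d (vec a (s i)).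
have xz' i : independent_pair x (z i) by exact: xz.
have zz i j : i != j -> independent_pair (z i) (z j) by move=> ij; exact: xz.
have ver0 (v : 'rV[k]_m.+1) : veronese_vec d v != 0 -> v != 0.
  apply: contraNneq => ->; rewrite -(scale0r 0) veronese_vecZ expr0n.
  by rewrite eqn0Ngt d0 scale0r.
exists (jet_scheme xx' xz'); split; last exact: jet_scheme_type.
- move=> f; apply: veronese_jet_sub => [|i]; apply: ver0.
    exact: independent_pair_neq0 xx'.
  exact: independent_pair_neq0 (independent_pair_sym (xz' i)).
apply: (jet_scheme_span PE) => V x'V zV.
rewrite tangent_sum_vec; apply: rpredD => //; apply: rpred_sum => i /andP[n0 n1].
have i2 : (i - 2 < t - 2)%N.
  by have := ltn_ord i; move: n0 n1; rewrite -!val_eqE /=; lia.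
have := zV (Ordinal i2); rewrite /z (_ : s _ = i) //; apply/val_inj => /=.
by move: n0 n1; rewrite -!val_eqE /=; lia.
Qed.
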